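(* For each $n \in \mathbf{N}$, let $W_n = (w_{ij}^{(n)})_{i,j=1}^n$ be a random $n \times n$ real symmetric matrix whose upper triangular entries $w_{ij}^{(n)}$, $1\le i\le j\le n$, are jointly independent and have symmetric distributions. Assume that $W_1, W_2, \ldots$ are defined on the same probability space. Assume that $w_{i_nj_n}^{(n)} \Rightarrow 0$ in distribution as $n \to \infty$ for any choice of $i_n,j_n \in \{1,\ldots,n\}$ for each $n \in \mathbf{N}$. If also $\sum_{j=1}^n w_{i_nj}^{(n)} \Rightarrow N(0,1)$ in distribution for any choice of $i_n \in \{1,\ldots,n\}$ for each $n \in \mathbf{N}$, then almost surely $\mu_{W_n} \Rightarrow \mu_{\mathrm{sc}}$ as $n \to \infty$.
   Context: Upper triangular entries include the diagonal. A random variable $X$ has a symmetric distribution if $X$ and $-X$ have the same distribution. $N(0,1)$ is the standard normal distribution. For an $n\times n$ Hermitian (e.g. real symmetric) matrix $A$ with eigenvalues $\lambda_1(A)\ge\cdots\ge\lambda_n(A)$ (with multiplicity), $\mu_A := \frac1n\sum_{i=1}^n \delta_{\lambda_i(A)}$. The semicircle distribution is $\mu_{\mathrm{sc}}(dx) = \frac{1}{2\pi}\sqrt{(4-x^2)_+}\,dx$, where $x_+=\max\{x,0\}$. *)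

(* Defs.v *)
From HB Require Import structures.
From mathcomp Require Import all_boot all_order all_algebra.
From mathcomp Require Import all_classical all_reals all_analysis.
Set Implicit Arguments. Unset Strict Implicit. Unset Printing Implicit Defensive.
Import Order.TTheory GRing.Theory Num.Theory.
Import numFieldNormedType.Exports.
Local Open Scope classical_set_scope.
Local Open Scope ring_scope.

Definition bounded_continuous {R : realType} (f : R -> R) : Prop :=
  continuous f /\ exists M : R, forall x, `|f x| <= M.

(* The eigenvalues lambda_1(A) >= ... >= lambda_n(A) of a square matrix,
   with multiplicity: the nonincreasing list s such that the characteristic
   polynomial of A is prod_{x in s} (X - x).  For real symmetric A such a
   list exists (spectral theorem) and is unique. *)
Definition eigvals {R : realType} (n : nat) (A : 'M[R]_n) : seq R :=
  xget [::] [set s : seq R | sorted (>=%R) s /\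
                            char_poly A = \prod_(x <- s) ('X - x%:P)].

Definition esd_integral {R : realType} (n : nat) (A : 'M[R]_n) (f : R -> R) : R :=
  (n%:R)^-1 * \sum_(x <- eigvals A) f x.

Definition semicircle_density {R : realType} (x : R) : R :=
  (2 * pi)^-1 * Num.sqrt (Num.max (4 - x ^+ 2) 0).

(* Main.v *)
(** Write [(V - i y)^-1 = A + i b] for the resolvent, split into its real and
imaginary part.

Row sums. By symmetry and independence, the characteristic function of a row
sum is the product of the real functions [phi_ij (t) = E cos (t w_ij)], each
close to [1]; hence [sum_j (1 - phi_ij (t)) -> t^2 / 2] uniformly in [i].
Comparing [cos] at [2 t] and [4 t] gives [sum_j E sin^2 (t w_ij) -> t^2] and
[sum_j E sin^4 (t w_ij) -> 0], and averaging [1 - cos] over small [t] controls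
large entries.  So for every [eps] the truncations [v_ij] of [w_ij] at level
[eps] satisfy [sum_j P (v_ij <> w_ij) -> 0] and [sum_j E v_ij^2 -> 1].

Resolvent.  The Schur complement with respect to row [i] says
[1 + i y G_ii + Q_i G_ii = v_ii G_ii] with [Q_i] a quadratic form in the row
[i], whose coefficients do not depend on that row.  It concentrates, so
[1 + i y G_ii + (sum_j s_ij G_jj) G_ii] is small in mean, [s_ij = E v_ij^2].
For [y >= 4] this system contracts towards its constant solution [i beta],
[y beta + beta^2 = 1].  Replacing one row and column of the matrix moves
[tr A] and [tr b] by at most [4 / y], which bounds the cost of truncation and,
through a martingale bound and Borel-Cantelli, yields almost sure convergence.

Weak convergence.  Partial fractions and uniform limits turn convergence at
the countably many poles [y^2 = 16 + 1 / m] and [y^2 = 16] into convergence of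
[p (u)] and [x u p (u)], [u = 1 / (x^2 + 16)], for all polynomials [p]; by
Weierstrass these approximate every continuous compactly supported function,
and no mass escapes because the semicircle law is a probability on [-2, 2]. *)

Require Import Defs.
From HB Require Import structures.
From mathcomp Require Import all_boot all_order all_algebra.
From mathcomp Require complex.
From mathcomp Require Import all_classical all_reals all_analysis.
From mathcomp Require Import measurable_realfun ring lra.
Import Order.TTheory GRing.Theory Num.Theory.
Import numFieldNormedType.Exports.
Local Open Scope classical_set_scope.
Local Open Scope ring_scope.
Set Implicit Arguments. Unset Strict Implicit. Unset Printing Implicit Defensive.

(** * Bounded random variables *)

(** No moment of an entry is assumed, only limits against bounded continuous functions. Hence every
    integrand below is bounded, the variances [s_ij] are extracted from sines and cosines, and the
    matrix is truncated before its resolvent is analysed. The hypotheses speak of one sequence of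
    indices at a time; choosing the worst index for each [n] makes them uniform over rows.

    Conditioning is replaced by resampling: for a symmetric set of marked positions,
    [E F (W) = E E' F (mix W W')], with marked entries from [W] and the others from a copy. This
    isolates one row for the quadratic form and also drives the martingale bound.

    The constant [4]: the variances of a row sum to at most [2], products of two unknowns cost
    another factor [2], and entries of [G] are at most [1 / y], so the feedback in the system is at
    most [4 / y] times the largest deviation, against a coefficient [y] on the left. Resolvents are
    pairs of real matrices, so that order and measurability stay over the reals; complex numbers
    enter only through the spectral theorem. *)

Section Expectation.
Context (R : realType) (d : measure_display) (T : measurableType d).
Implicit Types (f g : T -> R).

Definition bmeas f := measurable_fun setT f /\ exists M : R, forall x, `|f x| <= M.

Lemma bmeas_cst (c : R) : bmeas (fun=> c).
Proof. by split; [exact: measurable_cst|exists `|c|]. Qed.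

Lemma bmeasD f g : bmeas f -> bmeas g -> bmeas (fun x => f x + g x).
Proof.
move=> [mf [M fM]] [mg [N gN]]; split; first exact: measurable_funD.
by exists (M + N) => x; rewrite (le_trans (ler_normD _ _))// lerD.
Qed.

Lemma bmeasN f : bmeas f -> bmeas (fun x => - f x).
Proof.
move=> [mf [M fM]]; split; first exact: measurableT_comp.
by exists M => x; rewrite normrN.
Qed.

Lemma bmeasB f g : bmeas f -> bmeas g -> bmeas (fun x => f x - g x).
Proof. by move=> mf mg; apply: bmeasD => //; exact: bmeasN. Qed.

Lemma bmeasM f g : bmeas f -> bmeas g -> bmeas (fun x => f x * g x).
Proof.
move=> [mf [M fM]] [mg [N gN]]; split; first exact: measurable_funM.
by exists (M * N) => x; rewrite normrM ler_pM.
Qed.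

Lemma bmeasX f n : bmeas f -> bmeas (fun x => f x ^+ n).
Proof.
move=> mf; elim: n => [|n IH]; first exact: bmeas_cst.
by under eq_fun do rewrite exprS; exact: bmeasM.
Qed.

Lemma bmeas_norm f : bmeas f -> bmeas (fun x => `|f x|).
Proof.
move=> [mf [M fM]]; split; first exact: measurableT_comp.
by exists M => x; rewrite normr_id.
Qed.

Lemma bmeas_sum (I : Type) (r : seq I) (p : pred I) (F : I -> T -> R) :
  (forall i, p i -> bmeas (F i)) -> bmeas (fun x => \sum_(i <- r | p i) F i x).
Proof.
move=> mF; elim: r => [|i r IH].
  by under eq_fun do rewrite big_nil; exact: bmeas_cst.
rewrite (_ : (fun _ => _) = fun x => if p i then F i x + \sum_(j <- r | p j) F j x
    else \sum_(j <- r | p j) F j x); last by apply/funext => x; rewrite big_cons.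
by case: (boolP (p i)) => // pi; apply: bmeasD => //; exact: mF.
Qed.

Lemma bmeas_comp (h : R -> R) f : measurable_fun setT f ->
  measurable_fun setT h -> (exists M : R, forall x, `|h x| <= M) ->
  bmeas (fun x => h (f x)).
Proof.
move=> mf mh [M hM]; split; first exact: measurableT_comp.
by exists M => x; exact: hM.
Qed.

Lemma measurable_superlevel f (e : R) : measurable_fun setT f -> measurable [set x | e <= f x].
Proof.
move=> mf; rewrite -[X in measurable X]setTI.
have -> : [set x | e <= f x] = f @^-1` `[e, +oo[%classic.
  by apply/seteqP; split => x /=; rewrite in_itv/= andbT.
by apply: mf => //; exact: measurable_itv.
Qed.

Variable P : probability T R.

Definition expect f : R := \int[P]_w f w.

Lemma bmeas_integrable f : bmeas f -> P.-integrable setT (EFin \o f).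
Proof.
move=> [mf [M fM]]; apply: measurable_bounded_integrable => //.
  by rewrite (le_lt_trans (probability_le1 _ _))// ltry.
exists M; split; first exact: num_real.
by move=> x Mx y _ /=; rewrite (le_trans (fM y))// ltW.
Qed.

Lemma expectE f : bmeas f -> (\int[P]_w (f w)%:E)%E = (expect f)%:E.
Proof.
move=> mf; rewrite /expect /Rintegral fineK//.
exact: integrable_fin_num (bmeas_integrable mf).
Qed.

Lemma eq_expect f g : f =1 g -> expect f = expect g.
Proof. by move=> fg; congr expect; exact: funext. Qed.

Lemma expect_cst (c : R) : expect (fun=> c) = c.
Proof.
rewrite /expect Rintegral_cst// [X in fine X](_ : _ = 1%E) ?mulr1//.
exact: probability_setT.
Qed.

Lemma expectD f g : bmeas f -> bmeas g ->
  expect (fun x => f x + g x) = expect f + expect g.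
Proof. by move=> mf mg; rewrite /expect RintegralD//; exact: bmeas_integrable. Qed.

Lemma expectB f g : bmeas f -> bmeas g ->
  expect (fun x => f x - g x) = expect f - expect g.
Proof. by move=> mf mg; rewrite /expect RintegralB//; exact: bmeas_integrable. Qed.

Lemma expectZ (c : R) f : bmeas f -> expect (fun x => c * f x) = c * expect f.
Proof. by move=> mf; rewrite /expect RintegralZl//; exact: bmeas_integrable. Qed.

Lemma expectN f : bmeas f -> expect (fun x => - f x) = - expect f.
Proof.
by move=> mf; rewrite -mulN1r -expectZ//; apply: eq_expect => x; rewrite mulN1r.
Qed.

Lemma expect_sum (I : Type) (r : seq I) (p : pred I) (F : I -> T -> R) :
  (forall i, p i -> bmeas (F i)) ->
  expect (fun x => \sum_(i <- r | p i) F i x) = \sum_(i <- r | p i) expect (F i).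
Proof.
move=> mF; elim: r => [|i r IH].
  by rewrite big_nil; under eq_expect do rewrite big_nil; exact: expect_cst.
rewrite big_cons; under eq_expect do rewrite big_cons.
case: ifPn => // pi; rewrite expectD ?IH//; first exact: mF.
exact: bmeas_sum.
Qed.

Lemma expect_le f g : bmeas f -> bmeas g -> (forall x, f x <= g x) ->
  expect f <= expect g.
Proof.
by move=> mf mg fg; apply: le_Rintegral => //; exact: bmeas_integrable.
Qed.

Lemma expect_ge0 f : (forall x, 0 <= f x) -> 0 <= expect f.
Proof. by move=> f0; apply: Rintegral_ge0. Qed.

Lemma expect_norm f : bmeas f -> `|expect f| <= expect (fun x => `|f x|).
Proof. by move=> mf; apply: le_normr_Rintegral => //; exact: bmeas_integrable. Qed.

Lemma expect_le_cst f (c : R) : bmeas f -> (forall x, f x <= c) -> expect f <= c.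
Proof.
by move=> mf fc; rewrite -[leRHS]expect_cst expect_le//; exact: bmeas_cst.
Qed.

Lemma expect_norm_le_cst f (c : R) : bmeas f -> (forall x, `|f x| <= c) ->
  `|expect f| <= c.
Proof.
move=> mf fc; rewrite (le_trans (expect_norm mf))// expect_le_cst//.
exact: bmeas_norm.
Qed.

(* [0 <= E (|f| - E|f|)^2] *)
Lemma expect_norm_sqr f : bmeas f -> expect (fun x => `|f x|) ^+ 2 <= expect (fun x => f x ^+ 2).
Proof.
move=> mf; have mn := bmeas_norm mf; set m := expect (fun x => `|f x|).
have := @expect_ge0 (fun x => (`|f x| - m) ^+ 2) (fun x => sqr_ge0 _).
have -> : expect (fun x => (`|f x| - m) ^+ 2) =
    expect (fun x => (f x ^+ 2 - (2 * m) * `|f x|) + m ^+ 2).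
  apply: eq_expect => x; rewrite sqrrB real_normK ?num_real//.
  by congr (_ - _ + _); rewrite -mulr_natl -mulrA [m * _]mulrC.
have mX : bmeas (fun x => f x ^+ 2) by exact: bmeasX.
have mZ : bmeas (fun x => 2 * m * `|f x|) by apply: bmeasM => //; exact: bmeas_cst.
have mc : bmeas (fun=> m ^+ 2 : R) by exact: bmeas_cst.
have mB : bmeas (fun x => f x ^+ 2 - 2 * m * `|f x|) by exact: bmeasB.
by rewrite expectD// expectB// expectZ// expect_cst -/m; lra.
Qed.

Lemma expect_indic (A : set T) : measurable A -> expect (\1_A) = fine (P A).
Proof. by move=> mA; rewrite /expect /Rintegral integral_indic// setIT. Qed.

Lemma bmeas_indic (A : set T) : measurable A -> bmeas (\1_A).
Proof.
move=> mA; split; first exact: measurable_indic.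
by exists 1 => x; rewrite indicE; case: (_ \in _); rewrite ?normr1 ?normr0.
Qed.

End Expectation.

(** * Random matrices and decoupling of entries *)

Section MatrixBorel.
Context (R : realType) (n : nat).

(** Measurable boxes: a class stable under intersection, from which the Dynkin inductions below can
    start. *)
Definition cylinder : set (set 'M[R]_n) :=
  [set A | exists2 B : 'I_n -> 'I_n -> set R, (forall i j, measurable (B i j)) &
     A = [set M : 'M[R]_n | forall i j, B i j (M i j)]].

(* Square matrices with the Borel sigma-algebra. *)
Definition bmatrix := g_sigma_algebraType cylinder.
HB.instance Definition _ := Measurable.on bmatrix.

Lemma measurable_forall2 d (X : measurableType d) (B : 'I_n -> 'I_n -> set X) :
  (forall i j, measurable (B i j)) -> measurable [set x | forall i j, B i j x].
Proof.
move=> mB.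
have -> : [set x | forall i j, B i j x] =
    \bigcap_(i in [set: 'I_n]) \bigcap_(j in [set: 'I_n]) B i j.
  by apply/seteqP; split => x /= h; [move=> i _ j _; exact: h|move=> i j; exact: h].
apply: fin_bigcap_measurable => // i _.
by apply: fin_bigcap_measurable.
Qed.

Lemma measurable_bmatrix d (X : measurableType d) (M : X -> bmatrix) :
  (forall i j, measurable_fun setT (fun x => (M x : 'M[R]_n) i j)) ->
  measurable_fun setT M.
Proof.
move=> mM; have h := @measurability _ _ X bmatrix setT M cylinder; apply: h => //.
move=> _ [_ [B mB ->] <-]; rewrite setTI.
apply: measurable_forall2 => i j.
by rewrite -[X in measurable X]setTI; exact: mM.
Qed.

Lemma measurable_entry (i j : 'I_n) :
  measurable_fun [set: bmatrix] (fun M : bmatrix => (M : 'M[R]_n) i j).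
Proof.
move=> _ B mB; rewrite setTI; apply: sub_sigma_algebra.
exists (fun k l => if (k == i) && (l == j) then B else setT).
  by move=> k l; case: ifP.
apply/seteqP; split => M /=.
  by move=> BM k l; case: ifP => // /andP[/eqP -> /eqP ->].
by move=> /(_ i j); rewrite !eqxx.
Qed.

Definition mix (e : 'I_n -> 'I_n -> bool) (A B : 'M[R]_n) : 'M[R]_n :=
  \matrix_(i, j) if e i j then A i j else B i j.

Lemma measurable_mix d (X : measurableType d) e (A B : X -> bmatrix) :
  measurable_fun setT A -> measurable_fun setT B ->
  measurable_fun setT (fun x => mix e (A x) (B x) : bmatrix).
Proof.
move=> mA mB; apply: measurable_bmatrix => i j.
rewrite (_ : (fun _ => _) = if e i j then fun x => (A x : 'M[R]_n) i j else
    fun x => (B x : 'M[R]_n) i j); last first.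
  by apply/funext => x; rewrite !mxE; case: ifP.
by case: ifP => _; [exact: (measurableT_comp (measurable_entry i j) mA)|
  exact: (measurableT_comp (measurable_entry i j) mB)].
Qed.

End MatrixBorel.

(** Together with [indep_bigcup], the closure steps of the Dynkin inductions: the events independent
    of [B] form a Dynkin system. *)
Lemma indep_setC (R : realType) d (T : measurableType d) (P : probability T R) (A B : set T) :
  measurable A -> measurable B -> P (A `&` B) = (P A * P B)%E ->
  P (~` A `&` B) = (P (~` A) * P B)%E.
Proof.
move=> mA mB AB.
have fin C : measurable C -> P C \is a fin_num by move=> mC; exact: fin_num_measure.
have E : (P B = P (A `&` B) + P (~` A `&` B))%E.
  rewrite -measureU ?setIUl -?setIUl; last by rewrite setIACA setICr set0I.
  - by rewrite setUv setTI.
  - exact: measurableI.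
  - by apply: measurableI => //; exact: measurableC.
have mAC := measurableC mA.
move: E; rewrite AB probability_setC//.
rewrite -(fineK (fin _ mA)) -(fineK (fin _ mB)) -(fineK (fin _ (measurableI _ _ mAC mB))).
rewrite -EFinM -EFinD -EFinB -EFinM => -[E]; congr EFin; lra.
Qed.

Lemma indep_bigcup (R : realType) d (T : measurableType d) (P : probability T R)
    (A : (set T)^nat) (B : set T) :
  (forall k, measurable (A k)) -> trivIset setT A -> measurable B ->
  (forall k, P (A k `&` B) = (P (A k) * P B)%E) ->
  P ((\bigcup_k A k) `&` B) = (P (\bigcup_k A k) * P B)%E.
Proof.
move=> mA tA mB AB; rewrite setI_bigcupl !measure_bigcup//; last 2 first.
- by move=> k _; exact: measurableI.
- move=> i j _ _ [w [[Ai _] [Aj _]]]; apply: (tA i j) => //.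
  by exists w.
have fB : P B \is a fin_num by exact: fin_num_measure.
rewrite muleC -[in RHS](fineK fB) -nneseriesZl//.
apply: eq_eseriesr => k _; transitivity (P (A k) * P B)%E; first exact: AB.
by rewrite muleC fineK.
Qed.

Section Decoupling.
Context (R : realType) (d : measure_display) (T : measurableType d).
Variables (P : probability T R) (n : nat) (W : T -> 'M[R]_n).

Definition mx_measurable := forall i j, measurable_fun setT (fun w => W w i j).

Definition mx_symmetric := forall w, (W w)^T = W w.

(** Independence of every subfamily is included: taking [B i j] to be the full set drops the
    constraint on an entry. *)
Definition upper_independent := forall B : 'I_n -> 'I_n -> set R,
  (forall i j, measurable (B i j)) ->
  P [set w | forall i j : 'I_n, (i <= j)%N -> B i j (W w i j)] =
  (\prod_(i < n) \prod_(j < n | (i <= j)%N) P [set w | B i j (W w i j)])%E.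

Hypotheses (mW : mx_measurable) (symW : mx_symmetric) (indW : upper_independent).

Lemma bmeas_mx (F : bmatrix R n -> R) : bmeas F -> bmeas (fun w => F (W w)).
Proof.
move=> [mF [M FM]]; split; last by exists M => w.
by apply: (measurableT_comp mF); exact: measurable_bmatrix.
Qed.

Section Split.
(** Marks positions, symmetrically: an entry and its mirror image are the same random variable and
    must fall on the same side. *)
Variable e : 'I_n -> 'I_n -> bool.
Hypothesis esym : forall i j, e i j = e j i.

Let cyl_set (B : 'I_n -> 'I_n -> set R) := [set w | forall i j, B i j (W w i j)].

Let cyl_setE B : (forall i j, measurable (B i j)) ->
  P (cyl_set B) =
  (\prod_(i < n) \prod_(j < n | (i <= j)%N) P [set w | (B i j `&` B j i) (W w i j)])%E.
Proof.
move=> mB; rewrite -(indW (B := fun i j => B i j `&` B j i)); last first.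
  by move=> i j; exact: measurableI.
congr (P _); apply/seteqP; split => w /=.
  by move=> h i j _; split => //; rewrite -{1}symW mxE; exact: h.
move=> h i j; case: (leqP i j) => [/h[]//|/ltnW/h[_]].
by rewrite -{1}symW mxE.
Qed.

Let mcyl_set B : (forall i j, measurable (B i j)) -> measurable (cyl_set B).
Proof.
move=> mB; apply: measurable_forall2 => i j.
by rewrite -[X in measurable X]setTI; exact: mW.
Qed.

Let on (B : 'I_n -> 'I_n -> set R) i j := if e i j then B i j else setT.
Let off (B : 'I_n -> 'I_n -> set R) i j := if e i j then setT else B i j.

Let indep_cyl B C : (forall i j, measurable (B i j)) ->
  (forall i j, measurable (C i j)) ->
  P (cyl_set (on B) `&` cyl_set (off C)) = (P (cyl_set (on B)) * P (cyl_set (off C)))%E.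
Proof.
move=> mB mC.
have mon i j : measurable (on B i j) by rewrite /on; case: ifP.
have moff i j : measurable (off C i j) by rewrite /off; case: ifP.
have -> : cyl_set (on B) `&` cyl_set (off C) =
    cyl_set (fun i j => on B i j `&` off C i j).
  apply/seteqP; split => w /=; first by move=> [h k] i j; split; [exact: h|exact: k].
  by move=> h; split => i j; have [] := h i j.
rewrite !cyl_setE//; last by move=> i j; exact: measurableI.
rewrite -big_split/=; apply: eq_bigr => i _; rewrite -big_split/=.
apply: eq_bigr => j _; rewrite /on /off -(esym i j); case: (e i j).
  rewrite [X in (_ * P X)%E](_ : _ = setT); last by apply/seteqP; split.
  rewrite probability_setT mule1; congr (P _).
  by apply/seteqP; split => x /=; tauto.
rewrite [X in (P X * _)%E](_ : _ = setT); last by apply/seteqP; split.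
rewrite probability_setT mul1e; congr (P _).
by apply/seteqP; split => x /=; tauto.
Qed.

Let Won w : bmatrix R n := mix e (W w) 0.
Let Woff w : bmatrix R n := mix e 0 (W w).

Let mWb : measurable_fun setT (W : T -> bmatrix R n).
Proof. exact: measurable_bmatrix. Qed.
Let mWon : measurable_fun setT Won.
Proof. by apply: measurable_mix. Qed.
Let mWoff : measurable_fun setT Woff.
Proof. by apply: measurable_mix. Qed.

Let cylI : setI_closed (@cylinder R n).
Proof.
move=> _ _ [B mB ->] [C mC ->]; exists (fun i j => B i j `&` C i j).
  by move=> i j; exact: measurableI.
apply/seteqP; split => w /=; first by move=> [h k] i j; split; [exact: h|exact: k].
by move=> h; split => i j; have [] := h i j.
Qed.

Let cylT : (@cylinder R n) setT.
Proof. by exists (fun _ _ => setT) => //; apply/seteqP; split. Qed.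

(** The unmarked entries of [Won] are the constant [0], so the preimage of a box is either empty or
    constrains marked entries only; [b] records which case holds. *)
Let Won_cyl B : (forall i j, measurable (B i j)) ->
  exists (b : bool) (B' : 'I_n -> 'I_n -> set R), (forall i j, measurable (B' i j)) /\
  Won @^-1` [set M : 'M[R]_n | forall i j, B i j (M i j)] =
    if b then cyl_set (on B') else set0.
Proof.
move=> mB; exists `[<forall i j, ~~ e i j -> B i j 0>], B; split => //.
case: asboolP => h; apply/seteqP; split => w //=.
- by move=> k i j; have := k i j; rewrite mxE /on; case: (e i j).
- by move=> k i j; have := k i j; rewrite mxE /on; case: (boolP (e i j)) => // eij _;
    rewrite mxE; exact: h.
- by move=> k; apply: h => i j eij; have := k i j; rewrite mxE (negbTE eij) mxE.
Qed.

Let Woff_cyl B : (forall i j, measurable (B i j)) ->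
  exists (b : bool) (B' : 'I_n -> 'I_n -> set R), (forall i j, measurable (B' i j)) /\
  Woff @^-1` [set M : 'M[R]_n | forall i j, B i j (M i j)] =
    if b then cyl_set (off B') else set0.
Proof.
move=> mB; exists `[<forall i j, e i j -> B i j 0>], B; split => //.
case: asboolP => h; apply/seteqP; split => w //=.
- by move=> k i j; have := k i j; rewrite mxE /off; case: (e i j).
- by move=> k i j; have := k i j; rewrite mxE /off; case: (boolP (e i j)) => // eij _;
    rewrite mxE; exact: h.
- by move=> k; apply: h => i j eij; have := k i j; rewrite mxE eij mxE.
Qed.

(** Dynkin induction in [A] with [C] a box; [indep2] then runs it in [C] with [A] an arbitrary
    measurable set. *)
Let indep1 (A C : set (bmatrix R n)) : measurable A -> cylinder C ->
  P (Won @^-1` A `&` Woff @^-1` C) = (P (Won @^-1` A) * P (Woff @^-1` C))%E.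
Proof.
move=> mA cC.
have mWA (S : set (bmatrix R n)) : measurable S -> measurable (Won @^-1` S).
  by move=> mS; rewrite -[X in measurable X]setTI; exact: mWon.
have mC : measurable (Woff @^-1` C).
  by rewrite -[X in measurable X]setTI; apply: mWoff => //; exact: sub_sigma_algebra.
have fC : P (Woff @^-1` C) \is a fin_num by exact: fin_num_measure.
suff : forall A, <<s (@cylinder R n) >> A ->
    P (Won @^-1` A `&` Woff @^-1` C) = (P (Won @^-1` A) * P (Woff @^-1` C))%E by exact.
apply: (@dynkin_induction _ (bmatrix R n)) => //.
- by rewrite !preimage_setT setTI probability_setT mul1e.
- move=> _ [B mB ->]; case: cC => [B2 mB2 CE]; rewrite CE.
  have [b [B' [mB' ->]]] := Won_cyl mB; have [b2 [B2' [mB2' ->]]] := Woff_cyl mB2.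
  case: b; last by rewrite set0I measure0 mul0e.
  case: b2; last by rewrite setI0 measure0 mule0.
  exact: indep_cyl.
- by move=> S mS IH; apply: indep_setC => //; exact: mWA.
- move=> F mF tF IH; rewrite preimage_bigcup; apply: indep_bigcup => //.
  + by move=> k; exact: mWA.
  + by move=> i j _ _ [w [Fi Fj]]; apply: (tF i j) => //; exists (Won w).
Qed.

Let indep2 (A C : set (bmatrix R n)) : measurable A -> measurable C ->
  P (Won @^-1` A `&` Woff @^-1` C) = (P (Won @^-1` A) * P (Woff @^-1` C))%E.
Proof.
move=> mA.
have mWC (S : set (bmatrix R n)) : measurable S -> measurable (Woff @^-1` S).
  by move=> mS; rewrite -[X in measurable X]setTI; exact: mWoff.
have mA' : measurable (Won @^-1` A).
  by rewrite -[X in measurable X]setTI; exact: mWon.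
have fA : P (Won @^-1` A) \is a fin_num by exact: fin_num_measure.
suff : forall C, <<s (@cylinder R n) >> C ->
    P (Won @^-1` A `&` Woff @^-1` C) = (P (Won @^-1` A) * P (Woff @^-1` C))%E by exact.
apply: (@dynkin_induction _ (bmatrix R n)) => //.
- by rewrite !preimage_setT setIT probability_setT mule1.
- by move=> S cS; exact: indep1.
- move=> S mS IH; rewrite setIC muleC; apply: indep_setC => //; first exact: mWC.
  by rewrite setIC muleC.
- move=> F mF tF IH; rewrite preimage_bigcup setIC muleC; apply: indep_bigcup => //.
  + by move=> k; exact: mWC.
  + by move=> i j _ _ [w [Fi Fj]]; apply: (tF i j) => //; exists (Woff w).
  + by move=> k; rewrite setIC muleC.
Qed.

HB.instance Definition _ := isMeasurableFun.Build _ _ _ _ Won mWon.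
HB.instance Definition _ := isMeasurableFun.Build _ _ _ _ Woff mWoff.

Let D1 := distribution P Won.
Let D2 := distribution P Woff.
Let Wpair w := (Won w, Woff w).
Let mWpair : measurable_fun setT Wpair.
Proof. exact: measurable_fun_pair. Qed.
HB.instance Definition _ := isMeasurableFun.Build _ _ _ _ Wpair mWpair.

Let mix_split w : mix e (Won w) (Woff w) = W w.
Proof. by apply/matrixP => i j; rewrite !mxE; case: (e i j). Qed.

Let mix_double w w' : mix e (Won w) (Woff w') = mix e (W w) (W w').
Proof. by apply/matrixP => i j; rewrite !mxE; case: (e i j). Qed.

(** The marked and unmarked halves are independent, so their joint law is a product and Fubini
    applies. Pulling the two integrals back to [P] separately resamples the unmarked half. *)
Theorem decoupling (F : bmatrix R n -> R) : bmeas F ->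
  expect P (fun w => F (W w)) =
  expect P (fun w => expect P (fun w' => F (mix e (W w) (W w')))).
Proof.
move=> [mF [M FM]].
pose G (p : bmatrix R n * bmatrix R n) := F (mix e p.1 p.2).
have mG : measurable_fun setT G.
  apply: (@measurableT_comp _ _ _ _ _ _ F) => //.
  by apply: measurable_mix; [exact: measurable_fst|exact: measurable_snd].
have bG : bmeas G by split => //; exists M => p; exact: FM.
pose Dp := distribution P Wpair.
(* A measure that agrees with the product on rectangles is the product measure; [indep2] provides
   the agreement. *)
have E1 : (\int[D1 \x D2]_z (G z)%:E = \int[Dp]_z (G z)%:E)%E.
  apply: eq_measure_integral => A mA _.
  exact: (@product_measure_unique _ _ _ _ _ D1 D2 Dp).
have iG : (D1 \x D2)%E.-integrable setT (EFin \o G) by exact: (bmeas_integrable _ bG).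
have E2 := integral12_prod_meas1 iG.
rewrite /expect /Rintegral.
have -> : (\int[P]_w (F (W w))%:E = \int[Dp]_z (G z)%:E)%E.
  rewrite (@integral_distribution _ _ _ _ _ P Wpair (EFin \o G))//.
  - by apply: eq_integral => w _ /=; rewrite /G mix_split.
  - exact: measurableT_comp.
  - apply: (bmeas_integrable P); split; first exact: (measurableT_comp mG).
    by exists M => w; exact: FM.
rewrite -E1 -E2 /fubini_F.
have bGx x : bmeas (fun y => G (x, y)).
  split; last by exists M => y; exact: FM.
  exact: (measurableT_comp mG).
have intx x : (\int[D2]_y (G (x, y))%:E = \int[P]_w (G (x, Woff w))%:E)%E.
  rewrite (@integral_distribution _ _ _ _ _ P Woff (fun y => (G (x, y))%:E))//.
  - by apply: measurableT_comp => //; exact: (bGx x).1.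
  - apply: (bmeas_integrable P); split; last by exists M => w; exact: FM.
    exact: (measurableT_comp (bGx x).1).
have bGw x : bmeas (fun w => G (x, Woff w)).
  split; last by exists M => y; exact: FM.
  exact: (measurableT_comp (bGx x).1).
congr fine.
have /integrableP[mI _] := integrable_fubini_F iG.
have fI x : (\int[D2]_y (EFin \o G) (x, y))%E = (expect P (fun w => G (x, Woff w)))%:E.
  by rewrite /= intx expectE.
rewrite (@integral_distribution _ _ _ _ _ P Won (fun x => (\int[D2]_y (EFin \o G) (x, y)))%E)//.
  by apply: eq_integral => w _ /=; rewrite fI /expect /Rintegral/=; congr (fine _)%:E;
    apply: eq_integral => w' _; rewrite /G /= mix_double.
under eq_fun do rewrite /= fI.
apply: (bmeas_integrable P); split; last first.
  by exists M => w; apply: expect_norm_le_cst => // w'; exact: FM.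
apply/measurable_EFinP.
rewrite (_ : (_ \o _) = (fun x => (\int[D2]_y (EFin \o G) (x, y)))%E \o Won).
  exact: measurableT_comp.
by apply/funext => w /=; rewrite -fI.
Qed.

End Split.

(** Mark the position and its mirror image: [g] then sees only marked entries and [h] only unmarked
    ones. *)
Lemma expect_entry_mul (i j : 'I_n) (g : R -> R) (h : bmatrix R n -> R) : bmeas g -> bmeas h ->
  (forall M N : 'M[R]_n, (forall k l, ~~ ((k == i) && (l == j) || (k == j) && (l == i)) ->
     M k l = N k l) -> h M = h N) ->
  expect P (fun w => g (W w i j) * h (W w)) =
  expect P (fun w => g (W w i j)) * expect P (fun w => h (W w)).
Proof.
move=> bg bh hloc; pose e k l := (k == i) && (l == j) || (k == j) && (l == i).
have me := @measurable_entry R n i j.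
have bF : bmeas (fun M : bmatrix R n => g ((M : 'M[R]_n) i j) * h M).
  by apply: bmeasM => //; exact: (bmeas_comp me bg.1 bg.2).
rewrite (decoupling (e := e) _ bF); last first.
  by move=> k l; rewrite /e orbC andbC [X in _ || X]andbC.
have bgW : bmeas (fun w => g (W w i j)) := bmeas_comp (mW i j) bg.1 bg.2.
have bhW := bmeas_mx bh.
transitivity (expect P (fun w => expect P (fun w' => g (W w i j) * h (W w')))).
  apply: eq_expect => w; apply: eq_expect => w'; rewrite mxE /e !eqxx/=; congr (_ * _).
  by apply: hloc => k l; rewrite mxE /e => /negbTE ->.
under eq_expect do rewrite expectZ// mulrC.
by rewrite expectZ// mulrC.
Qed.

(** The mirror of position [(i, j)] lies in row [i] only when [i = j], so a function of the other
    columns of that row sees neither of the two. *)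
Lemma expect_row_entry_mul (i j : 'I_n) (r : seq 'I_n) (g : R -> R) (h : bmatrix R n -> R) :
  j \notin r -> bmeas g -> bmeas h ->
  (forall M N : 'M[R]_n, (forall k, k \in r -> M i k = N i k) -> h M = h N) ->
  expect P (fun w => g (W w i j) * h (W w)) =
  expect P (fun w => g (W w i j)) * expect P (fun w => h (W w)).
Proof.
move=> jr bg bh hloc; apply: expect_entry_mul => // M N MN; apply: hloc => k kr.
apply: MN; rewrite eqxx/=; have kj : k != j by apply: contraNneq jr => <-.
rewrite negb_or kj/= negb_and; case: (eqVneq i j) => //= ij.
by rewrite ij kj.
Qed.

End Decoupling.

(** * The resolvent of a symmetric matrix *)

Section Resolvent.
Context (R : realFieldType) (n : nat).
Implicit Types (V A b : 'M[R]_n) (u : 'cV[R]_n) (y : R).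

(* [A + i b = (V - i y)^-1], split into real and imaginary part. *)
Definition is_resolvent y V A b :=
  [/\ V^T = V, A^T = A, b^T = b, V *m A = 1%:M - y *: b & V *m b = y *: A].

(* [V^T] rather than [V]: the inverse then exists for every square matrix *)
Definition res_re y V := V *m invmx (V *m V^T + (y ^+ 2)%:M).
Definition res_im y V := y *: invmx (V *m V^T + (y ^+ 2)%:M).

Lemma sqnorm_ge0 (m : nat) (v : 'rV[R]_m) : 0 <= (v *m v^T) 0 0.
Proof. by rewrite mxE sumr_ge0// => j _; rewrite mxE -expr2 sqr_ge0. Qed.

Lemma sqnorm_eq0 (m : nat) (v : 'rV[R]_m) : (v *m v^T) 0 0 = 0 -> v = 0.
Proof.
rewrite mxE => /eqP; rewrite psumr_eq0; last by move=> j _; rewrite mxE -expr2 sqr_ge0.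
move=> /allP h; apply/rowP => j; have := h j; rewrite mem_index_enum mxE -expr2.
by move=> /(_ isT); rewrite sqrf_eq0 mxE => /eqP.
Qed.

(** A kernel row [u] satisfies [|u V|^2 + y^2 |u|^2 = 0], hence vanishes. *)
Lemma resolvent_unit y V : 0 < y -> V *m V^T + (y ^+ 2)%:M \in unitmx.
Proof.
move=> y0; rewrite -row_free_unit -kermx_eq0; apply/rowV0P => u /sub_kermxP uM.
have : ((u *m V) *m (u *m V)^T) 0 0 + y ^+ 2 * (u *m u^T) 0 0 = 0.
  transitivity (((u *m (V *m V^T + (y ^+ 2)%:M)) *m u^T) 0 0); last by rewrite uM mul0mx mxE.
  rewrite mulmxDr mulmxDl mul_mx_scalar -scalemxAl trmx_mul !mulmxA.
  by rewrite !mxE.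
move/eqP; rewrite paddr_eq0 ?sqnorm_ge0//; last by rewrite mulr_ge0 ?sqr_ge0 ?sqnorm_ge0.
by case/andP => _; rewrite mulf_eq0 expf_eq0/= gt_eqF//= => /eqP/sqnorm_eq0.
Qed.

(** [(V - i y)^-1 = (V + i y) (V^2 + y^2)^-1] for symmetric [V]. *)
Lemma resolvent_exists y V : 0 < y -> V^T = V ->
  is_resolvent y V (res_re y V) (res_im y V).
Proof.
move=> y0 VT; have uM := resolvent_unit V y0; rewrite /res_re /res_im.
rewrite VT in uM *; set M := V *m V + (y ^+ 2)%:M in uM *.
have MT : M^T = M by rewrite /M linearD/= trmx_mul VT tr_scalar_mx.
have MV : M *m V = V *m M.
  by rewrite /M mulmxDl mulmxDr mul_scalar_mx mul_mx_scalar mulmxA.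
have iMV : invmx M *m V = V *m invmx M.
  by rewrite -[LHS](mulmxK uM) -(mulmxA _ V) -MV mulmxA mulVmx// mul1mx.
have iMT : (invmx M)^T = invmx M by rewrite trmx_inv MT.
split => //.
- by rewrite trmx_mul iMT VT.
- by rewrite linearZ/= iMT.
- rewrite mulmxA scalerA -expr2 -[X in X - _](mulmxV uM) {2}/M mulmxDl.
  by rewrite mul_scalar_mx addrK.
- by rewrite -scalemxAr.
Qed.

Section Props.
Variables (y : R) (V A b : 'M[R]_n).
Hypotheses (y0 : 0 < y) (Vr : is_resolvent y V A b).

Lemma resolvent_mulC : A *m V = 1%:M - y *: b /\ b *m V = y *: A.
Proof.
case: Vr => VT AT bT VA Vb; split; apply: trmx_inj.
  by rewrite trmx_mul VT AT VA linearB/= [(y *: b)^T]linearZ/= bT trmx1.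
by rewrite trmx_mul VT bT Vb linearZ/= AT.
Qed.

(* [|G|^2 = Im G / y] for [G = A + i b] *)
Lemma ward : y *: (A *m A + b *m b) = b.
Proof.
have [AV bV] := resolvent_mulC; case: Vr => VT AT bT VA Vb.
rewrite scalerDr scalemxAl -bV -mulmxA VA mulmxBr mulmx1 -scalemxAr.
by rewrite subrK.
Qed.

Lemma ward_row i : y * \sum_j (A i j ^+ 2 + b i j ^+ 2) = b i i.
Proof.
case: Vr => VT AT bT _ _.
rewrite -[in RHS]ward !mxE; congr (_ * _); rewrite -big_split/=; apply: eq_bigr => j _.
by rewrite -[in A j i]AT -[in b j i]bT !mxE !expr2.
Qed.

Let sum_sq_ge0 i : 0 <= \sum_j (A i j ^+ 2 + b i j ^+ 2).
Proof. by rewrite sumr_ge0// => j _; rewrite addr_ge0// sqr_ge0. Qed.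

Lemma resolvent_im_ge0 i : 0 <= b i i.
Proof. by rewrite -ward_row mulr_ge0// ltW. Qed.

(** Keeping a single term of [ward_row] gives [y b_ii^2 <= b_ii]. *)
Lemma resolvent_im_le i : b i i <= y^-1.
Proof.
have h : y * b i i ^+ 2 <= b i i.
  rewrite -[leRHS]ward_row ler_wpM2l ?(ltW y0)// (bigD1 i)//= -addrA.
  rewrite addrCA lerDl addr_ge0 ?sqr_ge0// sumr_ge0// => j _.
  by rewrite addr_ge0// sqr_ge0.
have := resolvent_im_ge0 i; rewrite le_eqVlt => /orP[/eqP <-|b0].
  by rewrite invr_ge0 ltW.
rewrite -[leRHS]mulr1 ler_pdivlMl//.
by rewrite -(ler_pM2r b0) mul1r -mulrA -expr2.
Qed.

Lemma resolvent_row_sum i : \sum_j (A i j ^+ 2 + b i j ^+ 2) <= y^-1 ^+ 2.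
Proof.
rewrite -(ler_pM2l y0) ward_row expr2 mulrA divff ?gt_eqF// mul1r.
exact: resolvent_im_le.
Qed.

Lemma resolvent_entry_le i j : `|A i j| <= y^-1 /\ `|b i j| <= y^-1.
Proof.
have yi : 0 <= y^-1 by rewrite invr_ge0 ltW.
suff : A i j ^+ 2 + b i j ^+ 2 <= y^-1 ^+ 2.
  move=> h; have [A2 b2] := (sqr_ge0 (A i j), sqr_ge0 (b i j)).
  split; rewrite -(ler_pXn2r (n := 2))// ?nnegrE// real_normK ?num_real//; lra.
apply: le_trans (resolvent_row_sum i); rewrite (bigD1 j)//= lerDl sumr_ge0// => k _.
by rewrite addr_ge0// sqr_ge0.
Qed.

End Props.

Section Difference.
Variables (y : R) (V A b V0 A0 b0 : 'M[R]_n).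
Hypotheses (Vr : is_resolvent y V A b) (Vr0 : is_resolvent y V0 A0 b0).

(** This and the next lemma are the real and imaginary parts of the resolvent identity
    [G - G0 = - G0 (V - V0) G]. *)
Lemma resolvent_diff_re : A - A0 = b0 *m (V - V0) *m b - A0 *m (V - V0) *m A.
Proof.
have [AV bV] := resolvent_mulC Vr0; case: Vr => VT AT bT VA Vb.
rewrite !mulmxBr !mulmxBl AV bV -!mulmxA VA Vb !mulmxBr mulmxBl mulmx1 mul1mx.
rewrite -!scalemxAl -!scalemxAr.
by apply/matrixP => i j; rewrite !mxE; ring.
Qed.

Lemma resolvent_diff_im : b - b0 = - (A0 *m (V - V0) *m b + b0 *m (V - V0) *m A).
Proof.
have [AV bV] := resolvent_mulC Vr0; case: Vr => VT AT bT VA Vb.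
rewrite !mulmxBr !mulmxBl AV bV -!mulmxA VA Vb !mulmxBr mulmxBl mulmx1 mul1mx.
rewrite -!scalemxAl -!scalemxAr.
by apply/matrixP => i j; rewrite !mxE; ring.
Qed.

End Difference.

Lemma resolvent_uniq y V A b A' b' :
  is_resolvent y V A b -> is_resolvent y V A' b' -> A = A' /\ b = b'.
Proof.
move=> h h'; have := resolvent_diff_re h h'; have := resolvent_diff_im h h'.
have -> : V - V = 0 by apply/matrixP => i j; rewrite !mxE subrr.
rewrite !mulmx0 !mul0mx => /matrixP hb /matrixP hA.
by split; apply/matrixP => i j; [move: (hA i j)|move: (hb i j)]; rewrite !mxE; lra.
Qed.

Lemma mul_colE u (w : 'cV[R]_n) i j : (u *m w^T) i j = u i 0 * w j 0.
Proof. by rewrite mxE big_ord1 mxE. Qed.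

Lemma mul_rowE u (w : 'cV[R]_n) : u^T *m w = (\sum_k u k 0 * w k 0)%:M.
Proof.
apply/matrixP => i j; rewrite !ord1 !mxE eqxx mulr1n.
by apply: eq_bigr => k _; rewrite mxE.
Qed.

(* Sherman-Morrison, in real and imaginary parts: [x + i w = G u] and
   [c + i e = 1 + s u^T G u]. *)
Lemma sherman_morrison (y : R) V A b (s p q : R) (u x w : 'cV[R]_n) :
  0 < y -> is_resolvent y V A b -> x = A *m u -> w = b *m u ->
  u^T *m x = p%:M -> u^T *m w = q%:M ->
  let c := 1 + s * p in let e := s * q in let N := c ^+ 2 + e ^+ 2 in N != 0 ->
  is_resolvent y (V + s *: (u *m u^T))
    (A - (s / N) *: (c *: (x *m x^T - w *m w^T) + e *: (x *m w^T + w *m x^T)))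
    (b - (s / N) *: (c *: (x *m w^T + w *m x^T) - e *: (x *m x^T - w *m w^T))).
Proof.
move=> y0 Vr xE wE ux uw c e N Nn.
have [AV bV] := resolvent_mulC Vr; case: (Vr) => VT AT bT VA Vb.
have Vx : V *m x = u - y *: w by rewrite xE wE mulmxA VA mulmxBl mul1mx -scalemxAl.
have Vw : V *m w = y *: x by rewrite xE wE mulmxA Vb -scalemxAl.
have uA : u^T *m A = x^T by rewrite xE trmx_mul AT.
have ub : u^T *m b = w^T by rewrite wE trmx_mul bT.
have VM (v v' : 'cV[R]_n) : V *m (v *m v'^T) = V *m v *m v'^T by rewrite mulmxA.
have uM (v v' : 'cV[R]_n) : u *m u^T *m (v *m v'^T) = u *m (u^T *m v *m v'^T).
  by rewrite !mulmxA.
have uMA : u *m u^T *m A = u *m x^T by rewrite -mulmxA uA.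
have uMb : u *m u^T *m b = u *m w^T by rewrite -mulmxA ub.
split.
- by rewrite linearD/= linearZ/= trmx_mul trmxK VT.
- rewrite linearB/= AT; congr (_ - _); apply/matrixP => i j.
  by do ![rewrite mul_colE|rewrite mxE]; ring.
- rewrite linearB/= bT; congr (_ - _); apply/matrixP => i j.
  by do ![rewrite mul_colE|rewrite mxE]; ring.
- rewrite mulmxDl !mulmxBr -!scalemxAl -!scalemxAr !mulmxDr -!scalemxAr.
  rewrite !mulmxBr !mulmxDr !uM uMA ux uw !VM Vx Vw VA.
  rewrite !mul_scalar_mx -!scalemxAr -!scalemxAl !mulmxBl -!scalemxAl.
  apply/matrixP => i j; do ![rewrite mul_colE|rewrite mxE].
  by rewrite /N /c /e in Nn *; field.
- rewrite mulmxDl !mulmxBr -!scalemxAl -!scalemxAr !mulmxBr -!scalemxAr.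
  rewrite !mulmxBr !mulmxDr !uM uMb ux uw !VM Vx Vw Vb.
  rewrite !mul_scalar_mx -!scalemxAr -!scalemxAl !mulmxBl -!scalemxAl.
  apply/matrixP => i j; do ![rewrite mul_colE|rewrite mxE].
  by rewrite /N /c /e in Nn *; field.
Qed.

Section RankOne.
Variables (y : R) (V A b : 'M[R]_n) (s : R) (u : 'cV[R]_n).
Hypotheses (y0 : 0 < y) (Vr : is_resolvent y V A b).
Let x := A *m u.
Let w := b *m u.
Let p := \sum_k u k 0 * x k 0.
Let q := \sum_k u k 0 * w k 0.
Let c := 1 + s * p.
Let e := s * q.
Let N := c ^+ 2 + e ^+ 2.
Let A' := A - (s / N) *: (c *: (x *m x^T - w *m w^T) + e *: (x *m w^T + w *m x^T)).
Let b' := b - (s / N) *: (c *: (x *m w^T + w *m x^T) - e *: (x *m x^T - w *m w^T)).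

(** [Im (u^T G u) = y |G u|^2], the version of [ward] for quadratic forms. *)
Let qE : q = y * (\sum_k x k 0 ^+ 2 + \sum_k w k 0 ^+ 2).
Proof.
case: (Vr) => VT AT bT VA Vb.
have : u^T *m (b *m u) = y *: (x^T *m x + w^T *m w).
  rewrite -[in LHS](ward Vr) /x /w !trmx_mul AT bT -scalemxAl -[LHS]scalemxAr.
  by rewrite mulmxDl mulmxDr !mulmxA.
rewrite !mul_rowE => /matrixP/(_ 0 0).
by rewrite !mxE eqxx !mulr1n -/q; under eq_bigr do rewrite -expr2;
  under [in X in _ + X]eq_bigr do rewrite -expr2.
Qed.

Let sx_ge0 : 0 <= \sum_k x k 0 ^+ 2. Proof. by apply: sumr_ge0 => k _; exact: sqr_ge0. Qed.
Let sw_ge0 : 0 <= \sum_k w k 0 ^+ 2. Proof. by apply: sumr_ge0 => k _; exact: sqr_ge0. Qed.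

Let q_ge0 : 0 <= q.
Proof. by rewrite qE mulr_ge0 ?addr_ge0// ltW. Qed.

(** If the imaginary part of [1 + s u^T G u] vanishes, then [s = 0] or [G u = 0], and in both cases
    the real part is [1]. *)
Let N_gt0 : 0 < N.
Proof.
rewrite lt_neqAle addr_ge0 ?sqr_ge0// andbT eq_sym paddr_eq0 ?sqr_ge0//.
rewrite !sqrf_eq0; apply/negP => /andP[/eqP c0]; rewrite mulf_eq0 => /orP[/eqP s0|].
  by move: c0; rewrite /c s0 mul0r addr0 => /eqP; rewrite oner_eq0.
rewrite qE mulf_eq0 gt_eqF//= paddr_eq0// => /andP[].
rewrite psumr_eq0 => [|k _]; last exact: sqr_ge0.
move=> /allP x0 _; move: c0; rewrite /c (_ : p = 0) ?mulr0 ?addr0.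
  by move/eqP; rewrite oner_eq0.
rewrite /p big1// => k _; have := x0 k; rewrite mem_index_enum => /(_ isT)/=.
by rewrite sqrf_eq0 => /eqP ->; rewrite mulr0.
Qed.

Let rank_one_resolvent : is_resolvent y (V + s *: (u *m u^T)) A' b'.
Proof. by apply: sherman_morrison; rewrite ?mul_rowE ?gt_eqF. Qed.

(** The trace changes by [- s u^T G^2 u / (1 + s u^T G u)]. By [qE], [|s| |G u|^2 = |e| / y], and
    [e] is the imaginary part of that denominator, so the bound depends on neither [s] nor [u]. *)
Let trace_bound (z1 z2 al be : R) : `|al| <= `|e| -> `|be| <= `|c| ->
  `|z1| <= \sum_k x k 0 ^+ 2 + \sum_k w k 0 ^+ 2 ->
  `|z2| <= \sum_k x k 0 ^+ 2 + \sum_k w k 0 ^+ 2 ->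
  `|s / N * (al * z1 + be * z2)| <= 2 / y.
Proof.
move=> ale bec hz1 hz2; rewrite normrM.
have [X W] := (sx_ge0, sw_ge0).
set sx := \sum_k x k 0 ^+ 2 in X hz1 hz2 *; set sw := \sum_k w k 0 ^+ 2 in W hz1 hz2 *.
have h : `|al * z1 + be * z2| <= (`|e| + `|c|) * (sx + sw).
  rewrite (le_trans (ler_normD _ _))// (normrM al) (normrM be) mulrDl lerD//.
    exact: ler_pM.
  exact: ler_pM.
rewrite (le_trans (ler_wpM2l (normr_ge0 _) h))//.
have -> : sx + sw = q / y by rewrite qE mulrAC divff ?gt_eqF// mul1r.
rewrite (normrM s) normfV (gtr0_norm N_gt0).
have eE : `|e| = `|s| * q by rewrite /e normrM (ger0_norm q_ge0).
rewrite (_ : `|s| / N * _ = (`|e| ^+ 2 + `|e| * `|c|) / (N * y)); last first.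
  by rewrite eE; field; rewrite !gt_eqF.
rewrite invfM mulrA ler_pM2r ?invr_gt0// ler_pdivrMr// /N.
rewrite -(real_normK (num_real c)) -(real_normK (num_real e)).
move: (`|e|) (`|c|) => E C; have := sqr_ge0 (E - C); have := sqr_ge0 C; have := sqr_ge0 E.
lra.
Qed.

Let trace_col (v v' : 'cV[R]_n) : \tr (v *m v'^T) = \sum_k v k 0 * v' k 0 :> R.
Proof. by apply: eq_bigr => k _; rewrite mul_colE. Qed.

Lemma rank_one_trace V' A1 b1 : V' = V + s *: (u *m u^T) -> is_resolvent y V' A1 b1 ->
  `|\tr A1 - \tr A| <= 2 / y /\ `|\tr b1 - \tr b| <= 2 / y.
Proof.
move=> -> h1; have [-> ->] := resolvent_uniq h1 rank_one_resolvent.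
have wx : \sum_k w k 0 * x k 0 = \sum_k x k 0 * w k 0.
  by apply: eq_bigr => k _; rewrite mulrC.
have sqE (v : 'cV[R]_n) : \sum_k v k 0 * v k 0 = \sum_k v k 0 ^+ 2.
  by apply: eq_bigr => k _; rewrite expr2.
have tA : \tr A' - \tr A = - (s / N * (e * (2 * \sum_k x k 0 * w k 0) +
     c * (\sum_k x k 0 ^+ 2 - \sum_k w k 0 ^+ 2))).
  rewrite /A' raddfB/= mxtraceZ mxtraceD !mxtraceZ raddfB/= mxtraceD !trace_col.
  by rewrite wx !sqE; ring.
have tb : \tr b' - \tr b = - (s / N * ((- e) * (\sum_k x k 0 ^+ 2 - \sum_k w k 0 ^+ 2) +
     c * (2 * \sum_k x k 0 * w k 0))).
  rewrite /b' raddfB/= mxtraceZ raddfB/= !mxtraceZ raddfB/= mxtraceD !trace_col.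
  by rewrite wx !sqE; ring.
have xw : `|2 * \sum_k x k 0 * w k 0| <= \sum_k x k 0 ^+ 2 + \sum_k w k 0 ^+ 2.
  have g1 : 0 <= \sum_k (x k 0 + w k 0) ^+ 2 by apply: sumr_ge0 => k _; exact: sqr_ge0.
  have g2 : 0 <= \sum_k (x k 0 - w k 0) ^+ 2 by apply: sumr_ge0 => k _; exact: sqr_ge0.
  have E1 : \sum_k (x k 0 + w k 0) ^+ 2 =
      \sum_k x k 0 ^+ 2 + 2 * \sum_k x k 0 * w k 0 + \sum_k w k 0 ^+ 2.
    by rewrite mulr_sumr -!big_split; apply: eq_bigr => k _ /=; ring.
  have E2 : \sum_k (x k 0 - w k 0) ^+ 2 =
      \sum_k x k 0 ^+ 2 - 2 * \sum_k x k 0 * w k 0 + \sum_k w k 0 ^+ 2.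
    by rewrite mulr_sumr -sumrB -big_split; apply: eq_bigr => k _ /=; ring.
  by rewrite ler_norml; move: g1 g2; rewrite E1 E2 => g1 g2; apply/andP; split; lra.
have xx : `|\sum_k x k 0 ^+ 2 - \sum_k w k 0 ^+ 2| <= \sum_k x k 0 ^+ 2 + \sum_k w k 0 ^+ 2.
  by have [X W] := (sx_ge0, sw_ge0); rewrite ler_norml; apply/andP; split; lra.
rewrite tA tb 2!normrN; split; apply: trace_bound => //.
by rewrite normrN.
Qed.

End RankOne.

(** A change [e v^T + v e^T] supported on one row and column is half of
    [(e + v) (e + v)^T - (e - v) (e - v)^T]: two perturbations of rank one, each worth [2 / y]. *)
Lemma row_change_trace y V A b V' A' b' (k : 'I_n) : 0 < y ->
  is_resolvent y V A b -> is_resolvent y V' A' b' ->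
  (forall i j, i != k -> j != k -> V' i j = V i j) ->
  `|\tr A' - \tr A| <= 4 / y /\ `|\tr b' - \tr b| <= 4 / y.
Proof.
move=> y0 h h' VV'.
(* The diagonal entry is halved because [e v^T + v e^T] counts it twice. *)
pose v : 'cV[R]_n := \col_j if j == k then (V' k k - V k k) / 2 else V' k j - V k j.
pose e : 'cV[R]_n := delta_mx k 0.
pose V1 := V + 2^-1 *: ((e + v) *m (e + v)^T).
have E : V' = V1 + (- 2^-1) *: ((e - v) *m (e - v)^T).
  apply/matrixP => i j; rewrite /V1; do ![rewrite mul_colE|rewrite mxE].
  case: h h' => VT _ _ _ _ [V'T _ _ _ _].
  have Vik : V i k = V k i by rewrite -{1}VT mxE.
  have V'ik : V' i k = V' k i by rewrite -{1}V'T mxE.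
  case: (eqVneq i k) => [->|ik]; case: (eqVneq j k) => [->|jk]; rewrite ?eqxx/=.
  - by field.
  - by field.
  - by rewrite Vik V'ik; field.
  - by rewrite VV'//; field.
have V1T : V1^T = V1.
  by case: h => VT _ _ _ _; rewrite /V1 linearD/= linearZ/= trmx_mul trmxK VT.
have h1 := resolvent_exists y0 V1T.
have [a1 a2] := rank_one_trace y0 h (erefl V1) h1.
have [a3 a4] := rank_one_trace y0 h1 E h'.
have four : 4 / y = 2 / y + 2 / y by rewrite -mulrDl; congr (_ / _); lra.
rewrite four; split.
  rewrite (_ : \tr A' - \tr A = (\tr A' - \tr (res_re y V1)) + (\tr (res_re y V1) - \tr A)).
    by rewrite (le_trans (ler_normD _ _))// lerD.
  by ring.
rewrite (_ : \tr b' - \tr b = (\tr b' - \tr (res_im y V1)) + (\tr (res_im y V1) - \tr b)).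
  by rewrite (le_trans (ler_normD _ _))// lerD.
by ring.
Qed.

End Resolvent.

(** * Eigenvalues of a symmetric matrix and traces of its resolvent *)

Section Spectral.
Import complex.
Context (R : realType) (n : nat).
Implicit Types V : 'M[R]_n.
Let C : numClosedFieldType := complex R.
Let toC : {rmorphism R -> C} := real_complex R.

(** A real symmetric matrix is hermitian over [C], and the eigenvalues given by the complex spectral
    theorem are real: [P] is complex, [D] is real. *)
Lemma real_spectral V : V^T = V -> exists (P : 'M[C]_n) (D : 'rV[R]_n), P \in unitmx /\
  map_mx toC V = invmx P *m map_mx toC (diag_mx D) *m P.
Proof.
move=> VT; set M := map_mx toC V.
have Mr : M \is a mxOver Num.real.
  by apply/mxOverP => i j; rewrite mxE; apply/complex_realP; exists (V i j).
have Mh : M \is hermsymmx.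
  by apply: realsym_hermsym => //; apply/is_hermitianmxP;
    rewrite expr0 scale1r; apply/matrixP => i j; rewrite !mxE -[in LHS]VT mxE.
have /orthomx_spectralP ME := hermitian_normalmx Mh.
have /mxOverP Dr := hermitian_spectral_diag_real Mh.
exists (spectralmx M), (\row_j Re (spectral_diag M 0 j)); split; first exact: spectral_unit.
rewrite {1}ME map_diag_mx; congr (_ *m diag_mx _ *m _).
by apply/rowP => j; rewrite !mxE /toC /= RRe_real.
Qed.

Let char_poly_conj (P M : 'M[C]_n) : P \in unitmx -> char_poly (invmx P *m M *m P) = char_poly M.
Proof.
move=> uP; rewrite /char_poly /char_poly_mx.
have -> : 'X%:M - map_mx (@polyC C) (invmx P *m M *m P) =
    map_mx (@polyC C) (invmx P) *m ('X%:M - map_mx (@polyC C) M) *m map_mx (@polyC C) P.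
  rewrite mulmxBr mulmxBl !map_mxM -!mulmxA; congr (_ - _).
  by rewrite mul_scalar_mx -scalemxAr -map_mxM mulVmx// map_mx1 scalemx1.
rewrite !det_mulmx mulrAC -det_mulmx -map_mxM mulVmx// map_mx1 det1 mul1r.
by [].
Qed.

(** Unique factorization of the characteristic polynomial identifies [eigvals V] with the diagonal
    [D] up to order. In the basis [P] the matrix [V^2 + y^2] is diagonal, so both traces can be read
    off. *)
Lemma eigvals_trace V y : V^T = V -> 0 < y ->
  [/\ size (eigvals V) = n,
  \sum_(x <- eigvals V) (x / (x ^+ 2 + y ^+ 2)) = \tr (res_re y V) &
  \sum_(x <- eigvals V) (y / (x ^+ 2 + y ^+ 2)) = \tr (res_im y V)].
Proof.
move=> VT y0; have [P [D [uP VE]]] := real_spectral VT.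
pose ds := [seq D 0 j | j <- enum 'I_n].
have cpE : char_poly V = \prod_(x <- ds) ('X - x%:P).
  apply: (map_poly_inj toC); rewrite map_char_poly VE char_poly_conj//.
  rewrite map_diag_mx char_poly_trig; last first.
    by apply/is_trig_mxP => i j ij; rewrite mxE (_ : i == j = false) ?mulr0n//; apply/negbTE;
      rewrite neq_ltn ij.
  rewrite map_prod_XsubC big_map big_enum/=; apply: eq_bigr => i _.
  by rewrite !mxE eqxx mulr1n.
have : [set s : seq R | sorted (>=%R) s /\ char_poly V = \prod_(x <- s) ('X - x%:P)] (eigvals V).
  (* A sorted factorization exists, so the default value of [eigvals] does not occur. *)
  apply: (@xgetPex _ [::]); exists (sort (>=%R) ds); split.
    by apply: sort_sorted => a b; exact: le_total.
  rewrite cpE; apply: perm_big; by rewrite perm_sym perm_sort.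
move=> [_ ]; rewrite cpE => /prod_XsubC_eq pe.
have sumE (f : R -> R) : \sum_(x <- eigvals V) f x = \sum_j f (D 0 j).
  by rewrite -(perm_big _ pe) big_map big_enum.
rewrite !sumE.
pose E := \row_j (D 0 j ^+ 2 + y ^+ 2)^-1.
have Epos j : D 0 j ^+ 2 + y ^+ 2 != 0 :> R.
  by rewrite gt_eqF// ltr_wpDl ?sqr_ge0// exprn_gt0.
have uM := resolvent_unit V y0; rewrite VT in uM; set M := V *m V + (y ^+ 2)%:M in uM.
pose DC := map_mx toC (diag_mx D); pose EC := map_mx toC (diag_mx E).
have DE : diag_mx D *m (diag_mx D *m diag_mx E) + y ^+ 2 *: diag_mx E = 1%:M.
  rewrite !mulmx_diag; apply/matrixP => i j; rewrite !mxE.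
  case: eqP => _; rewrite ?mulr0n ?mulr1n ?mulr0 ?addr0//.
  by field; exact: Epos.
have VP : map_mx toC V *m invmx P = invmx P *m DC by rewrite VE -/DC mulmxK.
have uMC : map_mx toC M \in unitmx by rewrite map_unitmx.
have invE : map_mx toC (invmx M) = invmx P *m EC *m P.
  have MX : map_mx toC M *m (invmx P *m EC *m P) = 1%:M.
    rewrite /M map_mxD map_mxM map_scalar_mx mulmxDl mul_scalar_mx.
    rewrite -!mulmxA (mulmxA (map_mx toC V) (invmx P)) VP.
    rewrite -!(mulmxA (invmx P)) (mulmxA (map_mx toC V) (invmx P)) VP.
    rewrite -!(mulmxA (invmx P)) scalemxAr -mulmxDr !mulmxA scalemxAl -mulmxDl.
    rewrite -!mulmxA (_ : _ + _ = 1%:M) ?mul1mx ?mulVmx//.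
    by rewrite -map_mxZ -!map_mxM -map_mxD DE map_mx1.
  by rewrite map_invmx -[RHS]mul1mx -(mulVmx uMC) -[RHS]mulmxA MX mulmx1.
have trC N : toC (\tr N) = \tr (map_mx toC N) by rewrite trace_map_mx.
have trD (d : 'rV[R]_n) : \tr (diag_mx d) = \sum_j d 0 j by rewrite mxtrace_diag.
split; first (by rewrite -(perm_size pe) size_map size_enum_ord);
  apply: (fmorph_inj toC); rewrite [in RHS]trC.
- rewrite /res_re VT -/M map_mxM invE !mulmxA VP mxtrace_mulC !mulmxA mulmxV// mul1mx.
  rewrite -map_mxM mulmx_diag -trC trD; congr (toC _).
  by apply: eq_bigr => j _; rewrite !mxE.
- rewrite /res_im VT -/M map_mxZ invE mxtraceZ mxtrace_mulC !mulmxA mulmxV// mul1mx.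
  rewrite -trC trD -rmorphM mulr_sumr; congr (toC _).
  by apply: eq_bigr => j _; rewrite !mxE.
Qed.

End Spectral.

(** * Concentration *)

Section MatrixMeasurability.
Context (R : realType) (d : measure_display) (X : measurableType d).

Lemma measurable_fun_sumR (I : Type) (r : seq I) (p : pred I) (F : I -> X -> R) :
  (forall i, p i -> measurable_fun setT (F i)) ->
  measurable_fun setT (fun x => \sum_(i <- r | p i) F i x).
Proof.
move=> mF; elim: r => [|i r IH].
  by under eq_fun do rewrite big_nil; exact: measurable_cst.
rewrite (_ : (fun _ => _) = fun x => if p i then F i x + \sum_(j <- r | p j) F j x
    else \sum_(j <- r | p j) F j x); last by apply/funext => x; rewrite big_cons.
by case: (boolP (p i)) => // pi; apply: measurable_funD => //; exact: mF.
Qed.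

Lemma measurable_fun_prodR (I : Type) (r : seq I) (F : I -> X -> R) :
  (forall i, measurable_fun setT (F i)) ->
  measurable_fun setT (fun x => \prod_(i <- r) F i x).
Proof.
move=> mF; elim: r => [|i r IH].
  by under eq_fun do rewrite big_nil; exact: measurable_cst.
by under eq_fun do rewrite big_cons; apply: measurable_funM.
Qed.

Lemma measurable_fun_invR (g : X -> R) : measurable_fun setT g ->
  (forall x, g x != 0) -> measurable_fun setT (fun x => (g x)^-1).
Proof.
move=> mg g0.
(* [1 / g = g exp (- ln (g^2))] wherever [g] is nonzero, and the right side is built from measurable
   functions. *)
rewrite (_ : (fun _ => _) = fun x => g x * expR (- ln (g x ^+ 2))).
  apply: measurable_funM => //; apply: measurableT_comp => //; apply: measurableT_comp => //.
  apply: (measurableT_comp (@measurable_ln R)).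
  exact: measurable_funX.
apply/funext => x; have g2 : 0 < g x ^+ 2 by rewrite exprn_even_gt0//= g0.
by rewrite expRN lnK//; field.
Qed.

Lemma measurable_det m (M : X -> 'M[R]_m) :
  (forall i j, measurable_fun setT (fun x => M x i j)) ->
  measurable_fun setT (fun x => \det (M x)).
Proof.
move=> mM; apply: measurable_fun_sumR => s _; apply: measurable_funM => //.
exact: measurable_fun_prodR.
Qed.

Lemma measurable_mulmx m n p (M : X -> 'M[R]_(m, n)) (N : X -> 'M[R]_(n, p)) :
  (forall i j, measurable_fun setT (fun x => M x i j)) ->
  (forall i j, measurable_fun setT (fun x => N x i j)) ->
  forall i j, measurable_fun setT (fun x => (M x *m N x) i j).
Proof.
move=> mM mN i j; under eq_fun do rewrite mxE.
by apply: measurable_fun_sumR => k _; exact: measurable_funM.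
Qed.

(** Cramer's rule expresses the inverse through determinants. *)
Lemma measurable_invmx m (M : X -> 'M[R]_m) :
  (forall i j, measurable_fun setT (fun x => M x i j)) -> (forall x, M x \in unitmx) ->
  forall i j, measurable_fun setT (fun x => invmx (M x) i j).
Proof.
move=> mM uM i j.
rewrite (_ : (fun _ => _) = fun x => (\det (M x))^-1 * cofactor (M x) j i); last first.
  by apply/funext => x; rewrite /invmx uM !mxE.
apply: measurable_funM.
  by apply: measurable_fun_invR; [exact: measurable_det|move=> x; rewrite -unitfE -unitmxE].
apply: measurable_funM => //; apply: measurable_det => k l.
by under eq_fun do rewrite !mxE; exact: mM.
Qed.

Section Resolvent.
Variables (n : nat) (y : R) (V : X -> 'M[R]_n).
Hypotheses (y0 : 0 < y) (mV : forall i j, measurable_fun setT (fun x => V x i j)).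

Let mM i j :
  measurable_fun setT (fun x => invmx (V x *m (V x)^T + (y ^+ 2)%:M) i j).
Proof.
apply: (@measurable_invmx _ (fun x => V x *m (V x)^T + (y ^+ 2)%:M)); last first.
  by move=> x; exact: resolvent_unit.
move=> k l; under eq_fun do rewrite mxE; apply: measurable_funD; last by [].
apply: measurable_mulmx => // a b; under eq_fun do rewrite mxE.
exact: mV.
Qed.

Lemma measurable_res_re i j : measurable_fun setT (fun x => res_re y (V x) i j).
Proof. by apply: measurable_mulmx => // k l; exact: mM. Qed.

Lemma measurable_res_im i j : measurable_fun setT (fun x => res_im y (V x) i j).
Proof.
under eq_fun do rewrite mxE.
by apply: measurable_funM => //; exact: mM.
Qed.

End Resolvent.

End MatrixMeasurability.

(* Extends functions of symmetric matrices to all matrices. *)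
Definition symm (R : realType) n (V : 'M[R]_n) : 'M[R]_n :=
  \matrix_(i, j) if (i <= j)%N then V i j else V j i.

Lemma symm_tr (R : realType) n (V : 'M[R]_n) : (symm V)^T = symm V.
Proof.
apply/matrixP => i j; rewrite !mxE; case: (ltngtP i j) => // /val_inj ->.
by [].
Qed.

Lemma symm_id (R : realType) n (V : 'M[R]_n) : V^T = V -> symm V = V.
Proof. by move=> VT; apply/matrixP => i j; rewrite !mxE; case: ifP => // _; rewrite -{1}VT mxE. Qed.

Lemma measurable_symm (R : realType) n (i j : 'I_n) :
  measurable_fun [set: bmatrix R n] (fun V : bmatrix R n => symm V i j).
Proof.
under eq_fun do rewrite mxE.
by case: (i <= j)%N; exact: measurable_entry.
Qed.

(** * Exponential concentration for functions stable under the change of one row *)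

Section Concentration.
Context (R : realType) (d : measure_display) (T : measurableType d).
Variables (P : probability T R) (n : nat) (W : T -> 'M[R]_n).
Hypotheses (mW : mx_measurable W) (symW : mx_symmetric W) (indW : upper_independent P W).
Variables (F : bmatrix R n -> R) (c : R).
Hypotheses (mF : bmeas F) (c0 : 0 <= c).
Hypothesis Fdiff : forall (A B : bmatrix R n) (k : 'I_n),
  (forall i j, i != k -> j != k -> (A : 'M[R]_n) i j = (B : 'M[R]_n) i j) -> `|F A - F B| <= c.

Lemma bmeas_expect (G : T * T -> R) : bmeas G ->
  bmeas (fun x => expect P (fun w => G (x, w))).
Proof.
move=> bG; have [mG [M GM]] := bG.
have bGx x : bmeas (fun w => G (x, w)).
  by split; [exact: (measurableT_comp mG)|exists M => w; exact: GM].
split; last by exists M => x; apply: expect_norm_le_cst => // w; exact: GM.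
have iG : (P \x P)%E.-integrable setT (EFin \o G) by exact: bmeas_integrable.
have /integrableP[mI _] := integrable_fubini_F iG.
apply/measurable_EFinP; rewrite (_ : _ \o _ = fubini_F P (EFin \o G))//.
by apply/funext => x /=; rewrite /fubini_F -expectE.
Qed.

(** Rows and columns below [k] are revealed from the first argument; the remaining entries are
    resampled from the second. *)
Let mixk k := mix (R := R) (n := n) (fun i j => (i < k)%N || (j < k)%N).

Let mixk_measurable d' (X : measurableType d') k (A B : X -> bmatrix R n) :
  measurable_fun setT A -> measurable_fun setT B ->
  measurable_fun setT (fun x => mixk k (A x) (B x) : bmatrix R n).
Proof. exact: measurable_mix. Qed.

Let mWb : measurable_fun setT (W : T -> bmatrix R n).
Proof. exact: measurable_bmatrix. Qed.

Let bF d' (X : measurableType d') (A : X -> bmatrix R n) :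
  measurable_fun setT A -> bmeas (fun x => F (A x)).
Proof.
move: mF => [mF' [M FM]] mA; split; first exact: (measurableT_comp mF').
by exists M => x; exact: FM.
Qed.

Let bexp d' (X : measurableType d') (g : X -> R) : bmeas g -> bmeas (fun x => expR (g x)).
Proof.
move=> [mg [M gM]]; split; first exact: measurableT_comp.
exists (expR M) => x; rewrite ger0_norm ?expR_ge0// ler_expR.
by rewrite (le_trans (ler_norm _)).
Qed.

(** The conditional expectation of [F] given the rows and columns below [k]; at [W] it is a Doob
    martingale in [k]. *)
Let mean k (A : 'M[R]_n) := expect P (fun w => F (mixk k A (W w))).

Let mix_next k (A B B' : 'M[R]_n) :
  mixk k A (mixk k.+1 B B') = mixk k.+1 (mixk k A B) B'.
Proof.
apply/matrixP => i j; rewrite !mxE !ltnS.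
case: (ltngtP i k) => ik; case: (ltngtP j k) => jk //=.
Qed.

Let decouple k (A : 'M[R]_n) (G : R -> R) : (forall (X : bmatrix R n -> R), bmeas X -> bmeas (fun x => G (X x))) ->
  expect P (fun w => G (F (mixk k A (W w)))) =
  expect P (fun w => expect P (fun w' => G (F (mixk k.+1 (mixk k A (W w)) (W w'))))).
Proof.
move=> bG.
have := @decoupling _ _ _ P _ W mW symW indW (fun i j => (i < k.+1)%N || (j < k.+1)%N)
  (fun i j => orbC _ _) (fun B => G (F (mixk k A B))).
move=> ->; first by apply: eq_expect => w; apply: eq_expect => w'; rewrite -mix_next.
apply: (bG (fun B => F (mixk k A B))); apply: bF.
by apply: mixk_measurable.
Qed.

(** [exp x <= 1 / (1 - x)], and [(1 + x + 2 x^2) (1 - x) - 1 = x^2 (1 - 2 x)]. *)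
Let expR_le_quad (x : R) : x <= 2^-1 -> expR x <= 1 + x + 2 * x ^+ 2.
Proof.
move=> x2; have := expR_ge1Dx (- x); rewrite expRN => h.
have x1 : 0 < 1 - x by lra.
have : expR x <= (1 - x)^-1.
  by rewrite -[leLHS]invrK lef_pV2// posrE// invr_gt0 expR_gt0.
move=> /le_trans; apply; rewrite -[leLHS]mul1r ler_pdivrMr//.
have := mulr_ge0 (sqr_ge0 x) (_ : 0 <= 1 - 2 * x).
by move=> /(_ ltac:(lra)); lra.
Qed.

(** The Azuma-Hoeffding argument: revealing one more row adds a centred increment [D] with
    [|D| <= c], which multiplies the exponential moment by at most [1 + 2 (l c)^2]. *)
Lemma exp_moment_bound (l : R) : 0 <= l -> l * c <= 2^-1 ->
  expect P (fun w => expR (l * (F (W w) - expect P (fun w => F (W w))))) <=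
  expR (2 * (l * c) ^+ 2 *+ n).
Proof.
move=> l0 lc.
(* [m] counts the rows still to be revealed; the induction is for all revealed parts [A] at once. *)
suff main m : forall k, (k + m = n)%N -> forall A,
    expect P (fun w => expR (l * (F (mixk k A (W w)) - mean k A))) <=
    expR (2 * (l * c) ^+ 2 *+ m).
  have := main n 0%N (add0n n) 0.
  have E w : mixk 0 0 (W w) = W w by apply/matrixP => i j; rewrite !mxE.
  have -> : mean 0 0 = expect P (fun w => F (W w)) by apply: eq_expect => w; rewrite E.
  by under eq_expect do rewrite E.
elim: m => [|m IH] k km A.
  rewrite addn0 in km; rewrite mulr0n expR0.
  have E B : mixk k A B = A.
    by apply/matrixP => i j; rewrite !mxE km ltn_ord.
  have mE : mean k A = F A by rewrite /mean; under eq_expect do rewrite E; exact: expect_cst.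
  by under eq_expect do rewrite E mE subrr mulr0 expR0; rewrite expect_cst.
have kn : (k < n)%N by rewrite -km addnS ltnS leq_addr.
pose Aw w := mixk k A (W w).
have mAw : measurable_fun setT (Aw : T -> bmatrix R n) by exact: mixk_measurable.
have bcA : bmeas (fun w => mean k.+1 (Aw w)).
  apply: (@bmeas_expect (fun p => F (mixk k.+1 (Aw p.1) (W p.2)))).
  apply: bF; apply: mixk_measurable.
    exact: (measurableT_comp mAw).
  exact: (measurableT_comp mWb).
have bFk w : bmeas (fun w' => F (mixk k.+1 (Aw w) (W w'))) by apply: bF; exact: mixk_measurable.
have bFA : bmeas (fun w => F (mixk k A (W w))) by apply: bF; exact: mixk_measurable.
pose D w := mean k.+1 (Aw w) - mean k A.
have bD : bmeas D by apply: bmeasB => //; exact: bmeas_cst.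
have D0 : expect P D = 0.
  rewrite /D expectB//; last exact: bmeas_cst.
  by rewrite expect_cst /mean (decouple k A (G := id))// subrr.
have Dc w : `|D w| <= c.
  rewrite /D /mean -expectB//; apply: expect_norm_le_cst; first exact: bmeasB.
  move=> w'; apply: (Fdiff (k := Ordinal kn)) => i j ik jk.
  rewrite !mxE; have {ik}ik : (i : nat) != k by []; have {jk}jk : (j : nat) != k by [].
  by case: (ltngtP i k) ik => // ik _; case: (ltngtP j k) jk => // jk _;
    rewrite !ltnS ?ik ?jk ?(ltnW ik) ?(ltnW jk) ?orbT//= leqNgt ik /= leqNgt jk.
rewrite (decouple k A (G := fun z => expR (l * (z - mean k A)))); last first.
  move=> X bX; apply: bexp; apply: bmeasM; first exact: bmeas_cst.
  by apply: bmeasB => //; exact: bmeas_cst.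
(* Once row [k] is revealed the increment [D w] is fixed and leaves the inner expectation; what
   remains is the induction hypothesis at [Aw w]. *)
have step w : expect P (fun w' => expR (l * (F (mixk k.+1 (Aw w) (W w')) - mean k A))) <=
    expR (2 * (l * c) ^+ 2 *+ m) * (1 + l * D w + 2 * (l * c) ^+ 2).
  have -> : expect P (fun w' => expR (l * (F (mixk k.+1 (Aw w) (W w')) - mean k A))) =
      expect P (fun w' => expR (l * D w) *
        expR (l * (F (mixk k.+1 (Aw w) (W w')) - mean k.+1 (Aw w)))).
    by apply: eq_expect => w'; rewrite -expRD; congr expR; rewrite /D; ring.
  rewrite expectZ; last first.
    apply: bexp; apply: bmeasM; first exact: bmeas_cst.
    by apply: bmeasB => //; exact: bmeas_cst.
  rewrite mulrC ler_pM ?expR_ge0//.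
  - by apply: expect_ge0 => w'; exact: expR_ge0.
  - by apply: IH; rewrite addSnnS.
  - have lD : `|l * D w| <= l * c by rewrite normrM (ger0_norm l0) ler_wpM2l.
    apply: (le_trans (expR_le_quad _)).
      by rewrite (le_trans (ler_norm _))// (le_trans lD).
    rewrite lerD2l ler_wpM2l// -(real_normK (num_real (l * D w))).
    by rewrite lerXn2r ?nnegrE// (le_trans _ lD).
apply: (@le_trans _ _ (expect P (fun w => expR (2 * (l * c) ^+ 2 *+ m) *
    (1 + l * D w + 2 * (l * c) ^+ 2)))).
  apply: expect_le => //.
  - apply: (@bmeas_expect (fun p => expR (l * (F (mixk k.+1 (Aw p.1) (W p.2)) - mean k A)))).
    apply: bexp; apply: bmeasM; first exact: bmeas_cst.
    apply: bmeasB; last exact: bmeas_cst.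
    apply: bF; apply: mixk_measurable.
      exact: (measurableT_comp mAw).
    exact: (measurableT_comp mWb).
  - apply: bmeasM; first exact: bmeas_cst.
    by apply: bmeasD; [apply: bmeasD; [exact: bmeas_cst|apply: bmeasM => //; exact: bmeas_cst]
      |exact: bmeas_cst].
have blD : bmeas (fun w => l * D w) by apply: bmeasM => //; exact: bmeas_cst.
have b1D : bmeas (fun w => 1 + l * D w) by apply: bmeasD => //; exact: bmeas_cst.
rewrite expectZ; last by apply: bmeasD => //; exact: bmeas_cst.
rewrite expectD//; last exact: bmeas_cst.
rewrite expectD//; last exact: bmeas_cst.
rewrite expectZ// D0 mulr0 addr0 !expect_cst [X in _ <= expR X]mulrS expRD mulrC ler_wpM2r ?expR_ge0//.
exact: expR_ge1Dx.
Qed.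

(** Markov's inequality for [exp (l (F - E F))]. *)
Lemma tail_bound (l e : R) : 0 <= l -> l * c <= 2^-1 ->
  expect P (\1_[set w | e <= F (W w) - expect P (fun w => F (W w))]) <=
  expR (2 * (l * c) ^+ 2 *+ n - l * e).
Proof.
move=> l0 lc; set m := expect P (fun w => F (W w)).
have bFW : bmeas (fun w => F (W w) - m) by apply: bmeasB; [exact: bF|exact: bmeas_cst].
have be : bmeas (fun w => expR (l * (F (W w) - m))).
  by apply: bexp; apply: bmeasM => //; exact: bmeas_cst.
rewrite addrC expRD.
apply: (@le_trans _ _ (expect P (fun w => expR (- (l * e)) * expR (l * (F (W w) - m))))).
  apply: expect_le.
  - apply: bmeas_indic.
    exact: measurable_superlevel bFW.1.
  - by apply: bmeasM => //; exact: bmeas_cst.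
  - move=> w; rewrite indicE; case: (boolP (w \in _)) => [|_]; last first.
      by rewrite mulr_ge0 ?expR_ge0.
    rewrite inE/= => ew; rewrite -expRD -[leLHS]expR0 ler_expR addrC subr_ge0.
    by rewrite ler_wpM2l.
rewrite expectZ// ler_wpM2l ?expR_ge0//.
exact: exp_moment_bound.
Qed.

End Concentration.

(** * Schur complement *)

Section Schur.
Context (R : realFieldType) (n : nat).
Variables (y : R) (i : 'I_n) (V A b V' A' b' : 'M[R]_n).
Hypotheses (y0 : 0 < y) (Vr : is_resolvent y V A b) (Vr' : is_resolvent y V' A' b').
Hypothesis V'E : forall k l, V' k l = if (k == i) || (l == i) then 0 else V k l.

Let Asym k l : A k l = A l k. Proof. by case: Vr => _ AT _ _ _; rewrite -{1}AT mxE. Qed.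
Let bsym k l : b k l = b l k. Proof. by case: Vr => _ _ bT _ _; rewrite -{1}bT mxE. Qed.
Let A'sym k l : A' k l = A' l k. Proof. by case: Vr' => _ AT _ _ _; rewrite -{1}AT mxE. Qed.
Let b'sym k l : b' k l = b' l k. Proof. by case: Vr' => _ _ bT _ _; rewrite -{1}bT mxE. Qed.
Let Vsym k l : V k l = V l k. Proof. by case: Vr => VT _ _ _ _; rewrite -{1}VT mxE. Qed.

Let row0 (M : 'M[R]_n) k : (V' *m M) i k = 0.
Proof. by rewrite mxE big1// => l _; rewrite V'E eqxx mul0r. Qed.

(** Row and column [i] of [V'] are zero, so [V'] and its resolvent are block diagonal with [i] as a
    block of its own. *)
Let b'0 k : k != i -> b' k i = 0.
Proof.
move=> ki; case: Vr' => _ _ _ /matrixP/(_ i k) + _; rewrite row0 !mxE eq_sym (negbTE ki) sub0r.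
by move/eqP; rewrite eq_sym oppr_eq0 mulf_eq0 gt_eqF//= b'sym => /eqP.
Qed.

Let A'0 k : k != i -> A' k i = 0.
Proof.
move=> ki; case: Vr' => _ _ _ _ /matrixP/(_ i k); rewrite row0 !mxE.
by move/eqP; rewrite eq_sym mulf_eq0 gt_eqF//= A'sym => /eqP.
Qed.

Let al (M : 'M[R]_n) k := \sum_(l | l != i) M k l * V i l.

Let diffE (M N : 'M[R]_n) k m : M k i = 0 -> (M *m (V - V') *m N) k m = al M k * N i m.
Proof.
move=> Mk; rewrite mxE (bigD1 i)//= big1 ?addr0; last first.
  move=> l li; rewrite mxE big1 ?mul0r// => q _; rewrite !mxE V'E (negbTE li) orbF.
  by case: eqVneq => [->|_]; rewrite ?Mk ?mul0r// subrr mulr0.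
congr (_ * _); rewrite mxE (bigD1 i)//= Mk mul0r add0r; apply: eq_bigr => l li.
by rewrite !mxE V'E eqxx orbT subr0 Vsym.
Qed.

(** The resolvent identity in a row [k != i] of [G'] meets only column [i] of [V - V'], whence
    [G_km - G'_km = - al (G') k * G_im]; [reE] and [imE] are its two parts. *)
Let reE k m : k != i -> A k m - A' k m = al b' k * b i m - al A' k * A i m.
Proof.
move=> ki; have := resolvent_diff_re Vr Vr' => /matrixP/(_ k m).
by rewrite mxE [(- A') _ _]mxE => ->; rewrite mxE [X in _ + X]mxE !diffE ?A'0 ?b'0.
Qed.

Let imE k m : k != i -> b k m - b' k m = - (al A' k * b i m + al b' k * A i m).
Proof.
move=> ki; have := resolvent_diff_im Vr Vr' => /matrixP/(_ k m).
by rewrite mxE [(- b') _ _]mxE => ->; rewrite mxE [X in - X]mxE !diffE ?A'0 ?b'0.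
Qed.

Let colA k : k != i -> A i k = al b' k * b i i - al A' k * A i i.
Proof. by move=> ki; rewrite Asym -reE// A'0// subr0. Qed.

Let colb k : k != i -> b i k = - (al A' k * b i i + al b' k * A i i).
Proof. by move=> ki; rewrite bsym -imE// b'0// subr0. Qed.

Definition row_form (M : 'M[R]_n) : R := \sum_(j | j != i) \sum_(k | k != i) V i j * V i k * M j k.

Let formE M : row_form M = \sum_(j | j != i) V i j * al M j.
Proof.
by apply: eq_bigr => j _; rewrite big_distrr/=; apply: eq_bigr => k _; ring.
Qed.

(** Real part of the [(i, i)] entry of [V G = 1 + i y G], after [G_ij = - al (G') j * G_ii] has
    turned the off-diagonal terms into quadratic forms. *)
Lemma schur_re : 1 - y * b i i + (row_form A' * A i i - row_form b' * b i i) = V i i * A i i.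
Proof.
case: Vr => _ _ _ /matrixP/(_ i i) + _; rewrite !mxE eqxx => <-.
rewrite (bigD1 i)//= !formE !big_distrl/= -sumrB -addrA -big_split/= big1 ?addr0// => j ji.
by rewrite Asym colA//; ring.
Qed.

Lemma schur_im : y * A i i + (row_form A' * b i i + row_form b' * A i i) = V i i * b i i.
Proof.
case: Vr => _ _ _ _ /matrixP/(_ i i); rewrite !mxE => <-.
rewrite (bigD1 i)//= !formE !big_distrl/= -big_split/= -addrA -big_split/= big1 ?addr0// => j ji.
by rewrite bsym colb//; ring.
Qed.

(** Real part of [G_ii (G_jj - G'_jj) = G_ij^2], which lets the diagonal of the minor, around which
    the quadratic form concentrates, be replaced by that of the whole matrix. *)
Lemma schur_diag_re j : j != i ->
  A i i * (A j j - A' j j) - b i i * (b j j - b' j j) = A i j ^+ 2 - b i j ^+ 2.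
Proof.
move=> ji; rewrite reE// imE//; have := colA ji; have := colb ji.
move: (A i j) (b i j) => p q -> ->; ring.
Qed.

Lemma schur_diag_im j : j != i ->
  A i i * (b j j - b' j j) + b i i * (A j j - A' j j) = 2 * (A i j * b i j).
Proof.
move=> ji; rewrite reE// imE//; have := colA ji; have := colb ji.
move: (A i j) (b i j) => p q -> ->; ring.
Qed.

Variables (e : R) (s : 'I_n -> R).
Hypotheses (Ve : `|V i i| <= e) (s_ge0 : forall j, 0 <= s j) (s_le : forall j, s j <= e ^+ 2).
Hypotheses (y4 : 4 <= y) (e1 : e <= 1).

Let e0 : 0 <= e. Proof. exact: le_trans Ve. Qed.
Let yi : y^-1 <= 4^-1. Proof. by rewrite lef_pV2// posrE. Qed.
Let yi0 : 0 < y^-1. Proof. by rewrite invr_gt0. Qed.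

(** The price of this replacement: [s_j <= e^2], and a row of [G] has square sum at most
    [1 / y^2]. *)
Let cross : \sum_(j | j != i) s j * (A i j ^+ 2 + b i j ^+ 2) <= e / 4 * y^-1.
Proof.
apply: (@le_trans _ _ (e ^+ 2 * \sum_j (A i j ^+ 2 + b i j ^+ 2))); last first.
  apply: (@le_trans _ _ (e ^+ 2 * y^-1 ^+ 2)).
    by rewrite ler_wpM2l ?sqr_ge0//; exact: resolvent_row_sum Vr _.
  rewrite [y^-1 ^+ 2]expr2 mulrA ler_pM2r//.
    by rewrite ler_pM ?sqr_ge0 ?(ltW yi0)// expr2 ler_piMr.
rewrite [X in _ <= _ * X](bigD1 i)//= mulrDr ler_wpDl ?mulr_ge0 ?sqr_ge0 ?addr_ge0 ?sqr_ge0//.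
by rewrite big_distrr/= ler_sum// => j _; rewrite ler_wpM2r// addr_ge0 ?sqr_ge0.
Qed.

Let dev (M : 'M[R]_n) := row_form M - \sum_(j | j != i) s j * M j j.

(** The errors are the diagonal entry of [V], the deviations of the two quadratic forms from their
    means, and [cross]; [2 e] covers the first and the last. *)
Lemma self_consistent_re :
  `|1 - y * b i i + \sum_(j | j != i) s j * (A j j * A i i - b j j * b i i)|
    <= (2 * e + `|dev A'| + `|dev b'|) * y^-1.
Proof.
have [Ai bi] := resolvent_entry_le y0 Vr i i.
have -> : 1 - y * b i i + \sum_(j | j != i) s j * (A j j * A i i - b j j * b i i) =
  V i i * A i i - A i i * dev A' + b i i * dev b' +
  \sum_(j | j != i) s j * (A i j ^+ 2 - b i j ^+ 2).
  rewrite -schur_re /dev !mulrBr.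
  rewrite [X in _ = _ + X](_ : _ = \sum_(j | j != i) s j * (A j j * A i i - b j j * b i i)
     - A i i * \sum_(j | j != i) s j * A' j j + b i i * \sum_(j | j != i) s j * b' j j).
    by ring.
  rewrite !mulr_sumr -sumrB -big_split/=; apply: eq_bigr => j ji; rewrite -schur_diag_re//; ring.
have c1 : `|\sum_(j | j != i) s j * (A i j ^+ 2 - b i j ^+ 2)| <= e / 4 * y^-1.
  apply: le_trans cross; apply: le_trans (ler_norm_sum _ _ _) _; apply: ler_sum => j _.
  rewrite normrM (ger0_norm (s_ge0 j)) ler_wpM2l// (le_trans (ler_normB _ _))//.
  by rewrite !ger0_norm ?sqr_ge0.
have n4 (p q r t : R) : `|p - q + r + t| <= `|p| + `|q| + `|r| + `|t|.
  by rewrite (le_trans (ler_normD _ _))// lerD2r (le_trans (ler_normD _ _))// lerD2r ler_normB.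
apply: le_trans (n4 _ _ _ _) _; rewrite 3!normrM.
have h1 : `|V i i| * `|A i i| <= e * y^-1 by rewrite ler_pM.
have h2 : `|A i i| * `|dev A'| <= y^-1 * `|dev A'| by rewrite ler_wpM2r.
have h3 : `|b i i| * `|dev b'| <= y^-1 * `|dev b'| by rewrite ler_wpM2r.
have ey : 0 <= e * y^-1 by rewrite mulr_ge0// ltW.
lra.
Qed.

Lemma self_consistent_im :
  `|y * A i i + \sum_(j | j != i) s j * (A j j * b i i + b j j * A i i)|
    <= (2 * e + `|dev A'| + `|dev b'|) * y^-1.
Proof.
have [Ai bi] := resolvent_entry_le y0 Vr i i.
have -> : y * A i i + \sum_(j | j != i) s j * (A j j * b i i + b j j * A i i) =
  V i i * b i i - b i i * dev A' - A i i * dev b' +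
  \sum_(j | j != i) s j * (2 * (A i j * b i j)).
  rewrite -schur_im /dev !mulrBr.
  rewrite [X in _ = _ + X](_ : _ = \sum_(j | j != i) s j * (A j j * b i i + b j j * A i i)
     - b i i * \sum_(j | j != i) s j * A' j j - A i i * \sum_(j | j != i) s j * b' j j).
    by ring.
  rewrite !mulr_sumr -!sumrB/=; apply: eq_bigr => j ji; rewrite -schur_diag_im//; ring.
have c1 : `|\sum_(j | j != i) s j * (2 * (A i j * b i j))| <= e / 4 * y^-1.
  apply: le_trans cross; apply: le_trans (ler_norm_sum _ _ _) _; apply: ler_sum => j _.
  rewrite normrM (ger0_norm (s_ge0 j)) ler_wpM2l//.
  have := sqr_ge0 (A i j + b i j); have := sqr_ge0 (A i j - b i j).
  rewrite ler_norml => h1 h2; apply/andP; split; lra.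
have n4 (p q r t : R) : `|p - q - r + t| <= `|p| + `|q| + `|r| + `|t|.
  by rewrite (le_trans (ler_normD _ _))// lerD2r (le_trans (ler_normB _ _))// lerD2r ler_normB.
apply: le_trans (n4 _ _ _ _) _; rewrite 3!normrM.
have h1 : `|V i i| * `|b i i| <= e * y^-1 by rewrite ler_pM.
have h2 : `|A i i| * `|dev b'| <= y^-1 * `|dev b'| by rewrite ler_wpM2r.
have h3 : `|b i i| * `|dev A'| <= y^-1 * `|dev A'| by rewrite ler_wpM2r.
have ey : 0 <= e * y^-1 by rewrite mulr_ge0// ltW.
lra.
Qed.

(* The fixed point [i be] of [m |-> 1 / (- i y - m)] attracts the diagonal of the resolvent. *)
Lemma self_consistent_contraction (be : R) : 0 <= be -> be <= y^-1 -> y * be + be ^+ 2 = 1 ->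
  y * (`|A i i| + `|b i i - be|) <=
    2 * ((2 * e + `|dev A'| + `|dev b'|) * y^-1) + `|\sum_(j | j != i) s j - 1| * y^-1
    + y^-1 * \sum_(j | j != i) s j * (2 * `|A j j| + `|b j j - be|).
Proof.
move=> be0 bey beE; have [Ai bi] := resolvent_entry_le y0 Vr i i.
have := self_consistent_re; have := self_consistent_im.
set X := y * _ + _; set Y := 1 - _ + _; set D := (2 * e + _ + _) * _ => hX hY.
set Sa := \sum_(j | j != i) s j * A j j; set Sb := \sum_(j | j != i) s j * b j j.
set S := \sum_(j | j != i) s j; pose Sd := \sum_(j | j != i) s j * (b j j - be).
have XE : X = (y + Sb) * A i i + b i i * Sa.
  rewrite /X mulrDl -addrA; congr (_ + _); rewrite /Sa /Sb big_distrl big_distrr/= -big_split/=.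
  by apply: eq_bigr => j _; ring.
(* Subtracting [y be + be^2 = 1] leaves only small quantities: [Sa], [Sd], [b i i - be] and the row
   defect [S - 1]. *)
have YE : Y = A i i * Sa - b i i * Sd - (y + be) * (b i i - be) - be * b i i * (S - 1).
  have -> : Y = 1 - y * b i i + (A i i * Sa - b i i * (Sd + be * S)).
    rewrite /Y; congr (_ + _); rewrite /Sa /Sd /S !big_distrr/= -big_split/= big_distrr/= -sumrB.
    by apply: eq_bigr => j _; ring.
  by rewrite -{1}beE; ring.
have Sb0 : 0 <= Sb.
  by apply: sumr_ge0 => j _; rewrite mulr_ge0//; exact: resolvent_im_ge0 y0 Vr j.
have SaN : `|Sa| <= \sum_(j | j != i) s j * `|A j j|.
  by apply: le_trans (ler_norm_sum _ _ _) _; apply: ler_sum => j _; rewrite normrM ger0_norm.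
have SdN : `|Sd| <= \sum_(j | j != i) s j * `|b j j - be|.
  by apply: le_trans (ler_norm_sum _ _ _) _; apply: ler_sum => j _; rewrite normrM ger0_norm.
have -> : \sum_(j | j != i) s j * (2 * `|A j j| + `|b j j - be|) =
    2 * \sum_(j | j != i) s j * `|A j j| + \sum_(j | j != i) s j * `|b j j - be|.
  by rewrite big_distrr/= -big_split/=; apply: eq_bigr => j _; ring.
have ASa : `|A i i * Sa| <= y^-1 * \sum_(j | j != i) s j * `|A j j| by rewrite normrM ler_pM.
have bSa : `|b i i * Sa| <= y^-1 * \sum_(j | j != i) s j * `|A j j| by rewrite normrM ler_pM.
have bSd : `|b i i * Sd| <= y^-1 * \sum_(j | j != i) s j * `|b j j - be| by rewrite normrM ler_pM.
have beS : `|be * b i i * (S - 1)| <= `|S - 1| * y^-1.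
  rewrite !normrM mulrC ler_wpM2l// (ger0_norm be0) -[leRHS]mul1r ler_pM//.
  by rewrite (le_trans bey)// (le_trans yi)// invf_le1// ler1n.
(* [b] has a nonnegative diagonal, so [Sb >= 0] and the coefficient [y + Sb] of [A i i] is at least
   [y]. *)
have hA : y * `|A i i| <= D + y^-1 * \sum_(j | j != i) s j * `|A j j|.
  apply: (@le_trans _ _ `|(y + Sb) * A i i|).
    by rewrite normrM ler_wpM2r// (le_trans _ (ler_norm _))// lerDl.
  rewrite (_ : (y + Sb) * A i i = X - b i i * Sa); last by rewrite XE; ring.
  by rewrite (le_trans (ler_normB _ _))// lerD.
have hb : y * `|b i i - be| <= D + y^-1 * \sum_(j | j != i) s j * `|A j j|
    + y^-1 * (\sum_(j | j != i) s j * `|b j j - be|) + `|S - 1| * y^-1.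
  apply: (@le_trans _ _ `|(y + be) * (b i i - be)|).
    by rewrite normrM ler_wpM2r// (le_trans _ (ler_norm _))// lerDl.
  rewrite (_ : (y + be) * (b i i - be) =
      - Y + A i i * Sa - b i i * Sd - be * b i i * (S - 1)); last by rewrite YE; ring.
  rewrite (le_trans (ler_normB _ _))// lerD// (le_trans (ler_normB _ _))// lerD//.
  by rewrite (le_trans (ler_normD _ _))// lerD// normrN.
rewrite !mulrDr; lra.
Qed.

End Schur.

(** Rows are exchanged one at a time through the symmetric hybrids [M k]; a row without differences
    leaves the hybrid unchanged and is not counted. *)
Lemma rows_change_trace (R : realFieldType) (n : nat) (y : R) (V A b V' A' b' : 'M[R]_n) : 0 < y ->
  is_resolvent y V A b -> is_resolvent y V' A' b' ->
  `|\tr A' - \tr A| <= 4 / y * (\sum_i [exists j, V' i j != V i j])%:R /\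
  `|\tr b' - \tr b| <= 4 / y * (\sum_i [exists j, V' i j != V i j])%:R.
Proof.
move=> y0 Vr Vr'.
have [VT _ _ _ _] := Vr; have [V'T _ _ _ _] := Vr'.
pose M k : 'M[R]_n := \matrix_(i, j) if (i < k)%N || (j < k)%N then V' i j else V i j.
have MT k : (M k)^T = M k.
  by apply/matrixP => i j; rewrite !mxE orbC -{1}V'T -{1}VT !mxE.
have Mr k := resolvent_exists y0 (MT k).
pose c k := (\sum_(i < n | (i < k)%N) [exists j, V' i j != V i j])%N.
have step k : (k <= n)%N -> `|\tr (res_re y (M k)) - \tr A| <= 4 / y * (c k)%:R /\
    `|\tr (res_im y (M k)) - \tr b| <= 4 / y * (c k)%:R.
  elim: k => [_|k IH kn].
    have M0 : M 0%N = V by apply/matrixP => i j; rewrite mxE.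
    have := Mr 0%N; rewrite {1}M0 => /(resolvent_uniq Vr)[<- <-].
    by rewrite !subrr normr0 mulr_ge0 ?divr_ge0// ltW.
  have [{}IH1 {}IH2] := IH (ltnW kn); pose K := Ordinal kn.
  have cE : c k.+1 = (c k + [exists j, V' K j != V K j])%N.
    rewrite /c (bigD1 K)//= addnC; congr addn; apply: eq_bigl => i.
    by rewrite ltnS -val_eqE/= ltn_neqAle andbC.
  have [eqK|/existsPn eqK] := boolP [exists j, V' K j != V K j].
    have off i j : i != K -> j != K -> M k.+1 i j = M k i j.
      move=> /negbTE iK /negbTE jK; rewrite !mxE !ltnS (leq_eqVlt i) (leq_eqVlt j).
      by rewrite (_ : (i == k :> nat) = false)// (_ : (j == k :> nat) = false).
    have [h1 h2] := row_change_trace y0 (Mr k) (Mr k.+1) off.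
    rewrite cE eqK/= natrD mulrDr mulr1.
    split; [rewrite -(subrKA (\tr (res_re y (M k))))|rewrite -(subrKA (\tr (res_im y (M k))))];
      by rewrite (le_trans (ler_normD _ _))// addrC lerD.
  have -> : M k.+1 = M k.
    have VK j : V' K j = V K j by apply/eqP; have := eqK j; rewrite negbK.
    apply/matrixP => i j; rewrite !mxE !ltnS (leq_eqVlt i) (leq_eqVlt j).
    case: (eqVneq (i : nat) k) => [ik|_] /=.
      have -> : i = K by exact: val_inj.
      by rewrite ltnn /= VK; case: ifP.
    case: (eqVneq (j : nat) k) => [jk|_] //=.
    have -> : j = K by exact: val_inj.
    have E : V' i K = V i K by rewrite -{1}V'T -{1}VT !mxE.
    by rewrite E; do 2 case: ifP.
  by rewrite cE natrD mulrDr; split; rewrite ler_wpDr// mulr_ge0 ?divr_ge0// ltW.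
have := step n (leqnn n); have Mn : M n = V' by apply/matrixP => i j; rewrite mxE ltn_ord.
have := Mr n; rewrite {1}Mn => /(resolvent_uniq Vr')[<- <-].
by rewrite (_ : c n = (\sum_i [exists j, V' i j != V i j])%N)//; apply: eq_bigl => i; rewrite ltn_ord.
Qed.

(** * The Gaussian characteristic function *)

Section RealFunctions.
Context (R : realType).

Lemma continuous_derivable1 (f : R -> R) : (forall x : R, derivable f x 1) -> continuous f.
Proof. by move=> df x; exact/differentiable_continuous/derivable1_diffP. Qed.

Lemma integral_derivative_segment (F f : R -> R) (a b : R) : a < b -> continuous f ->
  (forall x : R, is_derive x (1 : R) F (f x)) ->
  (\int[lebesgue_measure]_(x in `[a, b]) (f x)%:E = (F b - F a)%:E)%E.
Proof.
move=> ab cf dF.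
have cF : continuous F by apply: continuous_derivable1 => x; have [] := dF x.
rewrite (@continuous_FTC2 _ f F)// ?EFinB//.
- exact: continuous_subspaceT.
- split.
  + by move=> x _; have [] := dF x.
  + by apply: cvg_at_right_filter; exact: cF.
  + by apply: cvg_at_left_filter; exact: cF.
- by move=> x _; rewrite derive1E; have [] := dF x.
Qed.

(** The fundamental theorem on [[- (n + 1), n + 1]], followed by dominated convergence. *)
Lemma integral_derivative_line (F f : R -> R) : continuous f ->
  (forall x : R, is_derive x (1 : R) F (f x)) ->
  lebesgue_measure.-integrable setT (EFin \o f) ->
  F n.+1%:R @[n --> \oo] --> 0 -> F (- n.+1%:R) @[n --> \oo] --> 0 ->
  (\int[lebesgue_measure]_x (f x)%:E = 0)%E.
Proof.
move=> cf dF If Fy FNy.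
have mf : measurable_fun setT f by exact: continuous_measurable_fun.
pose g n (x : R) := ((f \_ `[- n.+1%:R, n.+1%:R]) x)%:E.
have cv1 : (fun n => \int[lebesgue_measure]_x g n x)%E @ \oo -->
    (\int[lebesgue_measure]_x (f x)%:E)%E.
  apply: (@dominated_cvg _ (measurableTypeR R) R lebesgue_measure setT measurableT g (EFin \o f) (fun x => `|f x|%:E)) => //.
  - move=> n; apply/measurable_EFinP; apply: (measurable_restrictT _ _).1 => //.
    exact: measurable_funTS.
  - move=> x _; apply: cvg_near_cst; exists (Num.truncn `|x|).+1 => //= n /= xn.
    rewrite /g patchE ifT// inE/= in_itv/=.
    have : `|x| <= n.+1%:R.
      by rewrite (le_trans (ltW (truncnS_gt _)))// ler_nat (leq_trans xn).
    by rewrite ler_norml.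
  - by move/integrable_abse: If.
  - move=> n x _; rewrite /g /= lee_fin patchE; case: ifP => // _.
    by rewrite normr0.
have cv2 : (fun n => \int[lebesgue_measure]_x g n x)%E @ \oo --> 0%:E.
  rewrite (_ : (fun _ => _) = EFin \o (fun n => F n.+1%:R - F (- n.+1%:R))); last first.
    apply/funext => n /=.
    rewrite -(integral_derivative_segment _ cf dF); last by rewrite gtrN.
    rewrite [RHS]integral_mkcond; apply: eq_integral => x _.
    by rewrite /g restrict_EFin.
  apply/fine_cvgP; split; first exact: nearW.
  by rewrite -(subr0 0); apply: cvgB.
exact: cvg_unique cv1 cv2.
Qed.

End RealFunctions.

Lemma measurable_fun_sin (R : realType) : measurable_fun setT (@sin R).
Proof. by apply: continuous_measurable_fun => x; exact: continuous_sin. Qed.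

Lemma measurable_fun_cos (R : realType) : measurable_fun setT (@cos R).
Proof. by apply: continuous_measurable_fun => x; exact: continuous_cos. Qed.

Section GaussianCos.
Context (R : realType).
Let mu := @lebesgue_measure R.
Let p : R -> R := normal_pdf 0 1.
Let c0 : R := normal_peak 1.

Let c0_ge0 : 0 <= c0. Proof. exact: normal_peak_ge0. Qed.

Let pE x : p x = c0 * expR (- (x ^+ 2 / 2)).
Proof.
rewrite /p normal_pdfE ?oner_neq0// /normal_fun subr0 expr1n mulNr.
by [].
Qed.

Let pfun : p = fun x => c0 * expR (- (x ^+ 2 / 2)).
Proof. by apply/funext => x; exact: pE. Qed.

Let dp (x : R) : is_derive x (1 : R) p (- x * p x).
Proof.
rewrite pfun; apply: trigger_derive.
by do 3 rewrite /GRing.scale /=; field.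
Qed.

Let dcos (t x : R) : is_derive t (1 : R) (fun s => cos (s * x) * p x) (- x * sin (t * x) * p x).
Proof. by apply: trigger_derive; rewrite /GRing.scale /=; ring. Qed.

Let dH (t x : R) : is_derive x (1 : R) (fun z => - (p z * sin (t * z))) (x * sin (t * x) * p x - t * (cos (t * x) * p x)).
Proof.
have := dp x; move=> ?.
by apply: trigger_derive; rewrite /GRing.scale /=; ring.
Qed.

Let G (x : R) := `|x| * p x.

Let lin_le_exp (x : R) : `|x| <= 2 * expR (x ^+ 2 / 4).
Proof.
have := expR_ge1Dx (x ^+ 2 / 4); have := sqr_ge0 (`|x| - 1).
rewrite -(real_normK (num_real x)); lra.
Qed.

(** [|x| exp (- x^2 / 2) <= 2 exp (- x^2 / 4)], and the right side is a multiple of the normal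
    density of variance [2]. *)
Let intG : mu.-integrable setT (EFin \o G).
Proof.
pose s2 : R := Num.sqrt 2.
have s2n : s2 != 0 by rewrite sqrtr_eq0 -ltNge.
have s2E : s2 ^+ 2 = 2 by rewrite sqr_sqrtr.
pose K := 2 * c0 / normal_peak s2.
apply: (@le_integrable _ (measurableTypeR R) R mu setT measurableT _ (fun x => (K * normal_pdf 0 s2 x)%:E)) => //.
- apply/measurable_EFinP; apply: measurable_funM; first exact: normr_measurable.
  exact: measurable_normal_pdf.
- move=> x _ /=; rewrite lee_fin /G normrM normr_id (ger0_norm (normal_pdf_ge0 _ _ _)).
  rewrite [leRHS]ger0_norm; last first.
    by rewrite !mulr_ge0 ?invr_ge0 ?normal_peak_ge0 ?normal_pdf_ge0.
  rewrite -/(p x) pE normal_pdfE// /normal_fun subr0 s2E.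
  have KE : K * normal_peak s2 = 2 * c0 by rewrite /K divfK// gt_eqF// normal_peak_gt0.
  rewrite [leRHS]mulrA KE.
  rewrite (_ : - (x ^+ 2 / 2) = - (x ^+ 2 / 4) + - (x ^+ 2 / 4)); last by field.
  rewrite expRD [_ / (2 *+ 2)](_ : _ = - (x ^+ 2 / 4)); last by field.
  rewrite mulrCA !mulrA [2 * c0]mulrC -!mulrA ler_wpM2l// !mulrA ler_wpM2r ?expR_ge0//.
  rewrite expRN ler_pdivrMr ?expR_gt0//.
- under eq_fun do rewrite EFinM.
  by apply: integrableZl => //; exact: integrable_normal_pdf.
Qed.

Let intp : mu.-integrable setT (EFin \o p).
Proof. exact: integrable_normal_pdf. Qed.

Lemma integrable_norm_normal_pdf :
  (@lebesgue_measure R).-integrable setT (EFin \o (fun x => `|x| * normal_pdf 0 1 x)).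
Proof. exact: intG. Qed.

Let mp : measurable_fun setT p. Proof. exact: measurable_normal_pdf. Qed.

Let msin t : measurable_fun setT (fun x : R => sin (t * x)).
Proof. by apply: (measurableT_comp (@measurable_fun_sin R)); apply: measurable_funM. Qed.

Let mcos t : measurable_fun setT (fun x : R => cos (t * x)).
Proof. by apply: (measurableT_comp (@measurable_fun_cos R)); apply: measurable_funM. Qed.

Let intcos t : mu.-integrable setT (EFin \o (fun x => cos (t * x) * p x)).
Proof.
apply: (@le_integrable _ (measurableTypeR R) R mu setT measurableT _ (EFin \o p)) => //.
- by apply/measurable_EFinP; apply: measurable_funM; [exact: mcos|exact: mp].
- move=> x _ /=; rewrite lee_fin normrM ler_piMl//.
  exact: cos_max.
Qed.

Let intxsin t : mu.-integrable setT (EFin \o (fun x => x * sin (t * x) * p x)).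
Proof.
apply: (@le_integrable _ (measurableTypeR R) R mu setT measurableT _ (EFin \o G)) => //.
- apply/measurable_EFinP; apply: measurable_funM; last exact: mp.
  by apply: measurable_funM; [exact: measurable_id|exact: msin].
- move=> x _ /=; rewrite lee_fin /G !normrM normr_id ler_wpM2r// ler_piMr//.
  exact: sin_max.
Qed.

Let phi t := \int[mu]_x (cos (t * x) * p x).

Let dphi (t : R) : is_derive t (1 : R) phi (- (\int[mu]_x (x * sin (t * x) * p x))).
Proof.
pose f s x := cos (s * x) * p x.
have E s x : partial1of2 f s x = - x * sin (s * x) * p x.
  by rewrite partial1of2E; have [_ ->] := dcos s x.
have tI : `]t - 1, t + 1[%classic t by rewrite /= in_itv/=; apply/andP; split; lra.
have h1 : forall x, `]t - 1, t + 1[%classic x -> mu.-integrable setT (EFin \o f x).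
  by move=> x _; exact: intcos.
have h2 : forall x y, `]t - 1, t + 1[%classic x -> setT y -> derivable (f ^~ y) x 1.
  by move=> x y _ _; have [] := dcos x y.
have h3 : forall y, 0 <= G y by move=> y; rewrite mulr_ge0// normal_pdf_ge0.
have h4 : forall x y, `]t - 1, t + 1[%classic x -> setT y -> `|partial1of2 f x y| <= G y.
  move=> x y _ _; rewrite E /G !normrM normrN (ger0_norm (normal_pdf_ge0 _ _ _)).
  by rewrite ler_wpM2r ?normal_pdf_ge0// ler_piMr// sin_max.
have D1 := derivable_under_integral measurableT tI h1 h2 h3 intG h4.
have D2 := differentiation_under_integral measurableT tI h1 h2 h3 intG h4.
split; first exact: D1.
rewrite -derive1E; apply: etrans D2 _.
rewrite -mulN1r -RintegralZl//.
by apply: eq_Rintegral => x _; rewrite E; ring.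
Qed.

(** Since [p' = - x p], the difference of the two integrands is the derivative of
    [- p (x) sin (t x)], which vanishes at infinity. *)
Let by_parts t : \int[mu]_x (x * sin (t * x) * p x) = t * phi t.
Proof.
have If : mu.-integrable setT (EFin \o (fun x => x * sin (t * x) * p x - t * (cos (t * x) * p x))).
  have := integrableB measurableT (intxsin t) (integrableZl measurableT t (intcos t)).
  by apply: eq_integrable => // x _; rewrite /= EFinB EFinM.
have cH : continuous (fun x : R => x * sin (t * x) * p x - t * (cos (t * x) * p x)).
  apply: continuous_derivable1 => x; have := dp x => ?.
  by apply: ex_derive.
have bound (e : nat -> R) : (forall n, `|e n| <= 2 * c0 * n.+1%:R^-1) ->
    e n @[n --> \oo] --> (0 : R).
  move=> he; apply/norm_cvg0P; apply: (@squeeze_cvgr _ _ _ _ (fun=> 0) (fun n => 2 * c0 * n.+1%:R^-1)).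
  - by apply: nearW => n; rewrite normr_ge0/= he.
  - exact: cvg_cst.
  - by rewrite -[X in _ --> X](mulr0 (2 * c0)); apply: cvgM; [exact: cvg_cst|exact: cvg_harmonic].
have pn (n : nat) : p n.+1%:R <= 2 * c0 * n.+1%:R^-1.
  apply: (@le_trans _ _ (c0 * (2 / n.+1%:R))); last by rewrite mulrA [c0 * 2]mulrC.
  rewrite pE; apply: ler_wpM2l => //; rewrite expRN -[2 / _]invrK lef_pV2 ?posrE ?expR_gt0//.
  rewrite invfM invrK (le_trans _ (expR_ge1Dx _))//.
  have : 1 <= n.+1%:R :> R by rewrite ler1n.
  have := sqr_ge0 (n.+1%:R - 1 : R); lra.
have E0 := integral_derivative_line cH (dH t) If.
have : \int[mu]_x (x * sin (t * x) * p x - t * (cos (t * x) * p x)) = 0.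
  rewrite /Rintegral E0//; apply: bound => n.
    rewrite normrN normrM ger0_norm ?normal_pdf_ge0//.
    by rewrite (le_trans _ (pn n))// ler_piMr ?normal_pdf_ge0// sin_max.
  rewrite normrN normrM ger0_norm ?normal_pdf_ge0//.
  rewrite (le_trans _ (pn n))// -(_ : p (- n.+1%:R) = p n.+1%:R); last by rewrite !pE sqrrN.
  by rewrite ler_piMr ?normal_pdf_ge0// sin_max.
rewrite RintegralB//; last by have := integrableZl measurableT t (intcos t).
rewrite RintegralZl//.
by move=> /eqP; rewrite subr_eq0 => /eqP.
Qed.

(** [phi' = - t phi] and [phi 0 = 1], so [phi t * exp (t^2 / 2)] is constantly [1]. *)
Lemma gaussian_cos (t : R) :
  (\int[lebesgue_measure]_x (cos (t * x) * normal_pdf 0 1 x)%:E = (expR (- (t ^+ 2 / 2)))%:E)%E.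
Proof.
rewrite -[LHS]fineK; last by have := integrable_fin_num measurableT (intcos t).
congr EFin; rewrite -/(Rintegral mu setT (fun x => cos (t * x) * p x)) -/(phi t).
have : phi t * expR (t ^+ 2 / 2) = phi 0 * expR (0 ^+ 2 / 2).
  apply: (@is_derive_0_is_cst _ (fun s => phi s * expR (s ^+ 2 / 2))) => x.
  have := dphi x => ?.
  apply: trigger_derive; rewrite /GRing.scale /= by_parts.
  by field.
have -> : phi 0 = 1.
  rewrite /phi /Rintegral; under eq_integral do rewrite mul0r cos0 mul1r.
  by rewrite integral_normal_pdf.
rewrite expr0n/= mul0r expR0 mulr1 => E.
have e0 : expR (t ^+ 2 / 2) != 0 by rewrite gt_eqF// expR_gt0.
by rewrite expRN -[LHS](mulfK e0) E mul1r.
Qed.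

End GaussianCos.

(** * Row sums and truncation *)

Section Trigonometry.
Context (R : realType).
Implicit Types x t : R.

Lemma sin_norm_le x : `|sin x| <= `|x|.
Proof.
wlog x0 : x / 0 <= x.
  by move=> h; case: (lerP 0 x) => [/h//|/ltW]; rewrite -oppr_ge0 => /h; rewrite sinN !normrN.
have [|c _] := @MVT_segment R (@sin R) (@cos R) 0 x x0 (fun z _ => is_derive_sin z).
  exact/continuous_subspaceT/continuous_sin.
rewrite sin0 !subr0 => ->; rewrite normrM ler_piMl//.
exact: cos_max.
Qed.

(** The derivative of [sin] at [0] is [1]. *)
Lemma sin_norm_ge (e : R) : 0 < e -> exists2 r : R, 0 < r & forall x, `|x| <= r -> (1 - e) * `|x| <= `|sin x|.
Proof.
move=> e0; have [h1 D] := is_derive_sin (0 : R).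
move: h1; rewrite /derivable => /cvg_ex[/= l hl].
have lE : l = 1 by rewrite -cos0 -D /derive; exact/esym/cvg_lim.
move: hl; rewrite lE => /cvgrPdist_le/(_ _ e0).
case/nbhs_ballP => r /= r0 hr; exists (r / 2); first by rewrite divr_gt0.
move=> x xr; have [->|x0] := eqVneq x 0; first by rewrite normr0 mulr0.
have := hr x; rewrite /ball /= sub0r normrN => /(_ _ x0).
rewrite addr0 sin0 subr0 /GRing.scale/= mulr1 => h.
have {h}h : `|1 - x^-1 * sin x| <= e by apply: h; rewrite (le_lt_trans xr)// ltr_pdivrMr// ltr_pMr// ltr1n.
have : 1 - e <= `|x^-1 * sin x|.
  have := ler_normD (1 - x^-1 * sin x) (x^-1 * sin x).
  rewrite subrK normr1; lra.
rewrite normrM normfV => h2.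
by rewrite mulrC -ler_pdivlMl// normr_gt0.
Qed.

Lemma cos_double_sin x : 1 - cos (2 * x) = 2 * sin x ^+ 2.
Proof. by have := cos2Dsin2 x; rewrite mulr_natl mulr2n cosD -!expr2; lra. Qed.

Lemma sin_quartic x : 4 * sin x ^+ 4 = 4 * sin x ^+ 2 - sin (2 * x) ^+ 2.
Proof.
have E := cos2Dsin2 x; rewrite (_ : 2 * x = x + x) ?sinD; last by ring.
rewrite (_ : sin x * cos x + cos x * sin x = 2 * (sin x * cos x)); last by ring.
rewrite !exprMn (_ : cos x ^+ 2 = 1 - sin x ^+ 2); last by rewrite -E; ring.
ring.
Qed.

Lemma one_cos_ge0 x : 0 <= 1 - cos x.
Proof. by have := cos_max x; rewrite ler_norml => /andP[_]; lra. Qed.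

Lemma one_cos_le2 x : 1 - cos x <= 2.
Proof. by have := cos_max x; rewrite ler_norml => /andP[]; lra. Qed.

(** The majorant is free of [t] and is itself a bounded continuous test function of [x], so a single
    limit serves all small frequencies. *)
Lemma one_cos_le_min (d t x : R) : `|t| <= d -> 1 - cos (t * x) <= Num.min 2 (d * `|x|).
Proof.
move=> td; rewrite le_min one_cos_le2/=.
rewrite (_ : t * x = 2 * (t * x / 2)) ?cos_double_sin; last by field.
have h1 : `|sin (t * x / 2)| <= `|t * x / 2| := sin_norm_le _.
have h2 : `|sin (t * x / 2)| <= 1 by exact: sin_max.
rewrite -real_normK ?num_real//.
have h3 : `|t * x / 2| <= d * `|x| / 2.
  by rewrite !normrM normfV (gtr0_norm (ltr0n _ 2)) ler_wpM2r// ?invr_ge0// ler_wpM2r.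
have := normr_ge0 (sin (t * x / 2)); nra.
Qed.

(* Multiplying by [2 sin (h / 2)] makes the sum of cosines telescope. *)
Lemma sum_cos_le (h : R) (K : nat) :
  `|sin (h / 2)| * `|\sum_(k < K) cos (k.+1%:R * h)| <= 1.
Proof.
have tel : 2 * sin (h / 2) * \sum_(k < K) cos (k.+1%:R * h) =
    sin (K%:R * h + h / 2) - sin (h / 2).
  elim: K => [|K IH]; first by rewrite big_ord0 mulr0 mul0r add0r subrr.
  rewrite big_ord_recr/= mulrDr IH.
  have -> : K%:R * h + h / 2 = K.+1%:R * h - h / 2 by rewrite -[K.+1]addn1 natrD; field.
  by rewrite !sinD sinN cosN; ring.
have : `|2 * sin (h / 2) * \sum_(k < K) cos (k.+1%:R * h)| <= 2.
  rewrite tel (le_trans (ler_normB _ _))// (_ : 2 = 1 + 1)//.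
  by rewrite lerD// sin_max.
rewrite !normrM (ger0_norm (ler0n _ _)) -mulrA; lra.
Qed.

(** Averaging over the frequencies [k d / K] cancels the cosines: with [h = d x / K], [sum_cos_le]
    and [|sin (h / 2)| >= |h| / 4] bound their sum by [4 K / (d |x|)], at most [K / 2] once
    [d |x| >= 8]. The upper bound on [|x|] keeps [h / 2] in the range of the sine estimate. *)
Lemma sum_one_cos_ge (r d x : R) (K : nat) :
  0 < d -> (0 < K)%N -> (forall z, `|z| <= r -> 2^-1 * `|z| <= `|sin z|) ->
  8 / d <= `|x| -> `|x| <= 2 * r * K%:R / d ->
  K%:R / 2 <= \sum_(k < K) (1 - cos (k.+1%:R * (d / K%:R) * x)).
Proof.
move=> d0 K0 hr x8 xr; pose h := d / K%:R * x.
have Kp : 0 < K%:R :> R by rewrite ltr0n.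
have hE : `|h / 2| = d * `|x| / (2 * K%:R).
  rewrite /h !normrM !normfV (gtr0_norm d0) (gtr0_norm Kp) (gtr0_norm (ltr0n _ 2)).
  by field; rewrite gt_eqF.
have sh : 2^-1 * `|h / 2| <= `|sin (h / 2)|.
  apply: hr; rewrite hE ler_pdivrMr ?mulr_gt0//.
  by move: xr; rewrite ler_pdivlMr// => xr; lra.
have x0 : 0 < `|x| by rewrite (lt_le_trans _ x8)// divr_gt0.
have h0 : 0 < `|h / 2| by rewrite hE divr_gt0 ?mulr_gt0.
have S := sum_cos_le h K.
have : `|\sum_(k < K) cos (k.+1%:R * h)| <= K%:R / 2.
  rewrite -(ler_pM2l (_ : 0 < 2^-1 * `|h / 2|)) ?mulr_gt0//.
  apply: (@le_trans _ _ (`|sin (h / 2)| * `|\sum_(k < K) cos (k.+1%:R * h)|)).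
    by rewrite ler_wpM2r.
  rewrite (le_trans S)// hE (_ : 2^-1 * _ * _ = d * `|x| / 8); last by field; rewrite gt_eqF.
  by move: x8; rewrite ler_pdivrMr// => x8; rewrite ler_pdivlMr// mul1r mulrC.
have -> : \sum_(k < K) (1 - cos (k.+1%:R * (d / K%:R) * x)) =
    K%:R - \sum_(k < K) cos (k.+1%:R * h).
  by rewrite sumrB sumr_const card_ord -mulr_natl mulr1; congr (_ - _); apply: eq_bigr => k _;
    rewrite -mulrA.
by rewrite ler_norml => /andP[_]; lra.
Qed.

End Trigonometry.

(** * Products of factors [1 - x_i] compared with exponentials *)

Section Products.
Context (R : realType).

Lemma prod_one_sub_le (I : Type) (r : seq I) (x : I -> R) : (forall i, 0 <= x i <= 1) ->
  \prod_(i <- r) (1 - x i) <= expR (- \sum_(i <- r) x i).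
Proof.
move=> x01; elim: r => [|i r IH]; first by rewrite !big_nil oppr0 expR0.
rewrite !big_cons opprD expRD ler_pM//.
- by have /andP[_] := x01 i; lra.
- by apply: prodr_ge0 => j _; have /andP[_] := x01 j; lra.
- exact: expR_ge1Dx.
Qed.

(** [1 - x >= exp (- x / (1 - x))], and [1 / (1 - x) <= 1 + 2 e] for [0 <= x <= e <= 1 / 2]. *)
Lemma prod_one_sub_ge (I : Type) (r : seq I) (x : I -> R) (e : R) : e <= 2^-1 ->
  (forall i, 0 <= x i <= e) ->
  expR (- ((1 + 2 * e) * \sum_(i <- r) x i)) <= \prod_(i <- r) (1 - x i).
Proof.
move=> e2 xe; elim: r => [|i r IH]; first by rewrite !big_nil mulr0 oppr0 expR0.
rewrite !big_cons mulrDr opprD expRD ler_pM ?expR_ge0//.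
have /andP[x0 xe'] := xe i.
have x1 : 0 < 1 - x i by lra.
rewrite expRN -[leRHS]invrK lef_pV2 ?posrE ?expR_gt0 ?invr_gt0//.
apply: (@le_trans _ _ (expR (x i / (1 - x i)))).
  by rewrite (le_trans _ (expR_ge1Dx _))// le_eqVlt; apply/orP; left; apply/eqP; field; rewrite gt_eqF.
by rewrite ler_expR ler_pdivrMr//; nra.
Qed.

(** For the sum [S], [1 - k <= exp (- S) <= 1 / (1 + S)]. *)
Lemma sum_le_of_prod (I : Type) (r : seq I) (x : I -> R) (k : R) : k <= 2^-1 ->
  (forall i, 0 <= x i <= 1) -> 1 - k <= \prod_(i <- r) (1 - x i) ->
  \sum_(i <- r) x i <= 2 * k.
Proof.
move=> k2 x01 h; have := le_trans h (prod_one_sub_le r x01).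
set S := \sum_(i <- r) x i; have S0 : 0 <= S by apply: sumr_ge0 => i _; have /andP[] := x01 i.
have : expR (- S) <= (1 + S)^-1.
  by rewrite expRN lef_pV2 ?posrE ?expR_gt0 ?expR_ge1Dx//; lra.
have S1 : 0 < 1 + S by lra.
move=> a b; have := le_trans b a; rewrite -[leRHS]mul1r ler_pdivlMr// => c.
have k0 : 0 <= k by nra.
nra.
Qed.

End Products.

Section BmeasTrig.
Context (R : realType) (d : measure_display) (T : measurableType d).

Lemma bmeas_cos (t : R) (X : T -> R) : measurable_fun setT X -> bmeas (fun w => cos (t * X w)).
Proof.
move=> mX; split; last by exists 1 => w; exact: cos_max.
apply: (measurableT_comp (@measurable_fun_cos R)); apply: measurable_funM => //.
Qed.

Lemma bmeas_sin (t : R) (X : T -> R) : measurable_fun setT X -> bmeas (fun w => sin (t * X w)).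
Proof.
move=> mX; split; last by exists 1 => w; exact: sin_max.
apply: (measurableT_comp (@measurable_fun_sin R)); apply: measurable_funM => //.
Qed.

End BmeasTrig.

Section SymmetricLawExpectation.
Context (R : realType) (d : measure_display) (T : measurableType d).
Variables (P : probability T R) (X : T -> R).
Hypothesis mX : measurable_fun setT X.

Definition symmetric_law (X : T -> R) :=
  forall B : set R, measurable B -> P [set w | B (X w)] = P [set w | B (- X w)].

Let Y w := - X w.
Let mY : measurable_fun setT Y. Proof. exact: measurableT_comp. Qed.
HB.instance Definition _ := isMeasurableFun.Build _ _ _ _ X mX.
HB.instance Definition _ := isMeasurableFun.Build _ _ _ _ Y mY.

Lemma expect_symmetric_law (g : R -> R) :
  symmetric_law X -> bmeas g -> expect P (fun w => g (X w)) = expect P (fun w => g (- X w)).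
Proof.
move=> sX [mg [M gM]].
have E (Z : {mfun T >-> R}) : expect P (fun w => g (Z w)) = fine (\int[distribution P Z]_x (g x)%:E)%E.
  rewrite /expect /Rintegral (@integral_distribution _ _ _ _ _ P Z (EFin \o g))//.
  - exact/measurable_EFinP.
  - apply: (bmeas_integrable P); split; last by exists M => w; exact: gM.
    exact: (measurableT_comp mg).
rewrite (E X) (E Y); congr fine.
by apply: eq_measure_integral => A mA _; exact: sX.
Qed.

End SymmetricLawExpectation.

Section SymmetricLaw.
Context (R : realType) (d : measure_display) (T : measurableType d).
Variable P : probability T R.

Lemma expect_odd (X : T -> R) (g : R -> R) : measurable_fun setT X ->
  symmetric_law P X -> bmeas g -> (forall x, g (- x) = - g x) -> expect P (fun w => g (X w)) = 0.
Proof.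
move=> mX sX bg og; have := expect_symmetric_law mX sX bg.
under [RHS]eq_expect do rewrite og.
rewrite expectN; last by apply: bmeas_comp => //; [exact: bg.1|exact: bg.2].
lra.
Qed.

Lemma expect_sin (X : T -> R) (t : R) : measurable_fun setT X ->
  symmetric_law P X -> expect P (fun w => sin (t * X w)) = 0.
Proof.
move=> mX sX; apply: (@expect_odd X (fun x => sin (t * x))) => //; first exact: (bmeas_sin t (@measurable_id _ R setT)).
by move=> x; rewrite mulrN sinN.
Qed.

Definition tail (e : R) (X : T -> R) : R := expect P (\1_[set w | e < `|X w|]).

Lemma measurable_tail (e : R) (X : T -> R) : measurable_fun setT X -> measurable [set w | e < `|X w|].
Proof.
move=> mX; rewrite -[X in measurable X]setTI.
have -> : [set w | e < `|X w|] = (fun w => `|X w|) @^-1` `]e, +oo[%classic.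
  by apply/seteqP; split => w /=; rewrite in_itv/= andbT.
by apply: (measurableT_comp (@normr_measurable R setT) mX) => //; exact: measurable_itv.
Qed.

Lemma bmeas_tail (e : R) (X : T -> R) : measurable_fun setT X -> bmeas (\1_[set w | e < `|X w|] : T -> R).
Proof. by move=> mX; apply: bmeas_indic; exact: measurable_tail. Qed.

Lemma indic_tail (e : R) (X : T -> R) w :
  \1_[set w | e < `|X w|] w = if e < `|X w| then 1 else 0 :> R.
Proof.
rewrite indicE; case: ifPn => h; first by rewrite mem_set.
by rewrite memNset//=; exact/negP.
Qed.

Lemma tail_cvg0 (X : T -> R) : measurable_fun setT X -> forall e, 0 < e ->
  \forall K \near \oo, tail K%:R X <= e.
Proof.
move=> mX e e0.
have h0 := @nonincreasing_cvg_mu _ _ _ P (fun K => [set w | K%:R < `|X w|]).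
move: h0.
have mA K : measurable [set w | K%:R < `|X w|] by exact: measurable_tail.
rewrite [\bigcap_n _](_ : _ = set0); last first.
  apply/seteqP; split => // w /= h.
  have := h (Num.truncn `|X w|).+1 I => /=; apply/negP; rewrite -leNgt ltW//.
  exact: truncnS_gt.
rewrite measure0 => h0.
have h : P [set w | K%:R < `|X w|] @[K --> \oo] --> 0%E.
  apply: h0 => //.
    by rewrite (le_lt_trans (probability_le1 _ _))// ltry.
  apply/nonincreasing_seqP => K; apply/subsetPset => w /=; apply: le_lt_trans.
  by rewrite ler_nat.
have fin K : P [set w | K%:R < `|X w|] \is a fin_num by exact: fin_num_measure.
move/fine_cvgP : h => [_] /cvgrPdist_le/(_ _ e0); apply: filterS => K /=.
rewrite sub0r normrN /tail expect_indic// => /(le_trans _); apply.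
exact: ler_norm.
Qed.

End SymmetricLaw.

Section RowSum.
Context (R : realType) (d : measure_display) (T : measurableType d).
Variables (P : probability T R) (n : nat) (W : T -> 'M[R]_n).
Hypotheses (mW : mx_measurable W) (symW : mx_symmetric W) (indW : upper_independent P W).
Hypothesis lawW : forall i j, symmetric_law P (fun w => W w i j).

Definition chf (t : R) i j := expect P (fun w => cos (t * W w i j)).

(** Entries are added one at a time: in the addition formula for the cosine both products factor by
    independence, and [E sin = 0] by symmetry removes the second. *)
Lemma chf_row (t : R) (i : 'I_n) :
  expect P (fun w => cos (t * \sum_j W w i j)) = \prod_j chf t i j.
Proof.
rewrite -[index_enum _]enumT; have := enum_uniq 'I_n; elim: (enum 'I_n) => [|j r IH].
  by rewrite big_nil; under eq_expect do rewrite big_nil mulr0 cos0; rewrite expect_cst.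
rewrite cons_uniq big_cons => /andP[jr /IH{}IH].
have mrow (s : seq 'I_n) : measurable_fun setT (fun w => \sum_(l <- s) W w i l).
  by apply: measurable_fun_sumR => l _; exact: mW.
have bl : bmeas (fun w => cos (t * \sum_(l <- r) W w i l)) by exact: bmeas_cos.
have bs : bmeas (fun w => sin (t * \sum_(l <- r) W w i l)) by exact: bmeas_sin.
have bc1 : bmeas (fun x : R => cos (t * x)) := bmeas_cos t (@measurable_id _ R setT).
have bs1 : bmeas (fun x : R => sin (t * x)) := bmeas_sin t (@measurable_id _ R setT).
have mr : measurable_fun [set: bmatrix R n] (fun M : bmatrix R n => \sum_(l <- r) (M : 'M[R]_n) i l).
  by apply: measurable_fun_sumR => l _; exact: measurable_entry.
have dep (M N : 'M[R]_n) : (forall k, k \in r -> M i k = N i k) ->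
    \sum_(l <- r) M i l = \sum_(l <- r) N i l.
  by move=> MN; apply: eq_big_seq => k kr; rewrite MN.
have bcj := bmeas_cos t (mW i j); have bsj := bmeas_sin t (mW i j).
transitivity (expect P (fun w => cos (t * W w i j) * cos (t * \sum_(l <- r) W w i l) -
    sin (t * W w i j) * sin (t * \sum_(l <- r) W w i l))).
  by apply: eq_expect => w; rewrite big_cons mulrDr cosD.
rewrite expectB; [|exact: bmeasM|exact: bmeasM].
rewrite (expect_row_entry_mul mW symW indW (h := fun M => cos (t * \sum_(l <- r) (M : 'M[R]_n) i l))
  jr bc1 (bmeas_cos t mr)); last by move=> M N /dep ->.
rewrite (expect_row_entry_mul mW symW indW (h := fun M => sin (t * \sum_(l <- r) (M : 'M[R]_n) i l))
  jr bs1 (bmeas_sin t mr)); last by move=> M N /dep ->.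
by rewrite (expect_sin _ (mW i j) (lawW i j)) mul0r subr0 IH.
Qed.

End RowSum.

(** [i n] is an index violating the bound at [n] whenever there is one; convergence along this
    choice rules out violations for large [n]. *)
Lemma uniform_of_choices (R : realType) (I : nat -> choiceType) (x0 : forall n, I n)
    (a : forall n, I n -> R) (l : R) :
  (forall i : forall n, I n, (fun n => a n (i n)) @ \oo --> l) ->
  forall e, 0 < e -> \forall n \near \oo, forall i, `|a n i - l| <= e.
Proof.
move=> h e e0; pose i n := xget (x0 n) [set i | e < `|a n i - l|].
have /cvgrPdist_le/(_ _ e0) := h i; apply: filterS => n /= hn j.
rewrite leNgt; apply/negP => hj.
have /= := @xgetPex _ (x0 n) [set i | e < `|a n i - l|] (ex_intro _ j hj).
by rewrite distrC ltNge hn.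
Qed.

(** * Limits of row variances and row tails *)

Section RowLimits.
Context (R : realType) (d : measure_display) (T : measurableType d).
Variables (P : probability T R) (W : forall n : nat, T -> 'M[R]_n.+1).
Hypotheses (mW : forall n, mx_measurable (W n)) (symW : forall n, mx_symmetric (W n)).
Hypothesis indW : forall n, upper_independent P (W n).
Hypothesis lawW : forall n i j, symmetric_law P (fun w => W n w i j).
Hypothesis Hentry : forall f : R -> R, bounded_continuous f -> forall e : R, 0 < e ->
  \forall n \near \oo, forall i j, `|expect P (fun w => f (W n w i j)) - f 0| <= e.
Hypothesis Hrow : forall (f : R -> R) (l : R), bounded_continuous f ->
  (\int[lebesgue_measure]_x (f x * normal_pdf 0 1 x)%:E)%E = l%:E -> forall e : R, 0 < e ->
  \forall n \near \oo, forall i, `|expect P (fun w => f (\sum_j W n w i j)) - l| <= e.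

Let mrow n i : measurable_fun setT (fun w => \sum_j W n w i j).
Proof. by apply: measurable_fun_sumR => j _; exact: mW. Qed.

Let bc_cos (t : R) : bounded_continuous (fun x => cos (t * x)).
Proof.
split; last by exists 1 => x; exact: cos_max.
move=> x; apply: (@continuous_comp _ _ _ (fun x => t * x) cos); last exact: continuous_cos.
exact: mulrl_continuous.
Qed.

Let mWe n (i j : 'I_n.+1) : measurable_fun setT (fun w => W n w i j). Proof. exact: mW. Qed.

Let u n (t : R) (i j : 'I_n.+1) : R := 1 - chf P (W n) t i j.

Let u_ge0 n (t : R) (i j : 'I_n.+1) : 0 <= u t i j.
Proof. by rewrite subr_ge0 expect_le_cst ?cos_le1//; exact: bmeas_cos. Qed.

Let u_expect n (t : R) (i j : 'I_n.+1) : u t i j = expect P (fun w => 1 - cos (t * W n w i j)).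
Proof. by rewrite expectB ?expect_cst//; [exact: bmeas_cst|exact: bmeas_cos]. Qed.

Let u_small t e : 0 < e -> \forall n \near \oo, forall i j : 'I_n.+1, 0 <= u t i j <= e.
Proof.
move=> e0; have := Hentry (bc_cos t) e0; apply: filterS => n h i j.
rewrite u_ge0/=; have := h i j; rewrite mulr0 cos0 distrC; apply: le_trans.
exact: ler_norm.
Qed.

Let prod_chf t e : 0 < e ->
  \forall n \near \oo, forall i : 'I_n.+1, `|\prod_j (1 - u t i j) - expR (- (t ^+ 2 / 2))| <= e.
Proof.
move=> e0; have := Hrow (bc_cos t) (gaussian_cos t) e0; apply: filterS => n h i.
rewrite (_ : \prod_j _ = \prod_j chf P (W n) t i j); last first.
  by apply: eq_bigr => j _; rewrite /u subKr.
by rewrite -chf_row.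
Qed.

(** The product of the [1 - u_ij] lies between [exp (- (1 + 2 h) S)] and [exp (- S)], so its limit
    [exp (- t^2 / 2)] determines that of [S]. *)
Lemma sum_one_sub_chf t e : 0 < e -> \forall n \near \oo, forall i,
  `|\sum_j (1 - chf P (W n) t i j) - t ^+ 2 / 2| <= e.
Proof.
move=> e0; set L := t ^+ 2 / 2; pose dl := e / 2.
have L0 : 0 <= L by rewrite divr_ge0 ?sqr_ge0.
have d0 : 0 < dl by rewrite divr_gt0.
pose h := Num.min 2^-1 (dl / (2 * (L + dl))).
have Ld : 0 < L + dl by lra.
have h0 : 0 < h by rewrite lt_min invr_gt0 ltr0n/= divr_gt0// mulr_gt0.
(* Exponentials closer than [g] have exponents closer than [dl]; [h] is so small that the factor
   [1 + 2 h] costs only another [dl]. *)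
pose g := Num.min (expR (- (L - dl)) - expR (- L)) (expR (- L) - expR (- (L + dl))).
have g0 : 0 < g by rewrite lt_min !subr_gt0 !ltr_expR; apply/andP; split; lra.
have := prod_chf t g0; have := u_small t h0; apply: filterS2 => n hu hp i.
rewrite -/L; set S := \sum_j _.
have h2 : h <= 2^-1 by rewrite /h ge_min lexx.
have hL : h * (2 * (L + dl)) <= dl by rewrite -ler_pdivlMr ?mulr_gt0// /h ge_min lexx orbT.
have P1 : expR (- ((1 + 2 * h) * S)) <= \prod_j (1 - u t i j).
  by apply: prod_one_sub_ge => // j; exact: hu.
have P2 : \prod_j (1 - u t i j) <= expR (- S).
  by apply: prod_one_sub_le => // j; have /andP[-> /le_trans] := hu i j; apply; lra.
have := hp i; rewrite -/L ler_norml => /andP[A B].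
have gA : g <= expR (- (L - dl)) - expR (- L) by rewrite /g ge_min lexx.
have gB : g <= expR (- L) - expR (- (L + dl)) by rewrite /g ge_min lexx orbT.
have S1 : S <= L + dl by rewrite -lerN2 -ler_expR; lra.
have S2 : L - dl <= (1 + 2 * h) * S by rewrite -lerN2 -ler_expR; lra.
rewrite /dl in S1 S2 hL d0 Ld *; rewrite ler_norml; apply/andP; split; last by lra.
nra.
Qed.

Let bsin2 n (t : R) (i j : 'I_n.+1) k : bmeas (fun w => sin (t * W n w i j) ^+ k).
Proof. by apply: bmeasX; exact: bmeas_sin (mWe i j). Qed.

Lemma sum_sin_sqr t e : 0 < e -> \forall n \near \oo, forall i,
  `|\sum_j expect P (fun w => sin (t * W n w i j) ^+ 2) - t ^+ 2| <= e.
Proof.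
move=> e0; have := sum_one_sub_chf (2 * t) (_ : 0 < 2 * e) => /(_ ltac:(lra)).
apply: filterS => n h i; have := h i.
rewrite (_ : \sum_j _ = 2 * \sum_j expect P (fun w => sin (t * W n w i j) ^+ 2)).
  rewrite (_ : _ - _ = 2 * (\sum_j expect P (fun w => sin (t * W n w i j) ^+ 2) - t ^+ 2)); last by field.
  by rewrite normrM ger0_norm// ler_pM2l.
rewrite big_distrr/=; apply: eq_bigr => j _; rewrite -[LHS]/(u _ i j) u_expect -expectZ//.
by apply: eq_expect => w; rewrite -mulrA cos_double_sin.
Qed.

(** In [4 sin^4 x = 4 sin^2 x - sin^2 (2 x)] the two row limits, [4 t^2] and [(2 t)^2], cancel. *)
Lemma sum_sin_quartic t e : 0 < e -> \forall n \near \oo, forall i,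
  \sum_j expect P (fun w => sin (t * W n w i j) ^+ 4) <= e.
Proof.
move=> e0; have := sum_sin_sqr t (_ : 0 < e / 2) => /(_ ltac:(lra)).
have := sum_sin_sqr (2 * t) (_ : 0 < 2 * e) => /(_ ltac:(lra)).
apply: filterS2 => n h1 h2 i; have := h1 i; have := h2 i.
set S1 := \sum_j _; set S2 := \sum_j _; rewrite !ler_norml exprMn => /andP[_ A] /andP[B _].
rewrite (_ : \sum_j _ = S1 - 4^-1 * S2); first by lra.
rewrite big_distrr/= -sumrB; apply: eq_bigr => j _.
have bz : bmeas (fun w => 4^-1 * sin (2 * t * W n w i j) ^+ 2) by apply: bmeasM => //; exact: bmeas_cst.
rewrite -[X in _ - X]expectZ// -expectB//.
apply: eq_expect => w; rewrite -mulrA.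
by have := sin_quartic (t * W n w i j); lra.
Qed.

Let bc_min (c : R) : 0 < c -> bounded_continuous (fun x => Num.min 2 (c * `|x|)).
Proof.
move=> c0; split; last first.
  exists 2 => x; rewrite ger0_norm ?ge_min ?lexx// le_min ler0n mulr_ge0// ltW//.
move=> x; apply: (@continuous_min R R (fun=> 2) (fun y => c * `|y|) x); first exact: cst_continuous.
apply: (@continuousM _ _ (fun=> c) (fun x : R => `|x|)); first exact: cst_continuous.
exact: norm_continuous.
Qed.

(** [C] is the first absolute Gaussian moment, increased by [1] to be positive; it shows that the
    Gaussian mean of [min (2, c |x|)] tends to [0] with [c]. *)
Let gaussian_min : exists C : R, 0 < C /\ forall c, 0 < c -> exists2 l,
  (\int[lebesgue_measure]_x (Num.min 2 (c * `|x|) * normal_pdf 0 1 x)%:E)%E = l%:E & l <= c * C.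
Proof.
have iG := integrable_norm_normal_pdf R.
set m := @lebesgue_measure R in iG *.
exists (1 + \int[m]_x (`|x| * normal_pdf 0 1 x)); split.
  by rewrite ltr_pwDl// Rintegral_ge0// => x _; rewrite mulr_ge0// normal_pdf_ge0.
move=> c c0.
have mf : measurable_fun setT (fun x : R => Num.min 2 (c * `|x|)).
  by apply: continuous_measurable_fun; exact: (bc_min c0).1.
have i1 : m.-integrable setT (fun x => (c * (`|x| * normal_pdf 0 1 x))%:E).
  by under eq_fun do rewrite EFinM; exact: integrableZl.
have i2 : m.-integrable setT (EFin \o (fun x => Num.min 2 (c * `|x|) * normal_pdf 0 1 x)).
  apply: (@le_integrable _ (measurableTypeR R) R m setT measurableT _ _ _ _ i1) => //.
  - by apply/measurable_EFinP; apply: measurable_funM => //; exact: measurable_normal_pdf.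
  - move=> x _ /=; have x0 : 0 <= c * `|x| by rewrite mulr_ge0// ltW.
    rewrite lee_fin mulrA [leLHS]normrM [leRHS]normrM ler_wpM2r// (ger0_norm x0).
    by rewrite ger0_norm ?ge_min ?lexx ?orbT// le_min ler0n.
exists (\int[m]_x (Num.min 2 (c * `|x|) * normal_pdf 0 1 x)).
  by rewrite /Rintegral fineK//; exact: integrable_fin_num.
apply: (@le_trans _ _ (\int[m]_x (c * (`|x| * normal_pdf 0 1 x)))).
  apply: le_Rintegral => //= x _; rewrite mulrA ler_wpM2r ?normal_pdf_ge0//.
  by rewrite ge_min lexx orbT.
rewrite RintegralZl// ler_wpM2l ?ltW//; lra.
Qed.

(** For [|t| <= c], [E (1 - cos (t S_i)) <= E min (2, c |S_i|)] is small for the row sum [S_i];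
    hence the product of the [phi_ij (t)] is near [1] and the [1 - phi_ij (t)] have a small sum.
    Averaged over the frequencies [k c / K], [1 - cos] detects all entries between [8 / c] and
    [2 r K / c]. *)
Lemma row_tail_large e : 0 < e -> exists2 M, 0 < M &
  \forall n \near \oo, forall i, \sum_j tail P M (fun w => W n w i j) <= e.
Proof.
move=> e0; have [C [C0 hC]] := gaussian_min.
have [r r0 hr] := @sin_norm_ge R 2^-1 (ltac:(rewrite invr_gt0 ltr0n//)).
(* The frequency average will cost [2 * 2 k = 4 k <= e / 2]; [c] is chosen so that the Gaussian mean
   is at most [c C = k / 2]. *)
pose k := Num.min 2^-1 (e / 8); have k0 : 0 < k by rewrite lt_min invr_gt0 ltr0n/= divr_gt0.
pose c := k / (2 * C); have c0 : 0 < c by rewrite divr_gt0// mulr_gt0.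
have [l lE lC] := hC c c0.
exists (8 / c); first by rewrite divr_gt0.
have := Hrow (bc_min c0) lE (_ : 0 < k / 2) => /(_ ltac:(lra)).
(* Keeps each [1 - phi_ij (t)] at most [1], as [sum_le_of_prod] requires. *)
have := Hentry (bc_min c0) ltr01.
apply: filterS2 => n hE hR i.
have bmin (X : T -> R) : measurable_fun setT X -> bmeas (fun w : T => Num.min 2 (c * `|X w|)).
  move=> mX; have [cf [M fM]] := bc_min c0; split; last by exists M => w; exact: fM.
  exact: (measurableT_comp (continuous_measurable_fun cf)).
have sum_le t : `|t| <= c -> \sum_j u t i j <= 2 * k.
  move=> tc; apply: sum_le_of_prod; first by rewrite /k ge_min lexx.
    move=> j; rewrite u_ge0/=; have := hE i j; rewrite normr0 mulr0 min_r// subr0 => h.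
    rewrite u_expect; apply: le_trans h; rewrite (le_trans _ (ler_norm _))//.
    apply: expect_le; [|exact: bmin|by move=> w; exact: one_cos_le_min].
    by apply: bmeasB; [exact: bmeas_cst|exact: bmeas_cos].
  rewrite (_ : \prod_j _ = expect P (fun w => cos (t * \sum_j W n w i j))); last first.
    by rewrite chf_row//; apply: eq_bigr => j _; rewrite /u subKr.
  have bcs : bmeas (fun w => cos (t * \sum_j W n w i j)) by exact: bmeas_cos.
  rewrite lerBlDr -lerBlDl -[X in X - _](expect_cst P) -expectB//; last exact: bmeas_cst.
  have := hR i; rewrite ler_norml => /andP[_]; rewrite lerBlDr => h.
  have ck : c * C = k / 2 by rewrite /c; field; rewrite gt_eqF.
  apply: (@le_trans _ _ (k / 2 + l)); last by lra.
  apply: le_trans h; apply: expect_le; [|exact: bmin|by move=> w; exact: one_cos_le_min].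
  by apply: bmeasB => //; exact: bmeas_cst.
(* Here [n] and [i] are fixed, so [K] may depend on them: each of the [n + 1] entries exceeds
   [2 r K / c] with probability at most [e / (2 (n + 1))]. *)
have tail_K : \forall K \near \oo, forall j, tail P K%:R (fun w => W n w i j) <= e / (2 * n.+1%:R).
  by apply: filter_forall => j; apply: tail_cvg0 => //; rewrite divr_gt0// mulr_gt0// ltr0n.
have [K K0 hK] : exists2 K : nat, (0 < K)%N & forall j, tail P (2 * r * K%:R / c) (fun w => W n w i j) <= e / (2 * n.+1%:R).
  have [K0 _ hK0] := tail_K.
  exists (Num.truncn (K0%:R * c / (2 * r))).+1 => // j.
  apply: le_trans (hK0 K0 _ j) => //=.
  apply: expect_le; [exact: bmeas_tail|exact: bmeas_tail|move=> w].
  rewrite !indic_tail; case: ifPn => // h1; case: ifPn => // /negP[].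
  apply: le_lt_trans h1; rewrite ler_pdivlMr// -ler_pdivrMl ?mulr_gt0//.
  by rewrite mulrC ltW// truncnS_gt.
have Kp : 0 < K%:R :> R by rewrite ltr0n.
have pt j w : \1_[set w | 8 / c < `|W n w i j|] w <=
    \1_[set w | 2 * r * K%:R / c < `|W n w i j|] w +
    \sum_(k < K) (2 / K%:R) * (1 - cos (k.+1%:R * (c / K%:R) * W n w i j)).
  have s0 : 0 <= \sum_(k < K) (2 / K%:R) * (1 - cos (k.+1%:R * (c / K%:R) * W n w i j)).
    by apply: sumr_ge0 => q _; rewrite mulr_ge0 ?one_cos_ge0// divr_ge0// ltW.
  rewrite !indic_tail; case: ifPn => [h8|_]; last by rewrite addr_ge0//; case: ifP.
  case: ltP => hK2; first by rewrite lerDl.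
  rewrite add0r -big_distrr/= -ler_pdivrMl ?divr_gt0// invf_div mulr1.
  apply: sum_one_cos_ge (ltW h8) hK2 => // z /hr; rewrite (_ : 1 - 2^-1 = 2^-1)//; by field.
have bt j q : bmeas (fun w => 2 / K%:R * (1 - cos (q * W n w i j))).
  by apply: bmeasM; [|apply: bmeasB; [|exact: bmeas_cos]]; exact: bmeas_cst.
have pj j : tail P (8 / c) (fun w => W n w i j) <=
    e / (2 * n.+1%:R) + \sum_(k < K) (2 / K%:R) * u (k.+1%:R * (c / K%:R)) i j.
  have btl M : bmeas (\1_[set w | M < `|W n w i j|] : T -> R) by exact: bmeas_tail.
  have bs : bmeas (fun w => \sum_(k < K) (2 / K%:R) * (1 - cos (k.+1%:R * (c / K%:R) * W n w i j))).
    by apply: bmeas_sum => q _.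
  apply: le_trans (expect_le P _ _ (pt j)) _ => //; first exact: bmeasD.
  rewrite expectD// lerD//; first exact: hK.
  rewrite expect_sum//; apply: ler_sum => q _.
  by rewrite expectZ ?u_expect//; apply: bmeasB; [exact: bmeas_cst|exact: bmeas_cos].
apply: (le_trans (ler_sum _ (fun j _ => pj j))).
rewrite big_split/= sumr_const card_ord -[_ *+ n.+1]mulr_natl exchange_big/=.
have E2 (N : R) : N != 0 -> N * (e / (2 * N)) = e / 2 by move=> N0; field.
rewrite E2 ?pnatr_eq0//.
have S2 : \sum_(q < K) \sum_j (2 / K%:R) * u (q.+1%:R * (c / K%:R)) i j <= \sum_(q < K) (2 / K%:R) * (2 * k).
  apply: ler_sum => q _; rewrite -big_distrr/= ler_wpM2l ?divr_ge0 ?(ltW Kp)//.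
  apply: sum_le; rewrite ger0_norm; last by rewrite mulr_ge0// divr_ge0// ltW.
  by rewrite mulrCA ler_piMr ?(ltW c0)// ler_pdivrMr// mul1r ler_nat.
have kE : k <= e / 8 by rewrite /k ge_min lexx orbT.
rewrite sumr_const card_ord -[X in _ <= X]mulr_natl in S2.
have E4 : K%:R * (2 / K%:R * (2 * k)) = 4 * k by field; rewrite gt_eqF.
rewrite E4 in S2; lra.
Qed.

(** Beyond a high level [L], [row_tail_large] applies. Between [M] and [L] the choice [t = r / L]
    gives [sin^4 (t x) >= c], and the row sum of [E sin^4] tends to [0]. *)
Lemma row_tail M e : 0 < M -> 0 < e ->
  \forall n \near \oo, forall i, \sum_j tail P M (fun w => W n w i j) <= e.
Proof.
move=> M0 e0; have e2 : 0 < e / 2 by rewrite divr_gt0.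
have [L L0 hL] := row_tail_large e2.
have [r r0 hr] := @sin_norm_ge R 2^-1 (ltac:(rewrite invr_gt0 ltr0n//)).
pose t := r / L; have t0 : 0 < t by rewrite divr_gt0.
pose c := (2^-1 * (t * M)) ^+ 4; have c0 : 0 < c by rewrite exprn_gt0// !mulr_gt0// invr_gt0.
have := hL; have := sum_sin_quartic t (_ : 0 < c * (e / 2)) => /(_ ltac:(nra)).
apply: filterS2 => n h4 hl i.
have pt j w : \1_[set w | M < `|W n w i j|] w <= \1_[set w | L < `|W n w i j|] w +
    c^-1 * sin (t * W n w i j) ^+ 4.
  have s0 : 0 <= c^-1 * sin (t * W n w i j) ^+ 4.
    by rewrite mulr_ge0 ?invr_ge0 ?(ltW c0)// exprn_even_ge0.
  rewrite !indic_tail; case: ifPn => [hM|_]; last by rewrite addr_ge0//; case: ifP.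
  case: ltP => hL2; first by rewrite lerDl.
  rewrite add0r -ler_pdivrMl ?invr_gt0// invrK mulr1 /c.
  have -> : sin (t * W n w i j) ^+ 4 = `|sin (t * W n w i j)| ^+ 4.
    by rewrite -[RHS]normrX ger0_norm// exprn_even_ge0.
  have tM : 0 <= 2^-1 * (t * M) by rewrite mulr_ge0 ?invr_ge0// mulr_ge0// ltW.
  rewrite lerXn2r ?nnegrE//.
  have h : `|t * W n w i j| <= r.
    by rewrite normrM gtr0_norm// /t mulrAC ler_pdivrMr// ler_wpM2l// ltW.
  move: (hr _ h); rewrite (_ : 1 - 2^-1 = 2^-1); last by field.
  apply: le_trans; rewrite normrM (gtr0_norm t0) ler_wpM2l ?invr_ge0// ler_wpM2l ?ltW//.
have btl j K : bmeas (\1_[set w | K < `|W n w i j|] : T -> R) by exact: bmeas_tail.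
have b4 j : bmeas (fun w => c^-1 * sin (t * W n w i j) ^+ 4).
  by apply: bmeasM => //; exact: bmeas_cst.
have pj j : tail P M (fun w => W n w i j) <= tail P L (fun w => W n w i j) +
    c^-1 * expect P (fun w => sin (t * W n w i j) ^+ 4).
  apply: le_trans (expect_le P _ _ (pt j)) _ => //; first exact: bmeasD.
  by rewrite expectD// expectZ.
apply: (le_trans (ler_sum _ (fun j _ => pj j))).
rewrite big_split/= -big_distrr/= (splitr e) lerD//.
by rewrite ler_pdivrMl// mulrC.
Qed.

Definition truncate (M x : R) : R := if `|x| <= M then x else 0.

Lemma truncateN M x : truncate M (- x) = - truncate M x.
Proof. by rewrite /truncate normrN; case: ifP; rewrite ?oppr0. Qed.

Lemma truncate_le M x : 0 <= M -> `|truncate M x| <= M.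
Proof. by rewrite /truncate; case: ifP => // _; rewrite normr0. Qed.

Lemma measurable_truncate M : measurable_fun setT (truncate M).
Proof.
rewrite (_ : truncate M = fun x => x * \1_(`[- M, M]%classic) x); last first.
  apply/funext => x; rewrite /truncate indicE mem_setE in_itv/= -ler_norml.
  by case: ifP; rewrite ?mulr1 ?mulr0.
by apply: measurable_funM => //; exact: measurable_indic.
Qed.

(** With [t = r / M], the truncation [v] of [w] satisfies [(1 - e')^2 t^2 v^2 <= sin^2 (t w) <= t^2
    v^2 + 1_{|w| > M}]. Summing over the row compares its variance with the limit [t^2] of the
    sines. *)
Lemma row_variance M e : 0 < M -> 0 < e -> \forall n \near \oo, forall i,
  `|\sum_j expect P (fun w => truncate M (W n w i j) ^+ 2) - 1| <= e.
Proof.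
move=> M0 e0.
pose e' := Num.min 2^-1 (e / 16); have e'0 : 0 < e' by rewrite lt_min invr_gt0 ltr0n/= divr_gt0.
have e'2 : e' <= 2^-1 by rewrite ge_min lexx.
have e'e : e' <= e / 16 by rewrite ge_min lexx orbT.
have [r r0 hr] := @sin_norm_ge R e' e'0.
pose t := r / M; have t0 : 0 < t by rewrite divr_gt0.
have t2 : 0 < t ^+ 2 by rewrite exprn_gt0.
have := sum_sin_sqr t (_ : 0 < t ^+ 2 * e') => /(_ ltac:(nra)).
have := row_tail M0 (_ : 0 < t ^+ 2 * e') => /(_ ltac:(nra)).
apply: filterS2 => n h1 h2 i.
have hT := h1 i; have := h2 i; rewrite ler_norml => /andP[hA hB].
set S := \sum_j _ in hA hB; set S1 := \sum_j _ in hT.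
set V := \sum_j _.
have btr j : bmeas (fun w => truncate M (W n w i j) ^+ 2).
  apply: bmeasX; split; first exact: (measurableT_comp (measurable_truncate M) (mWe i j)).
  by exists M => w; rewrite truncate_le// ltW.
have btl j : bmeas (\1_[set w | M < `|W n w i j|] : T -> R) by exact: bmeas_tail.
have sqn (x : R) : x ^+ 2 = `|x| ^+ 2 by rewrite real_normK ?num_real.
have A1 : S <= t ^+ 2 * V + S1.
  rewrite /S /V /S1 big_distrr -big_split/=; apply: ler_sum => j _.
  have bz : bmeas (fun w => t ^+ 2 * truncate M (W n w i j) ^+ 2).
    by apply: bmeasM => //; exact: bmeas_cst.
  rewrite -expectZ// -expectD//; apply: expect_le => //; first exact: bmeasD.
  move=> w; rewrite indic_tail /truncate -/(_ < _); case: leP => h.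
    rewrite addr0 -exprMn (sqn (sin _)) (sqn (_ * _)) lerXn2r ?nnegrE//; exact: sin_norm_le.
  by rewrite expr0n mulr0 add0r sqn expr_le1//; exact: sin_max.
have A2 : (1 - e') ^+ 2 * (t ^+ 2 * V) <= S.
  rewrite /S /V !big_distrr/=; apply: ler_sum => j _.
  have bz : bmeas (fun w => t ^+ 2 * truncate M (W n w i j) ^+ 2).
    by apply: bmeasM => //; exact: bmeas_cst.
  rewrite -expectZ// -expectZ//; apply: expect_le => //.
    by apply: bmeasM => //; exact: bmeas_cst.
  move=> w; rewrite /truncate; case: ifPn => h; last first.
    by rewrite expr0n/= !mulr0 sqr_ge0.
  rewrite -!exprMn (sqn (sin _)) sqn lerXn2r ?nnegrE//.
  rewrite normrM ger0_norm; last by lra.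
  by apply: hr; rewrite normrM gtr0_norm// /t mulrAC ler_pdivrMr// ler_wpM2l// ltW.
have V1 : 1 - 2 * e' <= V.
  rewrite -(ler_pM2l t2); lra.
have V2 : V <= 1 + 16 * e'.
  have : (1 - e') ^+ 2 * V <= 1 + e'.
    by rewrite -(ler_pM2l t2) mulrCA; lra.
  have q : 1 + e' <= (1 - e') ^+ 2 * (1 + 16 * e') by nra.
  by move=> /le_trans/(_ q); rewrite ler_pM2l// exprn_gt0//; lra.
rewrite ler_norml; apply/andP; split; lra.
Qed.

End RowLimits.

(** * The resolvent of the truncated matrix *)

Lemma bmeas_truncate (R : realType) (d : measure_display) (T : measurableType d) (e : R) (X : T -> R) :
  0 <= e -> measurable_fun setT X -> bmeas (fun w => truncate e (X w)).
Proof.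
move=> e0 mX; split; first exact: (measurableT_comp (measurable_truncate e) mX).
by exists e => w; exact: truncate_le.
Qed.

(** * Variance of the quadratic form in one row *)

Section QuadraticForm.
Context (R : realType) (d : measure_display) (T : measurableType d).
Variables (P : probability T R) (n : nat) (W : T -> 'M[R]_n).
Hypotheses (mW : mx_measurable W) (symW : mx_symmetric W) (indW : upper_independent P W).
Hypothesis lawW : forall i j, symmetric_law P (fun w => W w i j).

Variables (e : R) (i : 'I_n).
Hypothesis e0 : 0 <= e.
Let v j w := truncate e (W w i j).
Let s j := expect P (fun w => v j w ^+ 2).

Let bv j : bmeas (v j). Proof. exact: bmeas_truncate. Qed.

Let btr : bmeas (truncate e).
Proof. by split; [exact: measurable_truncate|exists e => x; exact: truncate_le]. Qed.

Let Ev j : expect P (v j) = 0.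
Proof. by apply: (expect_odd (mW i j) (lawW i j) btr); exact: truncateN. Qed.

Let lin (c : 'I_n -> R) (r : seq 'I_n) (M : bmatrix R n) : R :=
  \sum_(k <- r) c k * truncate e ((M : 'M[R]_n) i k).

Let quad (A : 'M[R]_n) (r : seq 'I_n) (M : bmatrix R n) : R :=
  \sum_(j <- r) \sum_(k <- r) truncate e ((M : 'M[R]_n) i j) * truncate e ((M : 'M[R]_n) i k) * A j k
  - \sum_(j <- r) s j * A j j.

Let bentry k : bmeas (fun M : bmatrix R n => truncate e ((M : 'M[R]_n) i k)).
Proof. exact: bmeas_truncate (measurable_entry i k). Qed.

Let blin c r : bmeas (lin c r).
Proof. by apply: bmeas_sum => k _; apply: bmeasM => //; exact: bmeas_cst. Qed.

Let bquad A r : bmeas (quad A r).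
Proof.
apply: bmeasB; last exact: bmeas_cst.
apply: bmeas_sum => j _; apply: bmeas_sum => k _.
by apply: bmeasM; [exact: bmeasM|exact: bmeas_cst].
Qed.

Let bW (F : bmatrix R n -> R) : bmeas F -> bmeas (fun w => F (W w)).
Proof. exact: bmeas_mx. Qed.

Let mulE j := @expect_row_entry_mul _ _ _ _ _ _ mW symW indW i j.

Let lin_dep c r (M N : 'M[R]_n) : (forall k, k \in r -> M i k = N i k) -> lin c r M = lin c r N.
Proof. by move=> MN; apply: eq_big_seq => k kr; rewrite MN. Qed.

Let quad_dep A r (M N : 'M[R]_n) : (forall k, k \in r -> M i k = N i k) -> quad A r M = quad A r N.
Proof.
move=> MN; rewrite /quad; congr (_ - _); apply: eq_big_seq => k kr.
by apply: eq_big_seq => l lr; rewrite !MN.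
Qed.

Let lin_second c r : uniq r ->
  expect P (fun w => lin c r (W w) ^+ 2) = \sum_(k <- r) c k ^+ 2 * s k.
Proof.
elim: r => [_|j r IH /andP[jr ur]].
  by rewrite big_nil; under eq_expect do rewrite /lin big_nil expr0n; rewrite expect_cst.
rewrite big_cons -IH//.
have bl : bmeas (fun w => lin c r (W w)) by exact: bW.
transitivity (expect P (fun w => c j ^+ 2 * v j w ^+ 2 + (2 * c j) * (v j w * lin c r (W w)) + lin c r (W w) ^+ 2)).
  by apply: eq_expect => w; rewrite /lin big_cons -/(lin c r _) -/(v j w); ring.
have b1 : bmeas (fun w => c j ^+ 2 * v j w ^+ 2) by apply: bmeasM; [exact: bmeas_cst|exact: bmeasX].
have b2 : bmeas (fun w => (2 * c j) * (v j w * lin c r (W w))) by apply: bmeasM; [exact: bmeas_cst|exact: bmeasM].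
rewrite expectD//; [|exact: bmeasD|exact: bmeasX].
rewrite expectD// !expectZ//; [|exact: bmeasM|exact: bmeasX].
rewrite (@mulE j r (truncate e) (lin c r))//; last by move=> M N; exact: lin_dep.
by rewrite -/(v j) Ev mul0r mulr0 addr0.
Qed.

Let s_ge0 j : 0 <= s j. Proof. by apply: expect_ge0 => w; exact: sqr_ge0. Qed.

Let v_le j w : v j w ^+ 2 <= e ^+ 2.
Proof. by rewrite -(real_normK (num_real (v j w))) lerXn2r ?nnegrE// truncate_le. Qed.

Let s_le j : s j <= e ^+ 2.
Proof. by apply: expect_le_cst => [|w]; [exact: bmeasX|exact: v_le]. Qed.

(** Truncation gives [v^4 <= e^2 v^2]. *)
Let fourth j : expect P (fun w => (v j w ^+ 2 - s j) ^+ 2) <= e ^+ 2 * s j.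
Proof.
have b2 : bmeas (fun w => v j w ^+ 2) by exact: bmeasX.
have b3 : bmeas (fun w => (e ^+ 2 - 2 * s j) * v j w ^+ 2) by apply: bmeasM => //; exact: bmeas_cst.
apply: (@le_trans _ _ (expect P (fun w => (e ^+ 2 - 2 * s j) * v j w ^+ 2 + s j ^+ 2))).
  apply: expect_le.
  - by apply: bmeasX; apply: bmeasB => //; exact: bmeas_cst.
  - by apply: bmeasD => //; exact: bmeas_cst.
  - move=> w; have := v_le j w; have := sqr_ge0 (v j w); set z := v j w ^+ 2; nra.
rewrite expectD//; last exact: bmeas_cst.
by rewrite expectZ// expect_cst -/(s j); have := s_ge0 j; nra.
Qed.

(** Adding the variable [v_j] changes the centred form by [2 v_j L + A_jj (v_j^2 - s_j)], with [L]
    linear in the earlier variables. All cross terms have mean zero, because [v_j] and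
    [v_j (v_j^2 - s_j)] are odd and [v_j^2 - s_j] is centred. The two squares contribute [4] and [1]
    to the constant [5]. *)
Lemma quadratic_form_variance (A : 'M[R]_n) (K : R) (r : seq 'I_n) : A^T = A ->
  (forall j, \sum_k A j k ^+ 2 <= K) -> uniq r ->
  expect P (fun w => (\sum_(j <- r) \sum_(k <- r) truncate e (W w i j) * truncate e (W w i k) * A j k
     - \sum_(j <- r) expect P (fun w => truncate e (W w i j) ^+ 2) * A j j) ^+ 2) <=
  5 * e ^+ 2 * K * \sum_(j <- r) expect P (fun w => truncate e (W w i j) ^+ 2).
Proof.
move=> AT AK; rewrite -[X in is_true (X <= _)]/(expect P (fun w => quad A r (W w) ^+ 2)) -[X in _ * X]/(\sum_(j <- r) s j).
have AK2 j : A j j ^+ 2 <= K.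
  by apply: le_trans (AK j); rewrite (bigD1 j)//= lerDl sumr_ge0// => k _; exact: sqr_ge0.
elim: r => [_|j r IH /andP[jr ur]].
  by rewrite big_nil mulr0; under eq_expect do rewrite /quad !big_nil subr0 expr0n; rewrite expect_cst.
rewrite big_cons mulrDr.
pose q w := quad A r (W w); pose L w := lin (A j) r (W w); pose m := A j j.
have bq : bmeas q by exact: bW.
have bL : bmeas L by exact: bW.
have qE w : quad A (j :: r) (W w) = q w + 2 * (v j w * L w) + m * (v j w ^+ 2 - s j).
  rewrite /quad !big_cons /q /quad -/(v j w).
  under [X in _ + X - _]eq_bigr do rewrite big_cons.
  rewrite big_split/=.
  have -> : \sum_(k <- r) v j w * truncate e (W w i k) * A j k = v j w * L w.
    by rewrite /L /lin big_distrr/=; apply: eq_bigr => k _; ring.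
  have -> : \sum_(k <- r) truncate e (W w i k) * truncate e (W w i j) * A k j = v j w * L w.
    by rewrite /L /lin big_distrr/=; apply: eq_bigr => k _; rewrite -{1}AT mxE -/(v j w); ring.
  by rewrite -/(v j w) -/m; ring.
have bd : bmeas (fun w => v j w ^+ 2 - s j) by apply: bmeasB; [exact: bmeasX|exact: bmeas_cst].
have bc (c : R) f : bmeas f -> bmeas (fun w : T => c * f w) by move=> bf; apply: bmeasM => //; exact: bmeas_cst.
have -> : expect P (fun w => quad A (j :: r) (W w) ^+ 2) = expect P (fun w => q w ^+ 2 + 4 * (v j w ^+ 2 * L w ^+ 2) + m ^+ 2 * (v j w ^+ 2 - s j) ^+ 2
   + (4 * (v j w * (q w * L w)) + (2 * m) * ((v j w ^+ 2 - s j) * q w) + (4 * m) * (v j w * (v j w ^+ 2 - s j) * L w))).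
  by apply: eq_expect => w; rewrite qE; ring.
have t1 : bmeas (fun w => q w ^+ 2) by exact: bmeasX.
have bX2 : bmeas (fun w => (v j w ^+ 2 - s j) ^+ 2) by exact: bmeasX.
have bvL : bmeas (fun w => v j w ^+ 2 * L w ^+ 2) by apply: bmeasM; exact: bmeasX.
have bvqL : bmeas (fun w => v j w * (q w * L w)) by apply: bmeasM => //; exact: bmeasM.
have bdq : bmeas (fun w => (v j w ^+ 2 - s j) * q w) by exact: bmeasM.
have bvdL : bmeas (fun w => v j w * (v j w ^+ 2 - s j) * L w) by apply: bmeasM => //; exact: bmeasM.
have t2 := bc 4 _ bvL; have t3 := bc (m ^+ 2) _ bX2; have t4 := bc 4 _ bvqL.
have t5 := bc (2 * m) _ bdq; have t6 := bc (4 * m) _ bvdL.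
have t12 := bmeasD t1 t2; have t123 := bmeasD t12 t3.
have t45 := bmeasD t4 t5; have t456 := bmeasD t45 t6.
rewrite (expectD _ t123 t456) (expectD _ t12 t3) (expectD _ t1 t2) (expectD _ t45 t6) (expectD _ t4 t5).
rewrite (expectZ _ _ bvL) (expectZ _ _ bX2) (expectZ _ _ bvqL) (expectZ _ _ bdq) (expectZ _ _ bvdL).
have bg1 : bmeas (fun x : R => truncate e x ^+ 2 - s j) by apply: bmeasB; [exact: bmeasX|exact: bmeas_cst].
have bg2 : bmeas (fun x : R => truncate e x * (truncate e x ^+ 2 - s j)) by exact: bmeasM.
have -> : expect P (fun w => v j w ^+ 2 * L w ^+ 2) = s j * \sum_(k <- r) A j k ^+ 2 * s k.
  rewrite -(lin_second _ ur) (mulE (g := fun x => truncate e x ^+ 2) (h := fun M => lin (A j) r M ^+ 2) jr) => //.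
  - exact: bmeasX.
  - exact: bmeasX.
  - by move=> M N MN; rewrite (lin_dep _ MN).
have -> : expect P (fun w => v j w * (q w * L w)) = 0.
  rewrite (mulE (g := truncate e) (h := fun M => quad A r M * lin (A j) r M) jr) => //.
  - by rewrite -/(v j) Ev mul0r.
  - exact: bmeasM.
  - by move=> M N MN; rewrite (lin_dep _ MN) (quad_dep _ MN).
have -> : expect P (fun w => (v j w ^+ 2 - s j) * q w) = 0.
  rewrite (mulE (g := fun x => truncate e x ^+ 2 - s j) (h := quad A r) jr) => //.
  - by rewrite (expectB P (bmeasX 2 (bv j)) (bmeas_cst _ (s j))) expect_cst subrr mul0r.
  - by move=> M N; exact: quad_dep.
have -> : expect P (fun w => v j w * (v j w ^+ 2 - s j) * L w) = 0.
  rewrite (mulE (g := fun x => truncate e x * (truncate e x ^+ 2 - s j)) (h := lin (A j) r) jr) => //.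
  - rewrite (expect_odd (mW i j) (lawW i j) bg2) ?mul0r// => x.
    by rewrite truncateN sqrrN mulNr.
  - by move=> M N; exact: lin_dep.
rewrite !mulr0 !addr0.
have h1 : \sum_(k <- r) A j k ^+ 2 * s k <= K * e ^+ 2.
  apply: (@le_trans _ _ (\sum_k A j k ^+ 2 * e ^+ 2)); last by rewrite -big_distrl/= ler_wpM2r ?sqr_ge0.
  apply: (@le_trans _ _ (\sum_(k <- r) A j k ^+ 2 * e ^+ 2)).
    by apply: ler_sum => k _; rewrite ler_wpM2l ?sqr_ge0.
  rewrite big_uniq//= [leRHS](bigID [in r])/= lerDl sumr_ge0// => k _.
  by rewrite mulr_ge0 ?sqr_ge0.
have h2 := fourth j; have h3 := IH ur.
have h4 : 4 * (s j * \sum_(k <- r) A j k ^+ 2 * s k) <= 4 * (s j * (K * e ^+ 2)) by rewrite ler_wpM2l// ler_wpM2l.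
have h5 : m ^+ 2 * expect P (fun w => (v j w ^+ 2 - s j) ^+ 2) <= K * (e ^+ 2 * s j).
  by apply: ler_pM => //; [exact: sqr_ge0|apply: expect_ge0 => w; exact: sqr_ge0|exact: AK2].
lra.
Qed.

End QuadraticForm.

(** * The diagonal of the resolvent after truncation *)

Section TruncatedDiagonal.
Context (R : realType) (d : measure_display) (T : measurableType d).
Variables (P : probability T R) (n : nat) (W : T -> 'M[R]_n).
Hypotheses (mW : mx_measurable W) (symW : mx_symmetric W) (indW : upper_independent P W).
Hypothesis lawW : forall i j, symmetric_law P (fun w => W w i j).
Variables (e y : R).
Hypotheses (e0 : 0 <= e) (e1 : e <= 1) (y4 : 4 <= y).

Let y0 : 0 < y. Proof. exact: lt_le_trans y4. Qed.
Let yi : y^-1 <= 4^-1. Proof. by rewrite lef_pV2// posrE. Qed.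
Let yi0 : 0 < y^-1. Proof. by rewrite invr_gt0. Qed.

Definition truncate_mx (M : 'M[R]_n) : 'M[R]_n := map_mx (truncate e) M.

Let V w := truncate_mx (W w).
Let VT w : (V w)^T = V w. Proof. by rewrite /V map_trmx symW. Qed.
Let Vr w : is_resolvent y (V w) (res_re y (V w)) (res_im y (V w)).
Proof. exact: resolvent_exists. Qed.

Let s i j := expect P (fun w => truncate e (W w i j) ^+ 2).

Let s_ge0 i j : 0 <= s i j. Proof. by apply: expect_ge0 => w; exact: sqr_ge0. Qed.

Let s_le i j : s i j <= e ^+ 2.
Proof.
apply: expect_le_cst => [|w]; first by apply: bmeasX; exact: bmeas_truncate.
by rewrite -(real_normK (num_real (truncate _ _))) lerXn2r ?nnegrE// truncate_le.
Qed.

Let bres w : forall i j, `|res_re y (V w) i j| <= y^-1 /\ `|res_im y (V w) i j| <= y^-1.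
Proof. exact: resolvent_entry_le y0 (Vr w). Qed.

Let mV i j : measurable_fun setT (fun w => V w i j).
Proof. by under eq_fun do rewrite mxE; exact: (bmeas_truncate e0 (mW i j)).1. Qed.

Lemma bmeas_res_re i j : bmeas (fun w => res_re y (truncate_mx (W w)) i j).
Proof.
split; first exact: (measurable_res_re y0 mV).
by exists y^-1 => w; have [] := bres w i j.
Qed.

Lemma bmeas_res_im i j : bmeas (fun w => res_im y (truncate_mx (W w)) i j).
Proof.
split; first exact: (measurable_res_im y0 mV).
by exists y^-1 => w; have [] := bres w i j.
Qed.

Let sumb (F : 'I_n -> R) i : \sum_(j <- [seq j <- enum 'I_n | j != i]) F j = \sum_(j | j != i) F j.
Proof. by rewrite big_filter -[index_enum _]enumT. Qed.

Section Row.
Variable i : 'I_n.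

(* Row and column [i] are zeroed rather than deleted; [symm] makes the resolvent
   exist, with the usual bounds, at every [M]. *)
Let minor (M : bmatrix R n) : 'M[R]_n :=
  \matrix_(k, l) if (k == i) || (l == i) then 0 else truncate e (symm (M : 'M[R]_n) k l).

Let minorT M : (minor M)^T = minor M.
Proof.
apply/matrixP => k l; rewrite [LHS]mxE [LHS]mxE [RHS]mxE orbC.
by rewrite (_ : symm M l k = symm M k l)// -{1}(symm_tr M) mxE.
Qed.

Let minor_measurable k l : measurable_fun setT (fun M => minor M k l).
Proof.
rewrite (_ : (fun _ => _) = if (k == i) || (l == i) then fun=> 0 else
    fun M : bmatrix R n => truncate e (symm M k l)); last first.
  by apply/funext => M; rewrite [LHS]mxE; case: ifP.
case: ifP => // _; exact: (measurableT_comp (measurable_truncate e) (measurable_symm k l)).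
Qed.

(** [f (W)] does not see row and column [i], so given the other entries its coefficients are fixed
    and [quadratic_form_variance] applies. Its bound [5 e^2 * y^-2 * 2] is at most [e^2] for
    [y >= 4], and the second moment controls the first. *)
Lemma row_form_deviation (f : bmatrix R n -> 'M[R]_n) :
  (forall j k, bmeas (fun M => f M j k)) ->
  (forall M, (f M)^T = f M) ->
  (forall M j, \sum_k f M j k ^+ 2 <= y^-1 ^+ 2) ->
  (forall M N : 'M[R]_n, (forall k l, k != i -> l != i -> M k l = N k l) -> f M = f N) ->
  \sum_(j | j != i) s i j <= 2 ->
  expect P (fun w => `|row_form i (V w) (f (W w)) - \sum_(j | j != i) s i j * f (W w) j j|) <= e.
Proof.
move=> bf fT fK floc s2.
pose r := [seq j <- enum 'I_n | j != i].
have ur : uniq r by rewrite filter_uniq// enum_uniq.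
pose F (M : bmatrix R n) := \sum_(j <- r) \sum_(k <- r) truncate e ((M : 'M[R]_n) i j) *
   truncate e ((M : 'M[R]_n) i k) * f M j k - \sum_(j <- r) s i j * f M j j.
have bt j : bmeas (fun M : bmatrix R n => truncate e ((M : 'M[R]_n) i j)).
  exact: bmeas_truncate (measurable_entry i j).
have bF : bmeas F.
  apply: bmeasB; apply: bmeas_sum => j _; last by apply: bmeasM => //; exact: bmeas_cst.
  by apply: bmeas_sum => k _; apply: bmeasM => //; exact: bmeasM.
have bFW := bmeas_mx mW bF.
have FE w : row_form i (V w) (f (W w)) - \sum_(j | j != i) s i j * f (W w) j j = F (W w).
  rewrite /F /row_form -!sumb; congr (_ - _); apply: eq_bigr => j _; rewrite -sumb.
  by apply: eq_bigr => k _; rewrite !mxE.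
under eq_expect do rewrite FE.
have E0 : 0 <= expect P (fun w => `|F (W w)|) by exact: expect_ge0.
rewrite -(ler_pXn2r (n := 2))// ?nnegrE//.
apply: le_trans (expect_norm_sqr P bFW) _.
(* After decoupling the coefficients come from the first copy, row and column [i] from the
   second. *)
pose off k l := ~~ ((k == i) || (l == i)).
have offC k l : off k l = off l k by rewrite /off orbC.
rewrite (decoupling mW symW indW offC (bmeasX 2 bF)).
have bound w : expect P (fun w' => F (mix off (W w) (W w')) ^+ 2) <= e ^+ 2.
  have -> : expect P (fun w' => F (mix off (W w) (W w')) ^+ 2) =
    expect P (fun w' => (\sum_(j <- r) \sum_(k <- r) truncate e (W w' i j) * truncate e (W w' i k) * f (W w) j k
     - \sum_(j <- r) expect P (fun w => truncate e (W w i j) ^+ 2) * f (W w) j j) ^+ 2).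
    apply: eq_expect => w'; rewrite /F.
    have -> : f (mix off (W w) (W w')) = f (W w).
      by apply: floc => k l ki li; rewrite mxE /off negb_or ki li.
    congr ((_ - _) ^+ 2); apply: eq_bigr => j _; apply: eq_bigr => k _.
    by rewrite !mxE /off eqxx.
  apply: le_trans (quadratic_form_variance mW symW indW lawW i e0 (fT (W w)) (fK (W w)) ur) _.
  rewrite sumb -/(s i _).
  have y2 : y^-1 ^+ 2 <= 16^-1.
    rewrite (_ : 16^-1 = 4^-1 ^+ 2); last by field.
    by rewrite lerXn2r ?nnegrE ?invr_ge0// ltW.
  have h : \sum_(j < n | j != i) s i j * (e ^+ 2) <= 2 * e ^+ 2 by rewrite -big_distrl/= ler_wpM2r ?sqr_ge0.
  rewrite -big_distrl/= in h.
  have s0 : 0 <= \sum_(j < n | j != i) s i j by apply: sumr_ge0.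
  have q : 0 <= e ^+ 2 * \sum_(j < n | j != i) s i j by rewrite mulr_ge0 ?sqr_ge0.
  rewrite -/(\sum_(j < n | j != i) s i j).
  have := ler_wpM2l q y2; rewrite [X in X <= _ -> _]mulrC; lra.
apply: expect_le_cst => //.
apply: (@bmeas_expect _ _ _ P (fun z => F (mix off (W z.1) (W z.2)) ^+ 2)).
apply: bmeasX; case: bF => mF [M FM]; split; last by exists M => z.
apply: (measurableT_comp mF); apply: measurable_mix; apply: measurable_bmatrix => k l.
  by apply: (measurableT_comp (mW k l)).
by apply: (measurableT_comp (mW k l)).
Qed.

Let minor_bmeas k l : bmeas (fun M => res_re y (minor M) k l) /\ bmeas (fun M => res_im y (minor M) k l).
Proof.
have h M := resolvent_entry_le y0 (resolvent_exists y0 (minorT M)) k l.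
split; split.
- exact: (measurable_res_re y0 minor_measurable).
- by exists y^-1 => M; have [] := h M.
- exact: (measurable_res_im y0 minor_measurable).
- by exists y^-1 => M; have [] := h M.
Qed.

Let minor_rows M j : \sum_k res_re y (minor M) j k ^+ 2 <= y^-1 ^+ 2 /\
  \sum_k res_im y (minor M) j k ^+ 2 <= y^-1 ^+ 2.
Proof.
have h := resolvent_row_sum y0 (resolvent_exists y0 (minorT M)) j.
by split; apply: le_trans h; apply: ler_sum => k _; rewrite ?lerDl ?lerDr sqr_ge0.
Qed.

Let minor_loc (M N : 'M[R]_n) : (forall k l, k != i -> l != i -> M k l = N k l) -> minor M = minor N.
Proof.
move=> MN; apply/matrixP => k l; rewrite !mxE; case: ifPn => //; rewrite negb_or => /andP[ki li].
by rewrite !MN.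
Qed.

Hypothesis s2 : \sum_(j | j != i) s i j <= 2.

(** Expectation of [self_consistent_contraction]: both deviations have mean at most [e], so the
    error is [2 (2 e + e + e) / y]. *)
Lemma mean_contraction (be : R) : 0 <= be -> be <= y^-1 -> y * be + be ^+ 2 = 1 ->
  y * expect P (fun w => `|res_re y (V w) i i| + `|res_im y (V w) i i - be|) <=
  8 * e * y^-1 + `|\sum_(j | j != i) s i j - 1| * y^-1 + y^-1 * \sum_(j | j != i) s i j *
     (2 * expect P (fun w => `|res_re y (V w) j j| + `|res_im y (V w) j j - be|)).
Proof.
move=> be0 bey beE.
pose X j w := `|res_re y (V w) j j| + `|res_im y (V w) j j - be|.
have bX j : bmeas (X j).
  apply: bmeasD; apply: bmeas_norm; first exact: bmeas_res_re.
  by apply: bmeasB; [exact: bmeas_res_im|exact: bmeas_cst].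
pose A' w := res_re y (minor (W w)); pose b' w := res_im y (minor (W w)).
pose DA w := `|row_form i (V w) (A' w) - \sum_(j | j != i) s i j * A' w j j|.
pose Db w := `|row_form i (V w) (b' w) - \sum_(j | j != i) s i j * b' w j j|.
have hA : expect P DA <= e.
  apply: (@row_form_deviation (fun M => res_re y (minor M))) => //.
  - by move=> j k; have [] := minor_bmeas j k.
  - by move=> M; have [_ ? _ _ _] := resolvent_exists y0 (minorT M).
  - by move=> M j; have [] := minor_rows M j.
  - by move=> M N /minor_loc ->.
have hb : expect P Db <= e.
  apply: (@row_form_deviation (fun M => res_im y (minor M))) => //.
  - by move=> j k; have [] := minor_bmeas j k.
  - by move=> M; have [_ _ ? _ _] := resolvent_exists y0 (minorT M).
  - by move=> M j; have [] := minor_rows M j.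
  - by move=> M N /minor_loc ->.
have bV j k : bmeas (fun w => V w j k).
  by split; [exact: mV|exists e => w; rewrite mxE truncate_le].
have bdev (f : bmatrix R n -> 'M[R]_n) : (forall j k, bmeas (fun M => f M j k)) ->
    bmeas (fun w => `|row_form i (V w) (f (W w)) - \sum_(j | j != i) s i j * f (W w) j j|).
  move=> bfm; apply: bmeas_norm; apply: bmeasB; apply: bmeas_sum => j _.
    apply: bmeas_sum => k _; apply: bmeasM; first exact: bmeasM.
    exact: (bmeas_mx mW (bfm j k)).
  by apply: bmeasM; [exact: bmeas_cst|exact: (bmeas_mx mW (bfm j j))].
have bDA : bmeas DA by apply: (bdev (fun M => res_re y (minor M))) => j k; have [] := minor_bmeas j k.
have bDb : bmeas Db by apply: (bdev (fun M => res_im y (minor M))) => j k; have [] := minor_bmeas j k.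
pose c1 := `|\sum_(j | j != i) s i j - 1| * y^-1.
pose Z w := (2 * y^-1) * (2 * e + DA w + Db w) + c1 + y^-1 * \sum_(j | j != i) s i j * (2 * X j w).
have bS : bmeas (fun w => \sum_(j | j != i) s i j * (2 * X j w)).
  by apply: bmeas_sum => j _; apply: bmeasM; [exact: bmeas_cst|apply: bmeasM => //; exact: bmeas_cst].
have b1 : bmeas (fun w => 2 * e + DA w + Db w) by apply: bmeasD => //; apply: bmeasD => //; exact: bmeas_cst.
have b2 : bmeas (fun w => (2 * y^-1) * (2 * e + DA w + Db w)) by apply: bmeasM => //; exact: bmeas_cst.
have b3 : bmeas (fun w => (2 * y^-1) * (2 * e + DA w + Db w) + c1) by apply: bmeasD => //; exact: bmeas_cst.
have b4 : bmeas (fun w => y^-1 * \sum_(j | j != i) s i j * (2 * X j w)) by apply: bmeasM => //; exact: bmeas_cst.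
have pt w : y * X i w <= Z w.
  have ME k l : minor (W w) k l = if (k == i) || (l == i) then 0 else V w k l.
    by rewrite mxE; case: ifP => // _; rewrite (symm_id (symW w)) mxE.
  have Ve : `|V w i i| <= e by rewrite mxE truncate_le.
  have := self_consistent_contraction y0 (Vr w) (resolvent_exists y0 (minorT (W w))) ME Ve
    (s_ge0 i) (s_le i) y4 e1 be0 bey beE.
  rewrite -/(A' w) -/(b' w) -/(DA w) -/(Db w) => /le_trans; apply.
  rewrite /Z -/c1 !lerD//; first by rewrite le_eqVlt; apply/orP; left; apply/eqP; ring.
  rewrite ler_wpM2l ?(ltW yi0)//; apply: ler_sum => j _; rewrite ler_wpM2l// /X mulrDr lerD2l.
  by rewrite ler_peMl// ler1n.
rewrite -expectZ; last exact: bX.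
apply: (le_trans (expect_le P _ _ pt)).
- by apply: bmeasM => //; exact: bmeas_cst.
- exact: bmeasD.
rewrite (expectD P b3 b4) (expectZ P _ bS) (expectD P b2 (bmeas_cst _ c1)) (expectZ P _ b1) expect_cst.
rewrite (expectD P (bmeasD (bmeas_cst _ (2 * e)) bDA) bDb) (expectD P (bmeas_cst _ (2 * e)) bDA) expect_cst.
rewrite expect_sum; last by move=> j _; apply: bmeasM; [exact: bmeas_cst|apply: bmeasM => //; exact: bmeas_cst].
rewrite lerD//; last first.
  rewrite le_eqVlt; apply/orP; left; apply/eqP; congr (_ * _); apply: eq_bigr => j _.
  by rewrite expectZ ?expectZ//; apply: bmeasM => //; exact: bmeas_cst.
by rewrite lerD2r; nra.
Qed.

End Row.

(** A maximum principle: at the row with the greatest mean [k], the feedback is at most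
    [y^-1 * 4 k <= k] while the left side is at least [4 k], so [3 k] is bounded by the errors. *)
Lemma mean_diagonal (be dl : R) : 0 <= be -> be <= y^-1 -> y * be + be ^+ 2 = 1 ->
  (forall i, `|\sum_j s i j - 1| <= dl) -> dl <= 2^-1 -> forall i,
  expect P (fun w => `|res_re y (V w) i i| + `|res_im y (V w) i i - be|) <= e + dl + e ^+ 2.
Proof.
move=> be0 bey beE hs dl2.
pose k i := expect P (fun w => `|res_re y (V w) i i| + `|res_im y (V w) i i - be|).
suff : forall i, k i <= e + dl + e ^+ 2 by [].
move=> i0; have [i _ imax] := @arg_maxP _ _ _ i0 predT k isT.
apply: (le_trans (imax i0 isT)).
have := hs i; rewrite (bigD1 i)//=; set S := \sum_(j | j != i) s i j => /[dup] hS.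
rewrite ler_norml => /andP[S1 S2].
have := s_ge0 i i; have := s_le i i => si1 si0.
have SS : S <= 2 by lra.
have := mean_contraction SS be0 bey beE; rewrite -/(k i) -/S.
have k0 : 0 <= k i by apply: expect_ge0 => w; rewrite addr_ge0.
have : \sum_(j | j != i) s i j * (2 * k j) <= 4 * k i.
  apply: (@le_trans _ _ (\sum_(j | j != i) s i j * (2 * k i))).
    by apply: ler_sum => j _; rewrite ler_wpM2l// ler_wpM2l//; exact: imax.
  by rewrite -big_distrl/= -/S; nra.
set Q := \sum_(j | j != i) _ => hQ.
have hSn : `|S - 1| <= dl + e ^+ 2.
  by rewrite ler_norml; apply/andP; split; lra.
have p1 : 8 * e * y^-1 <= 2 * e by have := ler_wpM2l e0 yi; lra.
have p2 : `|S - 1| * y^-1 <= dl + e ^+ 2.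
  by apply: le_trans hSn; rewrite ler_piMr// (le_trans yi)// invf_le1// ler1n.
have p3 : y^-1 * Q <= k i.
  apply: (@le_trans _ _ (y^-1 * (4 * k i))); first by rewrite ler_wpM2l// ltW.
  by have := ler_wpM2r k0 yi; lra.
have p4 : 4 * k i <= y * k i by rewrite ler_wpM2r.
have := sqr_ge0 e; have : 0 <= dl by apply: le_trans (hs i).
lra.
Qed.

End TruncatedDiagonal.

(** * The semicircle law *)

Section Semicircle.
Context (R : realType).
Let mu := @lebesgue_measure R.
Implicit Types (g : R -> R) (x y : R).

Lemma semicircle_density_ge0 x : 0 <= semicircle_density x.
Proof. by rewrite mulr_ge0 ?sqrtr_ge0// invr_ge0 mulr_ge0// pi_ge0. Qed.

Lemma semicircle_density_out x : 2 < `|x| -> semicircle_density x = 0.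
Proof.
move=> x2; rewrite /semicircle_density max_r ?sqrtr0 ?mulr0//.
rewrite subr_le0 -(real_normK (num_real x)) (_ : 4 = 2 ^+ 2); last by rewrite expr2; lra.
by rewrite lerXn2r ?nnegrE// ltW.
Qed.

Lemma continuous_semicircle_density : continuous (@semicircle_density R).
Proof.
move=> x; apply: cvgM; first exact: cvg_cst.
apply: (@continuous_comp _ _ _ (fun x : R => Num.max (4 - x ^+ 2) 0) Num.sqrt); last exact: sqrt_continuous.
rewrite (_ : (fun x => _) = (fun x : R => (4 - x ^+ 2 + `|4 - x ^+ 2|) / 2)); last first.
  by apply/funext => z /=; rewrite maxr_absE subr0 addr0.
have c4 : {for x, continuous (fun x : R => 4 - x ^+ 2)}.
  by apply: cvgB; [exact: cvg_cst|exact: exprn_continuous].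
apply: cvgM; last exact: cvg_cst.
by apply: cvgD => //; exact: (@cvg_norm _ _ _ _ _ _ _ c4).
Qed.

Let pi2 : - (pi / 2) < pi / 2 :> R.
Proof. by have := pi_gt0 R; lra. Qed.

Let dsin2 (t : R) : is_derive t (1 : R) (fun s : R => 2 * sin s) (2 * cos t).
Proof. by apply: trigger_derive; rewrite /GRing.scale /=; ring. Qed.

Let dsin2E : derive1 (fun s : R => 2 * sin s) = (fun t => 2 * cos t).
Proof. by apply/funext => t; rewrite derive1E; have [_ ->] := dsin2 t. Qed.

Let cos2_cont : continuous (fun t : R => 2 * cos t).
Proof. by move=> t; apply: cvgM; [exact: cvg_cst|exact: continuous_cos]. Qed.

Let cos_sq_cont : continuous (fun t : R => cos t ^+ 2).
Proof.
move=> t; apply: (@continuous_comp _ _ _ cos (fun x : R => x ^+ 2)).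
  exact: continuous_cos.
exact: exprn_continuous.
Qed.

(** The substitution [x = 2 sin t] removes the square root: the density becomes [cos t / pi], and
    [dx = 2 cos t dt]. *)
Lemma semicircle_subst g : continuous g ->
  (\int[mu]_x (g x * semicircle_density x)%:E =
   \int[mu]_(t in `[(- (pi / 2))%R, (pi / 2)%R]) (g (2 * sin t) * (2 / pi * cos t ^+ 2))%:E)%E.
Proof.
move=> cg; have pi0 := pi_gt0 R; have pin : pi != 0 :> R by rewrite gt_eqF.
have -> : (\int[mu]_x (g x * semicircle_density x)%:E =
    \int[mu]_(x in `[(- 2)%R, 2%R]) (g x * semicircle_density x)%:E)%E.
  rewrite [RHS]integral_mkcond; apply: eq_integral => x _; rewrite patchE; case: ifPn => // x2.
  rewrite semicircle_density_out ?mulr0// ltNge; apply: contra x2.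
  by rewrite ler_norml inE/= in_itv/=.
have E1 : 2 * sin (pi / 2) = 2 :> R by rewrite sin_pihalf mulr1.
have E2 : 2 * sin (- (pi / 2)) = - 2 :> R by rewrite sinN sin_pihalf mulrN mulr1.
have cG : continuous (fun x => g x * semicircle_density x).
  by move=> x; apply: cvgM; [exact: cg|exact: continuous_semicircle_density].
rewrite -[X in `[_, X]]E1 -[X in `[X, _]]E2.
rewrite (@integration_by_substitution_increasing _ (fun s => 2 * sin s)).
- apply: eq_integral => t; rewrite inE/= in_itv/= => /andP[t1 t2]; congr EFin.
  rewrite !fctE dsin2E /semicircle_density.
  have ct : 0 <= cos t by rewrite cos_ge0_pihalf// t1.
  rewrite (_ : Num.max _ _ = (2 * cos t) ^+ 2); last first.
    rewrite max_l; last by rewrite exprMn -[sin t ^+ 2](addKr (cos t ^+ 2)) cos2Dsin2;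
      have := sqr_ge0 (cos t); lra.
    by rewrite !exprMn; have := cos2Dsin2 t; lra.
  rewrite sqrtr_sqr ger0_norm; last by rewrite mulr_ge0.
  by move: pin; move: (pi : R) (cos t) (g _) => p C G pn; field.
- exact: ltW.
- by move=> s t s1 t1 st; rewrite ltr_pM2l// ltr_sin.
- by rewrite dsin2E => t _; exact: cos2_cont.
- by rewrite dsin2E; apply/cvg_ex; exists (2 * cos (- (pi / 2))); apply: cvg_at_right_filter; exact: cos2_cont.
- by rewrite dsin2E; apply/cvg_ex; exists (2 * cos (pi / 2)); apply: cvg_at_left_filter; exact: cos2_cont.
- have cs : continuous (fun s : R => 2 * sin s).
    by apply: continuous_derivable1 => t; have [] := dsin2 t.
  split; first by move=> t _; have [] := dsin2 t.
  + by apply: cvg_at_right_filter; exact: cs.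
  + by apply: cvg_at_left_filter; exact: cs.
- exact: continuous_subspaceT.
Qed.

Lemma semicircle_mass : (\int[mu]_x (semicircle_density x)%:E = 1)%E.
Proof.
have pi0 := pi_gt0 R; have pin : pi != 0 :> R by rewrite gt_eqF.
have := @semicircle_subst (fun=> 1) (fun x => cvg_cst _).
under eq_integral do rewrite mul1r; move=> ->.
under eq_integral do rewrite mul1r.
have cf : continuous (fun t : R => 2 / pi * cos t ^+ 2).
  by move=> t; apply: cvgM; [exact: cvg_cst|exact: cos_sq_cont].
have dF (t : R) : is_derive t (1 : R) (fun t : R => (t + sin t * cos t) / pi) (2 / pi * cos t ^+ 2).
  apply: trigger_derive; rewrite /GRing.scale /=.
  have := cos2Dsin2 t => E.
  have -> : sin t * - sin t = cos t ^+ 2 - 1 by rewrite -E; ring.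
  by move: pin; move: (pi : R) (cos t) (sin t) => p C S pn; field.
rewrite (integral_derivative_segment pi2 cf dF).
rewrite sin_pihalf sinN cosN cos_pihalf !mulr0 !addr0; congr EFin.
by move: pin; move: (pi : R) => p pn; field.
Qed.

Let ydom x y : 0 < y -> x ^+ 2 + y ^+ 2 != 0.
Proof. by move=> y0; rewrite gt_eqF// ltr_wpDl ?sqr_ge0// exprn_gt0. Qed.

Let cont_frac (h : R -> R) y : 0 < y -> continuous h -> continuous (fun x => h x / (x ^+ 2 + y ^+ 2)).
Proof.
move=> y0 ch x; apply: cvgM; first exact: ch.
apply: cvgV; first exact: ydom.
by apply: cvgD; [exact: exprn_continuous|exact: cvg_cst].
Qed.

Lemma continuous_frac_odd y : 0 < y -> continuous (fun x => x / (x ^+ 2 + y ^+ 2)).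
Proof. by move=> y0; apply: cont_frac => // x; exact: cvg_id. Qed.

Lemma continuous_frac_even y : 0 < y -> continuous (fun x => y / (x ^+ 2 + y ^+ 2)).
Proof. by move=> y0; apply: cont_frac => // x; exact: cvg_cst. Qed.

(** After the substitution the integrand is odd in [t], so the finite integral equals its own
    negative. *)
Lemma semicircle_odd y : 0 < y ->
  (\int[mu]_x (x / (x ^+ 2 + y ^+ 2) * semicircle_density x)%:E = 0)%E.
Proof.
move=> y0; rewrite (semicircle_subst (continuous_frac_odd y0)).
set G := fun t : R => 2 * sin t / ((2 * sin t) ^+ 2 + y ^+ 2) * (2 / pi * cos t ^+ 2).
have cG : continuous G.
  move=> t; apply: cvgM.
    apply: (@continuous_comp _ _ _ (fun t => 2 * sin t) (fun x => x / (x ^+ 2 + y ^+ 2))).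
      by apply: cvgM; [exact: cvg_cst|exact: continuous_sin].
    exact: continuous_frac_odd.
  by apply: cvgM; [exact: cvg_cst|exact: cos_sq_cont].
have E := @integration_by_substitution_oppr _ G (- (pi / 2)) (pi / 2) (ltW pi2).
rewrite opprK in E.
have {}E := E (continuous_subspaceT cG).
have IG : mu.-integrable `[- (pi / 2), pi / 2] (EFin \o G).
  by apply: continuous_compact_integrable; [exact: segment_compact|exact: continuous_subspaceT].
have E2 : (\int[mu]_(x in `[(- (pi / 2))%R, (pi / 2)%R]) (G x)%:E =
   - \int[mu]_(x in `[(- (pi / 2))%R, (pi / 2)%R]) (G x)%:E)%E.
  rewrite {1}E -integralN; last exact: integrable_add_def.
  apply: eq_integral => t _; change ((G (- t))%:E = (- G t)%:E); congr EFin.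
  by rewrite /G sinN cosN !mulrN sqrrN !mulNr.
have : (\int[mu]_(x in `[(- (pi / 2))%R, (pi / 2)%R]) (G x)%:E)%E \is a fin_num.
  exact: integrable_fin_num IG.
move: E2; rewrite /=; case: (\int[mu]_(x in _) _)%E => // r [rr] _; congr EFin; lra.
Qed.

Let frac_identity (r y v : R) : y != 0 -> 2 ^+ 2 * (1 - v) + y ^+ 2 != 0 ->
  r * (r / y / ((2 ^+ 2 * (1 - v) + y ^+ 2) / y ^+ 2)) =
  y * r ^+ 2 / (2 ^+ 2 * (1 - v) + y ^+ 2).
Proof. by move: (2 ^+ 2 * (1 - v) + y ^+ 2) => Q yn Qn; field; rewrite Qn yn. Qed.

(** The value is the positive root of [y be + be^2 = 1], the fixed point of the resolvent system.
    The primitive comes from [atan (k tan t)] with [k = r / y]. *)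
Lemma semicircle_poisson y : 0 < y ->
  (\int[mu]_x (y / (x ^+ 2 + y ^+ 2) * semicircle_density x)%:E =
   ((Num.sqrt (y ^+ 2 + 4) - y) / 2)%:E)%E.
Proof.
move=> y0; have pi0 := pi_gt0 R; have pin : pi != 0 :> R by rewrite gt_eqF.
rewrite (semicircle_subst (continuous_frac_even y0)).
set r := Num.sqrt (y ^+ 2 + 4).
have r2 : r ^+ 2 = y ^+ 2 + 4 by rewrite sqr_sqrtr// addr_ge0// sqr_ge0.
have r0 : 0 < r by rewrite sqrtr_gt0 ltr_wpDl// sqr_ge0.
have [k kE k0] : exists2 k, k = r / y & 0 < k by exists (r / y); rewrite ?divr_gt0.
have D0 t : 0 < cos t ^+ 2 + k * sin t ^+ 2.
  have E := cos2Dsin2 t; have C := sqr_ge0 (cos t).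
  have [s0|s0] := ltrP 0 (sin t ^+ 2); first by have := mulr_gt0 k0 s0; lra.
  have := mulr_ge0 (ltW k0) (sqr_ge0 (sin t)); lra.
have D0' t : 0 < cos t ^+ 2 + k ^+ 2 * sin t ^+ 2.
  have E := cos2Dsin2 t; have C := sqr_ge0 (cos t).
  have [s0|s0] := ltrP 0 (sin t ^+ 2); first by have := mulr_gt0 (exprn_gt0 2 k0) s0; lra.
  have := mulr_ge0 (sqr_ge0 k) (sqr_ge0 (sin t)); lra.
(* [atan (N / D) = atan (k tan t) - t] by the subtraction formula for the tangent; this form stays
   smooth at the endpoints, where [tan] has poles and [N] vanishes. *)
pose D t := cos t ^+ 2 + k * sin t ^+ 2.
pose N t := (k - 1) * (sin t * cos t).
have dD (t : R) : is_derive t (1 : R) D (2 * (k - 1) * (sin t * cos t)).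
  by apply: trigger_derive; rewrite /GRing.scale /=; ring.
have dN (t : R) : is_derive t (1 : R) N ((k - 1) * (cos t ^+ 2 - sin t ^+ 2)).
  by apply: trigger_derive; rewrite /GRing.scale /=; ring.
have dDV (t : R) : is_derive t (1 : R) (fun s => (D s)^-1) (- (D t) ^- 2 *: (2 * (k - 1) * (sin t * cos t))).
  by apply: is_deriveV => //; rewrite gt_eqF// D0.
have cf : continuous (fun t : R => y / ((2 * sin t) ^+ 2 + y ^+ 2) * (2 / pi * cos t ^+ 2)).
  move=> t; apply: cvgM.
    apply: (@continuous_comp _ _ _ (fun t => 2 * sin t) (fun x => y / (x ^+ 2 + y ^+ 2))).
      by apply: cvgM; [exact: cvg_cst|exact: continuous_sin].
    exact: continuous_frac_even.
  by apply: cvgM; [exact: cvg_cst|exact: cos_sq_cont].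
have dF (t : R) : is_derive t (1 : R) (fun t => (r * (t + atan (N t * (D t)^-1)) - y * t) / (2 * pi))
  (y / ((2 * sin t) ^+ 2 + y ^+ 2) * (2 / pi * cos t ^+ 2)).
  have D0t := D0 t; have Et := cos2Dsin2 t.
  have Qt := D0' t.
  have dND : is_derive t (1 : R) (fun s => N s * (D s)^-1)
      ((k - 1) * (D t * (cos t ^+ 2 - sin t ^+ 2) - 2 * (k - 1) * (sin t * cos t) ^+ 2) / D t ^+ 2).
    have := dN t => ?; have := dDV t => ?.
    apply: trigger_derive; rewrite /GRing.scale /=.
    by rewrite /N; field; rewrite gt_eqF.
  have dA : is_derive t (1 : R) (fun s => atan (N s * (D s)^-1)) (k / (cos t ^+ 2 + k ^+ 2 * sin t ^+ 2) - 1).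
    apply: trigger_derive; rewrite -/(D t) /N.
    have uE : sin t ^+ 2 = 1 - cos t ^+ 2 by rewrite -Et; ring.
    move: D0t Qt; rewrite /D !exprMn uE; move: (cos t ^+ 2) => v D0t Qt.
    have QE : (v + k * (1 - v)) ^+ 2 + (k - 1) ^+ 2 * ((1 - v) * v) = v + k ^+ 2 * (1 - v) by ring.
    have -> : 1 + (k - 1) ^+ 2 * ((1 - v) * v) * (v + k * (1 - v))^-1 ^+ 2 =
        (v + k ^+ 2 * (1 - v)) / (v + k * (1 - v)) ^+ 2.
      by rewrite -QE; field; rewrite gt_eqF.
    by field; rewrite !gt_eqF.
  apply: trigger_derive; rewrite /GRing.scale /=.
  have uE : sin t ^+ 2 = 1 - cos t ^+ 2 by rewrite -Et; ring.
  move: Qt; rewrite !exprMn uE; move: (cos t ^+ 2) => v Qt.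
  have yQ : 0 < 2 ^+ 2 * (1 - v) + y ^+ 2.
    have := mulr_gt0 (exprn_gt0 2 y0) Qt.
    rewrite kE expr_div_n r2 mulrDr mulrA [y ^+ 2 * (_ / _)]mulrC divfK; first lra.
    by rewrite gt_eqF// exprn_gt0.
  have kQ : r * (k / (v + k ^+ 2 * (1 - v))) = y * (y ^+ 2 + 4) / (2 ^+ 2 * (1 - v) + y ^+ 2).
    have -> : v + k ^+ 2 * (1 - v) = (2 ^+ 2 * (1 - v) + y ^+ 2) / y ^+ 2.
      by rewrite kE expr_div_n r2; field; rewrite gt_eqF.
    have yn : y != 0 by rewrite gt_eqF.
    have Qn := lt0r_neq0 yQ.
    by rewrite kE -r2; exact: frac_identity.
  rewrite mulr0 add0r mulr1 addrCA subrr addr0 kQ.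
  by move: pin yQ; move: (pi : R) => p pn yQ; field; rewrite pn gt_eqF//; lra.
rewrite (integral_derivative_segment pi2 cf dF).
rewrite /N sin_pihalf sinN cosN cos_pihalf sin_pihalf !mulr0 !mul0r atan0 !addr0.
by congr EFin; move: pin; move: (pi : R) => p pn; field.
Qed.

End Semicircle.

(** * From resolvents to weak convergence *)

Section Bernstein.
Context (R : realType).
Implicit Types (h : nat -> R) (u : R).

(* The mean of [h] under the binomial law with parameters [n] and [u]. *)
Fixpoint binomial_mean n h u : R :=
  if n is m.+1 then u * binomial_mean m (fun k => h k.+1) u + (1 - u) * binomial_mean m h u
  else h 0%N.

Lemma binomial_mean_poly n h : exists p : {poly R}, forall u, binomial_mean n h u = p.[u].
Proof.
elim: n h => [|n IH] h; first by exists (h 0%N)%:P => u; rewrite hornerC.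
have [p hp] := IH (fun k => h k.+1); have [q hq] := IH h.
by exists ('X * p + (1 - 'X) * q) => u; rewrite /= hp hq !hornerE.
Qed.

Lemma binomial_mean_le n h1 h2 u : 0 <= u <= 1 -> (forall k, (k <= n)%N -> h1 k <= h2 k) ->
  binomial_mean n h1 u <= binomial_mean n h2 u.
Proof.
move=> /andP[u0 u1]; elim: n h1 h2 => [|n IH] h1 h2 h12 /=; first exact: h12.
rewrite lerD// ler_wpM2l ?subr_ge0//; apply: IH => k kn; apply: h12 => //.
exact: leqW.
Qed.

Lemma binomial_mean_linear n (a b : R) h1 h2 u :
  binomial_mean n (fun k => a * h1 k + b * h2 k) u = a * binomial_mean n h1 u + b * binomial_mean n h2 u.
Proof. by elim: n h1 h2 => [|n IH] h1 h2 //=; rewrite !IH; ring. Qed.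

Lemma binomial_mean_cst n (c : R) u : binomial_mean n (fun=> c) u = c.
Proof. by elim: n => [|n IH] //=; rewrite IH; ring. Qed.

Lemma binomial_mean_sqr n (c : R) u :
  binomial_mean n (fun k => (k%:R - c) ^+ 2) u = n%:R * u * (1 - u) + (n%:R * u - c) ^+ 2.
Proof.
elim: n c => [|n IH] c /=; first by ring.
rewrite IH (_ : (fun k => _) = fun k : nat => (k%:R - (c - 1)) ^+ 2); last first.
  by apply/funext => k; rewrite -natr1; congr (_ ^+ 2); ring.
by rewrite IH -natr1; ring.
Qed.

Lemma uniform_continuity (f : R -> R) (e : R) : continuous f -> 0 < e ->
  exists2 r : R, 0 < r & forall x z, 0 <= x <= 1 -> `|z - x| <= r -> `|f z - f x| <= e.
Proof.
move=> cf e0.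
pose Q (k : nat) x := forall z, `|z - x| <= k.+1%:R^-1 -> `|f z - f x| <= e.
have /compact_near_coveringP/(_ nat \oo Q) h := @segment_compact R 0 1.
have {}h : \forall k \near \oo, `[0, 1]%classic `<=` Q k.
  apply: h => x _ /=.
  have /cvgrPdist_le/(_ (e / 2)) := cf x; rewrite divr_gt0// => /(_ isT).
  case/nbhs_ballP => r /= r0 hr.
  have r2 : 0 < r / 2 by rewrite divr_gt0.
  exists (ball x (r / 2), [set k | k.+1%:R^-1 < r / 2]) => /=.
    split; first exact: nbhsx_ballx.
    by have := near_infty_natSinv_lt (PosNum r2); apply: filterS => k /=.
  move=> [x' k] /= [xx' kr] z zx'.
  have h1 : `|f x - f z| <= e / 2.
    apply: hr; rewrite /ball/= -(subrKA x') (le_lt_trans (ler_normD _ _))//.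
    rewrite (splitr r) ltrD// distrC; exact: le_lt_trans zx' kr.
  have h2 : `|f x - f x'| <= e / 2.
    by apply: hr; rewrite /ball/= (lt_le_trans xx')// ler_pdivrMr// ler_peMr ?(ltW r0)// ler1n.
  by rewrite -(subrKA (f x)) (le_trans (ler_normD _ _))// (splitr e) lerD// distrC.
case: h => k _ /(_ k (leqnn k)) hk; exists k.+1%:R^-1; first by rewrite invr_gt0.
by move=> x z x01 zx; apply: hk => //=; rewrite in_itv.
Qed.

(** Bernstein's proof: the binomial mean of the samples [f (k / n)] is a polynomial in [u], and [|f
    (k / n) - f u| <= e / 2 + c (k - n u)^2], whose quadratic part has mean [c n u (1 - u)]. *)
Theorem weierstrass (f : R -> R) (e : R) : continuous f -> (exists M, forall x, `|f x| <= M) -> 0 < e ->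
  exists p : {poly R}, forall u, 0 <= u <= 1 -> `|p.[u] - f u| <= e.
Proof.
move=> cf [M fM] e0.
have e2 : 0 < e / 2 by rewrite divr_gt0.
have [r r0 hr] := uniform_continuity cf e2.
have M0 : 0 <= M by apply: le_trans (fM 0).
(* Makes the variance term, at most [c n = 2 M / (r^2 n)], no larger than [e / 2]. *)
pose n := (Num.truncn (4 * M / (r ^+ 2 * e))).+1.
have r2 : 0 < r ^+ 2 by rewrite exprn_gt0.
have n0 : 0 < n%:R :> R by rewrite ltr0n.
have nE : 4 * M <= n%:R * (r ^+ 2 * e).
  by rewrite -ler_pdivrMr ?mulr_gt0// ltW// truncnS_gt.
pose h (k : nat) := f (k%:R / n%:R).
have [p hp] := binomial_mean_poly n h.
exists p => u u01; rewrite -hp; pose c := 2 * M / (r ^+ 2 * n%:R ^+ 2).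
have c0 : 0 <= c.
  by apply: divr_ge0; apply: mulr_ge0 => //; exact: sqr_ge0.
have bnd (k : nat) : `|h k - f u| <= e / 2 + c * (k%:R - n%:R * u) ^+ 2.
  have q0 : 0 <= c * (k%:R - n%:R * u) ^+ 2 by rewrite mulr_ge0 ?sqr_ge0.
  have [ku|ku] := leP `|k%:R / n%:R - u| r.
    by apply: le_trans (hr _ _ u01 ku) _; rewrite lerDl.
  apply: (@le_trans _ _ (2 * M)).
    by have := fM (k%:R / n%:R); rewrite -/(h k); have := fM u; have := ler_normB (h k) (f u); lra.
  apply: (@le_trans _ _ (c * (k%:R - n%:R * u) ^+ 2)); last by rewrite lerDr ltW.
  have -> : k%:R - n%:R * u = n%:R * (k%:R / n%:R - u) by rewrite mulrBr mulrCA divff ?mulr1// gt_eqF.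
  rewrite exprMn mulrA /c (_ : _ / _ * _ = 2 * M / r ^+ 2); last by field; rewrite !gt_eqF.
  rewrite mulrAC ler_pdivlMr// ler_wpM2l ?mulr_ge0//.
  by rewrite -[leRHS]real_normK ?num_real// lerXn2r ?nnegrE ?(ltW r0)// ltW.
have tot : e / 2 + c * (n%:R * u * (1 - u)) <= e.
  suff : c * (n%:R * u * (1 - u)) <= e / 2 by lra.
  have /andP[u0 u1] := u01.
  have uu : u * (1 - u) <= 1 by nra.
  apply: (@le_trans _ _ (c * n%:R)).
    by rewrite ler_wpM2l// -mulrA ler_piMr// ltW.
  rewrite /c (_ : _ * n%:R = 2 * M / (r ^+ 2 * n%:R)); last by field; rewrite !gt_eqF.
  by rewrite ler_pdivrMr ?mulr_gt0//; move: nE; lra.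
have diff : binomial_mean n h u - f u = binomial_mean n (fun k => 1 * h k + (- 1) * f u) u.
  by rewrite binomial_mean_linear binomial_mean_cst; ring.
have up : binomial_mean n (fun k => (e / 2) * 1 + c * (k%:R - n%:R * u) ^+ 2) u <= e.
  by rewrite binomial_mean_linear binomial_mean_cst binomial_mean_sqr subrr expr0n addr0 mulr1.
have lo : binomial_mean n (fun k => (- (e / 2)) * 1 + (- c) * (k%:R - n%:R * u) ^+ 2) u >= - e.
  by rewrite binomial_mean_linear binomial_mean_cst binomial_mean_sqr subrr expr0n addr0 mulr1 mulNr -opprD lerN2.
rewrite diff ler_norml; apply/andP; split.
  apply: le_trans lo _; apply: binomial_mean_le => // k _.
  by have := bnd k; rewrite ler_norml => /andP[+ _]; lra.
apply: le_trans up; apply: binomial_mean_le => // k _.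
by have := bnd k; rewrite ler_norml => /andP[_]; lra.
Qed.

End Bernstein.

(** * Positive normalized functionals on bounded continuous functions *)

Section BoundedContinuous.
Context (R : realType).
Implicit Types f g : R -> R.

Lemma bounded_continuous_cst (c : R) : bounded_continuous (fun=> c).
Proof. by split; [exact: cst_continuous|exists `|c|]. Qed.

Lemma bounded_continuousD f g : bounded_continuous f -> bounded_continuous g ->
  bounded_continuous (fun x => f x + g x).
Proof.
move=> [cf [M fM]] [cg [N gN]]; split; first by move=> x; apply: cvgD; [exact: cf|exact: cg].
by exists (M + N) => x; rewrite (le_trans (ler_normD _ _))// lerD.
Qed.

Lemma bounded_continuousM f g : bounded_continuous f -> bounded_continuous g ->
  bounded_continuous (fun x => f x * g x).
Proof.
move=> [cf [M fM]] [cg [N gN]]; split; first by move=> x; apply: cvgM; [exact: cf|exact: cg].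
by exists (M * N) => x; rewrite normrM ler_pM.
Qed.

Lemma bounded_continuousN f : bounded_continuous f -> bounded_continuous (fun x => - f x).
Proof.
by move=> [cf [M fM]]; split; [move=> x; apply: cvgN; exact: cf|exists M => x; rewrite normrN].
Qed.

Lemma bounded_continuousB f g : bounded_continuous f -> bounded_continuous g ->
  bounded_continuous (fun x => f x - g x).
Proof. by move=> bf bg; apply: bounded_continuousD => //; exact: bounded_continuousN. Qed.

Lemma bounded_continuousX f n : bounded_continuous f -> bounded_continuous (fun x => f x ^+ n).
Proof.
move=> bf; elim: n => [|n IH]; first exact: bounded_continuous_cst.
by under eq_fun do rewrite exprS; exact: bounded_continuousM.
Qed.

Lemma bounded_continuous_opp f : bounded_continuous f -> bounded_continuous (fun x => f (- x)).
Proof.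
move=> [cf [M fM]]; split; last by exists M => x.
by move=> x; apply: (@continuous_comp _ _ _ (fun x : R => - x) f); [exact: opp_continuous|exact: cf].
Qed.

(** Common ground of the spectral distribution, given by a finite sum, and the semicircle law, given
    by a density. *)
Definition averaging (L : (R -> R) -> R) := [/\
  forall f g (a : R), bounded_continuous f -> bounded_continuous g ->
    L (fun x => a * f x + g x) = a * L f + L g,
  forall f, bounded_continuous f -> (forall x, 0 <= f x) -> 0 <= L f &
  L (fun=> 1) = 1].

Section Averaging.
Variable L : (R -> R) -> R.
Hypothesis aL : averaging L.

Lemma averaging0 : L (fun=> 0) = 0.
Proof.
have [lin _ _] := aL; have := lin _ _ (-1) (bounded_continuous_cst 0) (bounded_continuous_cst 0).
by rewrite (_ : (fun x => _) = fun=> 0 :> R); [lra|apply/funext => x; rewrite mulr0 addr0].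
Qed.

Lemma averagingD f g : bounded_continuous f -> bounded_continuous g ->
  L (fun x => f x + g x) = L f + L g.
Proof.
move=> bf bg; have [lin _ _] := aL; rewrite -[L f]mul1r -lin//.
by congr L; apply/funext => x; rewrite mul1r.
Qed.

Lemma averagingZ (a : R) f : bounded_continuous f -> L (fun x => a * f x) = a * L f.
Proof.
move=> bf; have [lin _ _] := aL; rewrite -[RHS]addr0 -averaging0 -lin//; last exact: bounded_continuous_cst.
by congr L; apply/funext => x; rewrite addr0.
Qed.

Lemma averagingB f g : bounded_continuous f -> bounded_continuous g ->
  L (fun x => f x - g x) = L f - L g.
Proof.
move=> bf bg; rewrite averagingD//; last exact: bounded_continuousN.
rewrite -[- L g]mulN1r -averagingZ//; congr (_ + L _); apply/funext => x; by rewrite mulN1r.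
Qed.

Lemma averaging_cst (c : R) : L (fun=> c) = c.
Proof.
have [_ _ L1] := aL; rewrite -[RHS]mulr1 -L1 -averagingZ; last exact: bounded_continuous_cst.
by congr L; apply/funext => x; rewrite mulr1.
Qed.

Lemma averaging_le f g : bounded_continuous f -> bounded_continuous g -> (forall x, f x <= g x) -> L f <= L g.
Proof.
move=> bf bg fg; have [_ pos _] := aL.
rewrite -subr_ge0 -averagingB//; apply: pos; first exact: bounded_continuousB.
by move=> x; rewrite subr_ge0.
Qed.

Lemma averaging_norm_le f g : bounded_continuous f -> bounded_continuous g ->
  (forall x, `|f x| <= g x) -> `|L f| <= L g.
Proof.
move=> bf bg fg; rewrite ler_norml; apply/andP; split.
  rewrite lerNl -[- L f]mulN1r -averagingZ//; apply: averaging_le => //.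
    by apply: bounded_continuousM => //; exact: bounded_continuous_cst.
  by move=> x; rewrite mulN1r; have := fg x; rewrite ler_norml => /andP[+ _]; rewrite lerNl.
by apply: averaging_le => // x; rewrite (le_trans (ler_norm _))//.
Qed.

Lemma averaging_dist f g (e : R) : bounded_continuous f -> bounded_continuous g ->
  (forall x, `|f x - g x| <= e) -> `|L f - L g| <= e.
Proof.
move=> bf bg fg; rewrite -averagingB// -[leRHS]averaging_cst; apply: averaging_norm_le => //.
  exact: bounded_continuousB.
exact: bounded_continuous_cst.
Qed.

End Averaging.

(** * From resolvent functions to all test functions *)

Section WeakConvergence.
Variables (L_ : nat -> (R -> R) -> R) (L : (R -> R) -> R).
Hypotheses (aL_ : forall n, averaging (L_ n)) (aL : averaging L).

Definition converges f := bounded_continuous f /\ (fun n => L_ n f) @ \oo --> L f.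

Lemma converges_cst (c : R) : converges (fun=> c).
Proof.
split; first exact: bounded_continuous_cst.
rewrite averaging_cst//; under eq_fun do rewrite averaging_cst//; exact: cvg_cst.
Qed.

Lemma convergesD f g : converges f -> converges g -> converges (fun x => f x + g x).
Proof.
move=> [bf cf] [bg cg]; split; first exact: bounded_continuousD.
by rewrite averagingD//; under eq_fun do rewrite averagingD//; exact: cvgD.
Qed.

Lemma convergesZ (a : R) f : converges f -> converges (fun x => a * f x).
Proof.
move=> [bf cf]; split; first by apply: bounded_continuousM => //; exact: bounded_continuous_cst.
by rewrite averagingZ//; under eq_fun do rewrite averagingZ//; apply: cvgM => //; exact: cvg_cst.
Qed.

Lemma converges_sum (I : Type) (r : seq I) (F : I -> R -> R) :
  (forall i, converges (F i)) -> converges (fun x => \sum_(i <- r) F i x).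
Proof.
move=> cF; elim: r => [|i r IH].
  by under eq_fun do rewrite big_nil; exact: converges_cst.
by under eq_fun do rewrite big_cons; exact: convergesD.
Qed.

(** Positivity and total mass one make every functional a contraction for the uniform distance, so
    [e / 3] can be spent three times. *)
Lemma converges_uniform f : bounded_continuous f ->
  (forall e, 0 < e -> exists2 g, converges g & forall x, `|f x - g x| <= e) -> converges f.
Proof.
move=> bf h; split => //; apply/cvgrPdist_le => e e0.
have e3 : 0 < e / 3 by rewrite divr_gt0.
have [g [bg /cvgrPdist_le/(_ _ e3) cg] fg] := h _ e3.
have h1 := averaging_dist aL bf bg fg.
apply: filterS cg => n hn; have h2 := averaging_dist (aL_ n) bf bg fg.
rewrite (_ : L f - L_ n f = (L f - L g) + (L g - L_ n g) - (L_ n f - L_ n g)); last by ring.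
rewrite (le_trans (ler_normB _ _))// (_ : e = e / 3 + e / 3 + e / 3); last by field.
by rewrite lerD// (le_trans (ler_normD _ _))// lerD.
Qed.

(* [16 + 1 / m] and its limit [16] *)
Let pole (t : R) := t = 0 \/ exists m : nat, t = m.+1%:R^-1.
Hypothesis Hodd : forall t, pole t -> (fun n => L_ n (fun x => x / (x ^+ 2 + (16 + t)))) @ \oo -->
  L (fun x => x / (x ^+ 2 + (16 + t))).
Hypothesis Heven : forall t, pole t -> (fun n => L_ n (fun x => (x ^+ 2 + (16 + t))^-1)) @ \oo -->
  L (fun x => (x ^+ 2 + (16 + t))^-1).

Let pole_ge0 t : pole t -> 0 <= t.
Proof. by case=> [->|[m ->]]. Qed.

Let den_gt0 t (x : R) : 0 <= t -> 0 < x ^+ 2 + (16 + t).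
Proof. by move=> t0; have := sqr_ge0 x; lra. Qed.

Let bc_even t : 0 <= t -> bounded_continuous (fun x : R => (x ^+ 2 + (16 + t))^-1).
Proof.
move=> t0; split; last first.
  exists 1 => x; have h := den_gt0 x t0; rewrite ger0_norm ?invr_ge0 ?(ltW h)//.
  by rewrite invf_le1//; have := sqr_ge0 x; lra.
move=> x; apply: (@continuousV R R (fun x : R => x ^+ 2 + (16 + t)) x); first by rewrite gt_eqF// den_gt0.
by apply: continuousD; [exact: exprn_continuous|exact: cst_continuous].
Qed.

Let odd_le t (x : R) : 0 <= t -> `|x / (x ^+ 2 + (16 + t))| <= 1.
Proof.
move=> t0; have h := den_gt0 x t0; rewrite normrM normfV (gtr0_norm h) ler_pdivrMr// mul1r.
by rewrite -(real_normK (num_real x)); have := sqr_ge0 (`|x| - 1); have := sqr_ge0 `|x|; lra.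
Qed.

Let bc_odd t : 0 <= t -> bounded_continuous (fun x : R => x / (x ^+ 2 + (16 + t))).
Proof.
move=> t0; split; last by exists 1 => x; exact: odd_le.
move=> x; apply: (@continuousM R R id (fun x => (x ^+ 2 + (16 + t))^-1) x); first exact: cvg_id.
exact: (bc_even t0).1.
Qed.

Let u (x : R) := (x ^+ 2 + 16)^-1.

Let uE x : u x = (x ^+ 2 + (16 + 0))^-1. Proof. by rewrite addr0. Qed.

Let bu : bounded_continuous u.
Proof. by have := bc_even (lexx 0); under eq_fun do rewrite -uE. Qed.

Let u01 x : 0 < u x <= 16^-1.
Proof.
have h := sqr_ge0 x; apply/andP; split; first by rewrite invr_gt0; lra.
by rewrite lef_pV2 ?posrE; lra.
Qed.

(* [1 / (a (a + t)) = (1 / a - 1 / (a + t)) / t], and [t -> 0] *)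
Let powers (w : R -> R) : (forall x, `|w x * u x| <= 1) -> (forall t, pole t -> converges (fun x => w x / (x ^+ 2 + (16 + t)))) ->
  forall k t, pole t -> converges (fun x => w x / (x ^+ 2 + (16 + t)) * u x ^+ k).
Proof.
move=> wu w0; elim=> [|k IH] t pt.
  by under eq_fun do rewrite expr0 mulr1; exact: w0.
have p0 : pole 0 by left.
have pos s : 0 < s -> pole s -> converges (fun x => w x / (x ^+ 2 + (16 + s)) * u x ^+ k.+1).
  move=> s0 ps; rewrite (_ : (fun x => _) = fun x => s^-1 * (w x / (x ^+ 2 + (16 + 0)) * u x ^+ k +
     (-1) * (w x / (x ^+ 2 + (16 + s)) * u x ^+ k))).
    by apply: convergesZ; apply: convergesD; [exact: IH|apply: convergesZ; exact: IH].
  apply/funext => x; rewrite -uE [u x ^+ k.+1]exprS.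
  have a0 : x ^+ 2 + 16 != 0 by have := @den_gt0 0 x (lexx _); rewrite addr0 => /gt_eqF ->.
  have b0 : x ^+ 2 + (16 + s) != 0 by rewrite gt_eqF// den_gt0// ltW.
  move: (u x ^+ k) => z; rewrite /u; field.
  by rewrite a0 b0 gt_eqF.
case: pt => [->|[m tE]]; last by apply: pos; [rewrite tE invr_gt0|right; exists m].
have E (s x : R) : 0 <= s -> w x / (x ^+ 2 + (16 + 0)) * u x ^+ k.+1 - w x / (x ^+ 2 + (16 + s)) * u x ^+ k.+1
    = s * ((w x * u x) * ((x ^+ 2 + (16 + s))^-1 * u x ^+ k.+1)).
  move=> s0; have a0 : x ^+ 2 + 16 != 0 by have := @den_gt0 0 x (lexx _); rewrite addr0 => /gt_eqF ->.
  have b0 : x ^+ 2 + (16 + s) != 0 by rewrite gt_eqF// den_gt0.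
  rewrite -uE; move: (u x ^+ k.+1) => z; rewrite /u; field.
  by rewrite a0 b0.
have u1 x : 0 <= u x <= 1.
  have /andP[a b] := u01 x; rewrite ltW//= (le_trans b)// invf_le1//; lra.
have small s x : 0 <= s -> `|w x / (x ^+ 2 + (16 + 0)) * u x ^+ k.+1 - w x / (x ^+ 2 + (16 + s)) * u x ^+ k.+1| <= s.
  move=> s0; rewrite E// normrM (ger0_norm s0) ler_piMr// normrM mulr_ile1//.
  have h := den_gt0 x s0; have /andP[a b] := u1 x.
  have d0 : 0 <= (x ^+ 2 + (16 + s))^-1 by rewrite invr_ge0 ltW.
  have d1 : (x ^+ 2 + (16 + s))^-1 <= 1 by rewrite invf_le1//; have := sqr_ge0 x; lra.
  have k0 : 0 <= u x ^+ k.+1 by rewrite exprn_ge0.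
  by rewrite ger0_norm ?mulr_ge0// mulr_ile1// exprn_ile1.
have [bw _] := w0 0 p0.
apply: converges_uniform.
  by apply: bounded_continuousM => //; exact: bounded_continuousX.
move=> e e0; have [m hm] : exists m : nat, m.+1%:R^-1 <= e.
  exists (Num.truncn e^-1); rewrite invf_ple ?posrE// ltW//; exact: truncnS_gt.
exists (fun x => w x / (x ^+ 2 + (16 + m.+1%:R^-1)) * u x ^+ k.+1).
  by apply: pos; [rewrite invr_gt0|right; exists m].
by move=> x; apply: le_trans hm; apply: small; rewrite invr_ge0.
Qed.

Let even_poly (p : {poly R}) : converges (fun x => p.[u x]).
Proof.
under eq_fun do rewrite horner_coef; apply: converges_sum => i; apply: convergesZ.
case: (val i) => [|k]; first by under eq_fun do rewrite expr0; exact: converges_cst.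
have := @powers (fun=> 1) _ _ k 0 (or_introl erefl).
rewrite (_ : (fun x => 1 / _ * _) = fun x => u x ^+ k.+1); last first.
  by apply/funext => x; rewrite -uE mul1r -exprS.
apply => [x|t pt].
  by have /andP[a b] := u01 x; rewrite mul1r gtr0_norm// (le_trans b)// invf_le1//; lra.
under eq_fun do rewrite mul1r; split; last exact: Heven.
by apply: bc_even; exact: pole_ge0.
Qed.

Let odd_poly (p : {poly R}) : converges (fun x => x * u x * p.[u x]).
Proof.
under eq_fun do rewrite horner_coef mulr_sumr.
apply: converges_sum => i; under eq_fun do rewrite mulrCA; apply: convergesZ.
have := @powers id _ _ i 0 (or_introl erefl).
rewrite (_ : (fun x => id x / _ * _) = fun x => x * u x * u x ^+ i); last first.
  by apply/funext => x; rewrite -uE.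
apply => [x|t pt]; first by have := @odd_le 0 x (lexx _); rewrite addr0.
by split; [apply: bc_odd; exact: pole_ge0|exact: Hodd].
Qed.

(** [|x|] is recovered from [u x] as [sqrt (1 / u - 16)], so [g |x|] is a continuous function of
    [u x], to which the polynomial approximation on [[0, 1]] applies. *)
Let approx (g : R -> R) (e : R) : continuous g -> (exists M, forall x, `|g x| <= M) ->
  (forall z, 3 <= `|z| -> g z = 0) -> 0 < e ->
  exists p : {poly R}, forall x, `|g `|x| - p.[u x]| <= e.
Proof.
move=> cg [M gM] g0 e0.
(* The cut at [26^-1] avoids the pole at [v = 0]; below it [x^2 > 10 > 3^2], where [g] vanishes. *)
pose z (v : R) := Num.sqrt ((Num.max v 26^-1)^-1 - 16).
have cz : continuous z.
  move=> v; apply: (@continuous_comp _ _ _ (fun v : R => (Num.max v 26^-1)^-1 - 16) Num.sqrt); last first.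
    exact: sqrt_continuous.
  apply: continuousB; last exact: cst_continuous.
  apply: continuousV.
    by rewrite gt_eqF// lt_max invr_gt0 ltr0n orbT.
  by apply: (@continuous_max R R id (fun=> 26^-1) v); [exact: cvg_id|exact: cst_continuous].
have cgz : continuous (g \o z) by move=> v; apply: continuous_comp; [exact: cz|exact: cg].
have [p hp] := weierstrass cgz (ex_intro _ M (fun v => gM (z v))) e0.
exists p => x; have /andP[a b] := u01 x.
have <- : g (z (u x)) = g `|x|.
  rewrite /z; have [h|h] := lerP (26^-1) (u x).
    by rewrite invrK addrK sqrtr_sqr.
  rewrite invrK g0; last first.
    rewrite (_ : 26 - 16 = 10 :> R); last by ring.
    rewrite ger0_norm ?sqrtr_ge0// -(ler_pXn2r (n := 2))// ?nnegrE ?sqrtr_ge0//.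
    by rewrite sqr_sqrtr//; lra.
  rewrite g0// normr_id; move: h; rewrite /u ltf_pV2 ?posrE//; last by have := sqr_ge0 x; lra.
  rewrite -(real_normK (num_real x)) => h; rewrite -(ler_pXn2r (n := 2))// ?nnegrE//; lra.
rewrite distrC; apply: hp; rewrite ltW//= (le_trans b)// invf_le1//; lra.
Qed.

Let even_part g : bounded_continuous g -> (forall x, g (- x) = g x) ->
  (forall x, 3 <= `|x| -> g x = 0) -> converges g.
Proof.
move=> bg ge g0; apply: converges_uniform => // e e0.
have [p hp] := approx bg.1 bg.2 g0 e0.
exists (fun x => p.[u x]) => // x; have := hp x; suff -> : g `|x| = g x by [].
by case: (lerP 0 x) => [/ger0_norm ->//|/ltr0_norm ->].
Qed.

(** An odd [g] is [x u (x) h (|x|)] with [h (z) = g (z) (z^2 + 16) / z]. Replacing the denominator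
    by [max (|z|, r)] removes the singularity at [0]; it alters the product only where [|x| <= r],
    and there [|g| <= e / 2]. *)
Let odd_part g : bounded_continuous g -> (forall x, g (- x) = - g x) ->
  (forall x, 3 <= `|x| -> g x = 0) -> converges g.
Proof.
move=> bg go g0; apply: converges_uniform => // e e0.
have g00 : g 0 = 0 by have := go 0; rewrite oppr0; lra.
have e2 : 0 < e / 2 by rewrite divr_gt0.
have [r r0 hr] : exists2 r : R, 0 < r & forall x, `|x| <= r -> `|g x| <= e / 2.
  have /cvgrPdist_le/(_ _ e2) := bg.1 0; case/nbhs_ballP => r /= r0 hr.
  exists (r / 2); first by rewrite divr_gt0.
  move=> x xr; have := hr x; rewrite /ball/= g00 !sub0r !normrN; apply.
  by rewrite (le_lt_trans xr)// ltr_pdivrMr// ltr_pMr// ltr1n.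
pose h z := g z * (z ^+ 2 + 16) / Num.max `|z| r.
have mr (z : R) : 0 < Num.max `|z| r by rewrite lt_max r0 orbT.
have ch : continuous h.
  move=> z; apply: (@continuousM R R (fun z => g z * (z ^+ 2 + 16)) (fun z => (Num.max `|z| r)^-1) z).
    apply: (@continuousM R R g (fun z => z ^+ 2 + 16) z); first exact: bg.1.
    by apply: continuousD; [exact: exprn_continuous|exact: cst_continuous].
  apply: continuousV; first by rewrite gt_eqF.
  by apply: (@continuous_max R R (fun z => `|z|) (fun=> r) z); [exact: norm_continuous|exact: cst_continuous].
have h0 z : 3 <= `|z| -> h z = 0 by move=> z3; rewrite /h g0// !mul0r.
have hb : exists M, forall x, `|h x| <= M.
  have [M gM] := bg.2; exists (M * 25 / r) => x.
  have M0 : 0 <= M by apply: le_trans (gM 0).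
  have [x3|x3] := lerP 3 `|x|.
    by rewrite h0// normr0 divr_ge0 ?mulr_ge0// ltW.
  rewrite /h !normrM ler_pM//; last first.
    by rewrite normfV lef_pV2 ?posrE ?normr_gt0 ?gt_eqF// (gtr0_norm (mr x)) le_max lexx orbT.
  rewrite ler_pM// ger0_norm; last by have := sqr_ge0 x; lra.
  rewrite -(real_normK (num_real x)).
  have : `|x| ^+ 2 <= 3 ^+ 2 by rewrite lerXn2r ?nnegrE// ltW.
  lra.
have [p hp] := approx ch hb h0 e2.
exists (fun x => x * u x * p.[u x]) => // x.
have xu : `|x * u x| <= 1 by have := @odd_le 0 x (lexx _); rewrite addr0.
have hE : x * u x * h `|x| = g x * (`|x| / Num.max `|x| r).
  have a0 : x ^+ 2 + 16 != 0 by have := @den_gt0 0 x (lexx _); rewrite addr0 => /gt_eqF ->.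
  have b0 : Num.max `|x| r != 0 by rewrite gt_eqF.
  rewrite /h /u normr_id real_normK ?num_real//.
  case: (lerP 0 x) => x0.
    by move: b0; rewrite (ger0_norm x0); move: (Num.max _ _) => q q0; field; rewrite a0 q0.
  move: b0; rewrite (ltr0_norm x0) go; move: (Num.max _ _) => q q0; field; by rewrite a0 q0.
rewrite -(subrKA (x * u x * h `|x|)) (le_trans (ler_normD _ _))// (splitr e) lerD//; last first.
  by rewrite -mulrBr normrM (le_trans _ (hp x))// ler_piMl.
rewrite hE -{1}[g x]mulr1 -mulrBr normrM.
have [xr|xr] := lerP `|x| r.
  rewrite (le_trans _ (hr x xr))// ler_piMr//.
  have q1 : `|x| / r <= 1 by rewrite ler_pdivrMr// mul1r.
  have q0 : 0 <= `|x| / r by rewrite divr_ge0// ltW.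
  rewrite ger0_norm; lra.
rewrite divff ?subrr ?normr0 ?mulr0 ?(ltW e2)//.
by rewrite gt_eqF// (lt_trans r0).
Qed.

Let compact_part g : bounded_continuous g -> (forall x, 3 <= `|x| -> g x = 0) -> converges g.
Proof.
move=> bg g0; have bgo := bounded_continuous_opp bg.
have bc := bounded_continuous_cst 2^-1.
rewrite (_ : g = fun x => 2^-1 * (g x + g (- x)) + 2^-1 * (g x - g (- x))); last first.
  by apply/funext => x; field.
apply: convergesD.
- apply: even_part.
  + by apply: bounded_continuousM => //; exact: bounded_continuousD.
  + by move=> x; rewrite opprK addrC.
  + by move=> x x3; rewrite !g0 ?normrN// addr0 mulr0.
- apply: odd_part.
  + by apply: bounded_continuousM => //; exact: bounded_continuousB.
  + by move=> x; rewrite opprK; ring.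
  + by move=> x x3; rewrite !g0 ?normrN// subr0 mulr0.
Qed.

Hypothesis supp : forall f, bounded_continuous f -> (forall x, `|x| <= 2 -> f x = 0) -> L f = 0.

Theorem weak_convergence f : bounded_continuous f -> (fun n => L_ n f) @ \oo --> L f.
Proof.
(* A cut-off that is [1] where [|x| <= 2] and [0] where [|x| >= 3]. *)
move=> bf; pose chi (x : R) := Num.max (Num.min (3 - `|x|) 1) 0.
have chi01 x : 0 <= chi x <= 1.
  by rewrite /chi le_max lexx orbT/= ge_max ler01 andbT ge_min lexx orbT.
have bchi : bounded_continuous chi.
  split; last by exists 1 => x; have /andP[a b] := chi01 x; rewrite ger0_norm.
  move=> x; apply: (@continuous_max R R (fun x => Num.min (3 - `|x|) 1) (fun=> 0) x); last exact: cst_continuous.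
  apply: (@continuous_min R R (fun x => 3 - `|x|) (fun=> 1) x); last exact: cst_continuous.
  by apply: continuousB; [exact: cst_continuous|exact: norm_continuous].
have chi0 x : 3 <= `|x| -> chi x = 0.
  by move=> x3; rewrite /chi max_r// ge_min subr_le0 x3.
have chi1 x : `|x| <= 2 -> chi x = 1.
  by move=> x2; rewrite /chi min_r ?max_l//; lra.
have b1 := bounded_continuous_cst (1 : R).
have b1c := bounded_continuousB b1 bchi.
have bfc := bounded_continuousM bf bchi.
have [_ cchi] := compact_part bchi chi0.
have [_ cfc] : converges (fun x => f x * chi x).
  by apply: compact_part => // x x3; rewrite chi0// mulr0.
have Lchi : L chi = 1.
  have : L (fun x => 1 - chi x) = 0 by apply: supp => // x /chi1 ->; rewrite subrr.
  by rewrite averagingB// averaging_cst//; lra.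
have Lf : L f = L (fun x => f x * chi x).
  have : L (fun x => f x - f x * chi x) = 0.
    by apply: supp => [|x /chi1 ->]; [exact: bounded_continuousB|rewrite mulr1 subrr].
  by rewrite averagingB//; lra.
have [M fM] := bf.2; have M0 : 0 <= M by apply: le_trans (fM 0).
(* Tightness: the mass lost by the cut-off is [1 - L_n chi], which tends to [1 - L chi = 0]. *)
have close n : `|L_ n f - L_ n (fun x => f x * chi x)| <= M * (1 - L_ n chi).
  rewrite -averagingB// (_ : M * _ = L_ n (fun x => M * (1 - chi x))); last first.
    by rewrite averagingZ// averagingB// averaging_cst.
  apply: averaging_norm_le => //; first exact: bounded_continuousB.
    by apply: bounded_continuousM => //; exact: bounded_continuous_cst.
  move=> x; have /andP[a b] := chi01 x; rewrite -{1}[f x]mulr1 -mulrBr normrM ler_pM//.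
  by rewrite ger0_norm// subr_ge0.
apply/cvgrPdist_le => e e0.
have e2 : 0 < e / 2 by rewrite divr_gt0.
have e3 : 0 < e / (2 * (M + 1)) by rewrite divr_gt0// mulr_gt0// ltr_wpDl.
move/cvgrPdist_le/(_ _ e2) : cfc; move/cvgrPdist_le/(_ _ e3) : cchi.
apply: filterS2 => n h1 h2; rewrite Lf.
rewrite -(subrKA (L_ n (fun x => f x * chi x))) (le_trans (ler_normD _ _))// (splitr e) lerD//.
rewrite distrC (le_trans (close n))//; move: h1; rewrite Lchi => /(le_trans (ler_norm _)) h1.
apply: (@le_trans _ _ (M * (e / (2 * (M + 1))))); first by rewrite ler_wpM2l.
rewrite mulrA ler_pdivrMr; last by rewrite mulr_gt0// ltr_wpDl.
nra.
Qed.

End WeakConvergence.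

End BoundedContinuous.

(** * Almost sure convergence *)

Section BorelCantelli.
Context (R : realType) (d : measure_display) (T : measurableType d).
Variable P : probability T R.

Lemma borel_cantelli_geometric (A : (set T)^nat) (x : R) : (forall k, measurable (A k)) ->
  0 < x < 1 -> (forall k, (P (A k) <= (x ^+ k)%:E)%E) -> {ae P, forall w, \forall k \near \oo, ~ A k w}.
Proof.
move=> mA /andP[x0 x1] PA.
have nx : `|x| < 1 by rewrite gtr0_norm.
have S : (\sum_(0 <= k <oo) P (A k) < +oo)%E.
  apply: (@le_lt_trans _ _ ((1 - x)^-1)%:E); last exact: ltry.
  apply: lime_le; first exact: is_cvg_nneseries.
  apply: nearW => k; apply: (@le_trans _ _ (\sum_(0 <= i < k) (x ^+ i)%:E)%E).
    by apply: lee_sum => i _; exact: PA.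
  rewrite sumEFin lee_fin.
  have := @geometric_le_lim R k 1 x ler01 x0 nx; rewrite mul1r; apply: le_trans.
  by rewrite /series/= le_eqVlt; apply/orP; left; apply/eqP; apply: eq_bigr => i _; rewrite mul1r.
exists (lim_sup_set A); split.
- apply: bigcap_measurable => // n _; apply: bigcup_measurable => k _; exact: mA.
- exact: lim_sup_set_cvg0.
- move=> w /= h n _; apply: contrapT => hn; apply: h; exists n => // k /= nk Ak.
  by apply: hn; exists k.
Qed.

Variables (W : forall n : nat, T -> 'M[R]_n.+1).
Hypotheses (mW : forall n, mx_measurable (W n)) (symW : forall n, mx_symmetric (W n)).
Hypothesis indW : forall n, upper_independent P (W n).

(** Taking [c = 1 / (n + 1)] and [l = lam (n + 1)] in [tail_bound] gives tails below
    [exp (- kap n)], which are summable. Both signs of [F] and the countably many levels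
    [1 / (k + 1)] then yield the limit. *)
Lemma concentration_as (F : forall n, bmatrix R n.+1 -> R) (l : R) :
  (forall n, bmeas (F n)) ->
  (forall n (A B : bmatrix R n.+1) (k : 'I_n.+1),
    (forall i j, i != k -> j != k -> (A : 'M[R]_n.+1) i j = (B : 'M[R]_n.+1) i j) ->
    `|F n A - F n B| <= n.+1%:R^-1) ->
  (fun n => expect P (fun w => F n (W n w))) @ \oo --> l ->
  {ae P, forall w, (fun n => F n (W n w)) @ \oo --> l}.
Proof.
move=> bF Fdiff mean.
have bFW n := bmeas_mx (@mW n) (bF n).
pose m n := expect P (fun w => F n (W n w)).
have one_side (G : forall n, bmatrix R n.+1 -> R) e : (forall n, bmeas (G n)) ->
  (forall n (A B : bmatrix R n.+1) (k : 'I_n.+1),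
    (forall i j, i != k -> j != k -> (A : 'M[R]_n.+1) i j = (B : 'M[R]_n.+1) i j) ->
    `|G n A - G n B| <= n.+1%:R^-1) -> 0 < e ->
  {ae P, forall w, \forall n \near \oo, G n (W n w) - expect P (fun w => G n (W n w)) < e}.
  move=> bG Gdiff e0.
  have bGW n : bmeas (fun w => G n (W n w) - expect P (fun w => G n (W n w))).
    by apply: bmeasB; [exact: (bmeas_mx (@mW n) (bG n))|exact: bmeas_cst].
  pose A n := [set w | e <= G n (W n w) - expect P (fun w => G n (W n w))].
  have mA n : measurable (A n) by exact: measurable_superlevel (bGW n).1.
  (* [lam <= 1 / 2] is the range of [tail_bound]; [lam <= e / 4] makes the exponent
     [(n + 1) lam (2 lam - e)] at most [- (n + 1) kap]. *)
  pose lam := Num.min 2^-1 (e / 4); pose kap := lam * e / 2.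
  have lam0 : 0 < lam by rewrite lt_min invr_gt0 ltr0n/= divr_gt0.
  have kap0 : 0 < kap by rewrite divr_gt0// mulr_gt0.
  have lam2 : lam <= 2^-1 by rewrite ge_min lexx.
  have lame : lam <= e / 4 by rewrite ge_min lexx orbT.
  have PA n : (P (A n) <= ((expR (- kap)) ^+ n)%:E)%E.
    rewrite -[leLHS]fineK; last exact: fin_num_measure.
    rewrite lee_fin -expect_indic//.
    have N0 : 0 < n.+1%:R :> R by rewrite ltr0n.
    have lc : lam * n.+1%:R * n.+1%:R^-1 = lam by rewrite mulfK// gt_eqF.
    have l0 : 0 <= lam * n.+1%:R by rewrite mulr_ge0// ltW.
    have lc2 : lam * n.+1%:R * n.+1%:R^-1 <= 2^-1 by rewrite lc.
    have tb := tail_bound (@mW n) (@symW n) (@indW n) (bG n) (Gdiff n) e l0 lc2.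
    apply: le_trans tb _.
    rewrite -expRM_natl ler_expR lc -mulr_natl.
    have n1 : n%:R <= n.+1%:R :> R by rewrite ler_nat.
    have n0 : 0 <= n%:R :> R by [].
    have h : lam * (2 * lam - e) <= - kap by rewrite /kap; nra.
    rewrite (_ : _ - _ = n.+1%:R * (lam * (2 * lam - e))); last by ring.
    apply: (@le_trans _ _ (n.+1%:R * - kap)); first by rewrite ler_wpM2l.
    by rewrite ler_nM2r// oppr_lt0.
  have := @borel_cantelli_geometric A (expR (- kap)) mA _ PA.
  rewrite expR_gt0 expR_lt1 oppr_lt0 => /(_ kap0); apply: filterS => w.
  by apply: filterS => n /negP; rewrite -ltNge.
have both k : {ae P, forall w, \forall n \near \oo, `|F n (W n w) - m n| < k.+1%:R^-1}.
  have k0 : 0 < k.+1%:R^-1 :> R by rewrite invr_gt0.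
  have h1 := one_side F _ bF Fdiff k0.
  have h2 := one_side (fun n M => - F n M) _ (fun n => bmeasN (bF n)) _ k0.
  apply: filterS2 h1 (h2 _) => [w a b|n A B q AB].
    move: a b; apply: filterS2 => n a; rewrite (expectN P (bFW n)) -/(m n) => b.
    move: a b; rewrite -/(m n); move: (F n (W n w)) (m n) (k.+1%:R^-1 : R) => p q z a b.
    by rewrite ltr_norml; apply/andP; split; lra.
  by rewrite -opprD normrN; exact: (Fdiff n A B q AB).
have := ae_foralln both; apply: filterS => w h.
apply/cvgrPdist_lt => e e0.
have [k hk] : exists k : nat, k.+1%:R^-1 <= e / 2.
  exists (Num.truncn (2 / e)); rewrite invf_ple ?posrE ?divr_gt0// invf_div.
  by rewrite ltW// truncnS_gt.
have /cvgrPdist_lt/(_ (e / 2)) := mean; rewrite divr_gt0// => /(_ isT) hm.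
have hF := h k; move: hm hF; apply: filterS2 => n hm hF.
rewrite -(subrKA (m n)) (le_lt_trans (ler_normD _ _))// (splitr e) ltrD// distrC.
exact: lt_le_trans hF hk.
Qed.

End BorelCantelli.

(** * Almost sure limits of the normalized traces *)

Section TraceLimits.
Context (R : realType) (d : measure_display) (T : measurableType d).
Variables (P : probability T R) (W : forall n : nat, T -> 'M[R]_n.+1).
Hypotheses (mW : forall n, mx_measurable (W n)) (symW : forall n, mx_symmetric (W n)).
Hypothesis indW : forall n, upper_independent P (W n).
Hypothesis lawW : forall n i j, symmetric_law P (fun w => W n w i j).
Hypothesis Hentry : forall f : R -> R, bounded_continuous f -> forall e : R, 0 < e ->
  \forall n \near \oo, forall i j, `|expect P (fun w => f (W n w i j)) - f 0| <= e.
Hypothesis Hrow : forall (f : R -> R) (l : R), bounded_continuous f ->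
  (\int[lebesgue_measure]_x (f x * normal_pdf 0 1 x)%:E)%E = l%:E -> forall e : R, 0 < e ->
  \forall n \near \oo, forall i, `|expect P (fun w => f (\sum_j W n w i j)) - l| <= e.
Variable y : R.
Hypothesis y4 : 4 <= y.

Let y0 : 0 < y. Proof. exact: lt_le_trans y4. Qed.

(** The concentration bound compares arbitrary matrices; composing with [symm] puts the resolvent
    estimates at its disposal. *)
Let tr_re n (M : bmatrix R n.+1) : R := n.+1%:R^-1 * \tr (res_re y (symm (M : 'M[R]_n.+1))).
Let tr_im n (M : bmatrix R n.+1) : R := n.+1%:R^-1 * \tr (res_im y (symm (M : 'M[R]_n.+1))).

Let symm_res n (M : 'M[R]_n.+1) := resolvent_exists y0 (symm_tr M).

Let bmeas_tr (g : forall n, 'M[R]_n.+1 -> 'M[R]_n.+1) n :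
  (forall i j, measurable_fun [set: bmatrix R n.+1] (fun M : bmatrix R n.+1 => g n (symm (M : 'M[R]_n.+1)) i j)) ->
  (forall (M : 'M[R]_n.+1) i j, `|g n (symm M) i j| <= y^-1) ->
  bmeas (fun M : bmatrix R n.+1 => n.+1%:R^-1 * \tr (g n (symm (M : 'M[R]_n.+1)))).
Proof.
move=> mg gy; apply: bmeasM; first exact: bmeas_cst.
by apply: bmeas_sum => i _; split => //; exists y^-1 => M.
Qed.

Let btr_re n : bmeas (@tr_re n).
Proof.
apply: (@bmeas_tr (fun n => res_re y)) => [i j|M i j].
  by apply: measurable_res_re => // k l; exact: measurable_symm.
by have [] := resolvent_entry_le y0 (symm_res M) i j.
Qed.

Let btr_im n : bmeas (@tr_im n).
Proof.
apply: (@bmeas_tr (fun n => res_im y)) => [i j|M i j].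
  by apply: measurable_res_im => // k l; exact: measurable_symm.
by have [] := resolvent_entry_le y0 (symm_res M) i j.
Qed.

Let tr_diff n (A B : 'M[R]_n.+1) (k : 'I_n.+1) : (forall i j, i != k -> j != k -> A i j = B i j) ->
  `|tr_re A - tr_re B| <= n.+1%:R^-1 /\ `|tr_im A - tr_im B| <= n.+1%:R^-1.
Proof.
move=> AB; have AB' i j : i != k -> j != k -> symm A i j = symm B i j.
  by move=> ik jk; rewrite !mxE !AB.
have [h1 h2] := row_change_trace y0 (symm_res B) (symm_res A) AB'.
have y1 : 4 / y <= 1 by rewrite ler_pdivrMr// mul1r.
have N0 : 0 <= n.+1%:R^-1 :> R by rewrite invr_ge0.
split; rewrite /tr_re /tr_im -mulrBr normrM (ger0_norm N0) ler_piMr//.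
  exact: le_trans h1 y1.
exact: le_trans h2 y1.
Qed.

Let be : R := (Num.sqrt (y ^+ 2 + 4) - y) / 2.

Let sqE : Num.sqrt (y ^+ 2 + 4) ^+ 2 = y ^+ 2 + 4.
Proof. by rewrite sqr_sqrtr// addr_ge0// sqr_ge0. Qed.

Let beE : y * be + be ^+ 2 = 1.
Proof.
rewrite /be; move: sqE; move: (Num.sqrt _) => q qE.
by rewrite expr_div_n sqrrB qE; field.
Qed.

Let be0 : 0 <= be.
Proof.
rewrite divr_ge0// subr_ge0 -[leLHS]ger0_norm ?(ltW y0)// -sqrtr_sqr ler_wsqrtr//.
by rewrite lerDl.
Qed.

Let bey : be <= y^-1.
Proof.
rewrite -[leRHS]mul1r ler_pdivlMr// mulrC -[leRHS]beE lerDl.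
exact: sqr_ge0.
Qed.

(** The diagonal errors control the trace of the truncated resolvent. Undoing the truncation costs
    at most [1] per changed row, since [4 / y <= 1], and the changed rows are at most as many as the
    entries above the truncation level. *)
Let mean_traces e : 0 < e -> \forall n \near \oo,
  `|expect P (fun w => tr_re (W n w))| <= e /\ `|expect P (fun w => tr_im (W n w)) - be| <= e.
Proof.
(* [r] is both truncation level and tolerance: a row costs [2 r + r^2] on the diagonal and [r] for
   its tail, together at most [4 r <= e / 2]. *)
move=> e0; pose r := Num.min 2^-1 (e / 8).
have r0 : 0 < r by rewrite lt_min invr_gt0 ltr0n/= divr_gt0.
have r2 : r <= 2^-1 by rewrite ge_min lexx.
have re : r <= e / 8 by rewrite ge_min lexx orbT.
have r1 : r <= 1 by lra.
have r0' := ltW r0.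
have := row_variance mW symW indW lawW Hentry Hrow r0 r0.
have := row_tail mW symW indW lawW Hentry Hrow r0 r0.
apply: filterS2 => n hT hV.
have N0 : 0 < n.+1%:R :> R by rewrite ltr0n.
pose V w := truncate_mx r (W n w).
have VT w : (V w)^T = V w by rewrite map_trmx symW.
have Vr w := resolvent_exists y0 (VT w).
have Wr w := resolvent_exists y0 (@symW n w).
have diag := mean_diagonal (@mW n) (@symW n) (@indW n) (@lawW n) r0' r1 y4 be0 bey beE hV r2.
pose X i w := `|res_re y (V w) i i| + `|res_im y (V w) i i - be|.
have bre i : bmeas (fun w => res_re y (V w) i i) := bmeas_res_re (@mW n) (@symW n) r0' y4 i i.
have bim i : bmeas (fun w => res_im y (V w) i i) := bmeas_res_im (@mW n) (@symW n) r0' y4 i i.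
have bX i : bmeas (X i).
  by apply: bmeasD; apply: bmeas_norm => //; apply: bmeasB => //; exact: bmeas_cst.
pose tl i j w : R := \1_[set w | r < `|W n w i j|] w.
have btl i j : bmeas (tl i j) by apply: bmeas_tail; exact: mW.
pose B w := n.+1%:R^-1 * (\sum_i X i w + \sum_i \sum_j tl i j w).
have bS1 : bmeas (fun w => \sum_i X i w) by exact: bmeas_sum.
have bS2 : bmeas (fun w => \sum_i \sum_j tl i j w) by apply: bmeas_sum => i _; exact: bmeas_sum.
have bS := bmeasD bS1 bS2.
have bB : bmeas B by apply: bmeasM => //; exact: bmeas_cst.
have EB : expect P B <= e.
  rewrite (expectZ P _ bS) (expectD P bS1 bS2) expect_sum// expect_sum; last by move=> i _; exact: bmeas_sum.
  have -> : \sum_i expect P (fun w => \sum_j tl i j w) = \sum_i \sum_j tail P r (fun w => W n w i j).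
    by apply: eq_bigr => i _; rewrite expect_sum.
  rewrite mulrC ler_pdivrMr// -big_split/=.
  apply: (@le_trans _ _ (\sum_(i < n.+1) e)).
    apply: ler_sum => i _; have := hT i; have := diag i; have : r ^+ 2 <= r by rewrite expr2 ler_piMr.
    by rewrite -/(V _) -/(X i); lra.
  by rewrite sumr_const card_ord mulr_natr.
have changed w : (\sum_i [exists j, V w i j != W n w i j])%:R <= \sum_i \sum_j tl i j w.
  rewrite natr_sum; apply: ler_sum => i _; case: existsP => [[j hj]|_]; last first.
    by apply: sumr_ge0 => j _; rewrite /tl indic_tail; case: ifP.
  rewrite (bigD1 j)//= -[leLHS]addr0 lerD//; last first.
    by apply: sumr_ge0 => k _; rewrite /tl indic_tail; case: ifP.
  rewrite /tl indic_tail; case: ltP => // h; move: hj.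
  by rewrite mxE /truncate h eqxx.
have y1 : 4 / y <= 1 by rewrite ler_pdivrMr// mul1r.
have tl0 w : 0 <= \sum_i \sum_j tl i j w by exact: le_trans (changed w).
have trW w : `|\tr (res_re y (V w)) - \tr (res_re y (W n w))| <= \sum_i \sum_j tl i j w /\
    `|\tr (res_im y (V w)) - \tr (res_im y (W n w))| <= \sum_i \sum_j tl i j w.
  have [h1 h2] := rows_change_trace y0 (Wr w) (Vr w).
  have h : 4 / y * (\sum_i [exists j, V w i j != W n w i j])%:R <= \sum_i \sum_j tl i j w.
    apply: le_trans (changed w); rewrite ler_piMl//.
  by split; [exact: le_trans h1 h|exact: le_trans h2 h].
have N1 : 0 <= n.+1%:R^-1 :> R by rewrite invr_ge0.
have b1 := bmeas_mx (@mW n) (@btr_re n); have b2 := bmeas_mx (@mW n) (@btr_im n).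
split.
  apply: le_trans EB; apply: le_trans (expect_norm P b1) _.
  apply: expect_le => //; first exact: bmeas_norm.
  move=> w; rewrite /tr_re /B symm_id; last exact: symW.
  rewrite normrM (ger0_norm N1) ler_wpM2l// [leRHS]addrC.
  have [h1 _] := trW w.
  rewrite -(subrK (\tr (res_re y (V w))) (\tr (res_re y (W n w)))).
  rewrite (le_trans (ler_normD _ _))// lerD//; first by rewrite distrC.
  apply: le_trans (ler_norm_sum _ _ _) _; apply: ler_sum => i _.
  by rewrite lerDl.
have b3 : bmeas (fun w => tr_im (W n w) - be) by apply: bmeasB => //; exact: bmeas_cst.
rewrite -[X in _ - X](expect_cst P) -expectB//; last exact: bmeas_cst.
apply: le_trans EB; apply: le_trans (expect_norm P b3) _.
apply: expect_le => //; first exact: bmeas_norm.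
move=> w; rewrite /tr_im /B symm_id; last exact: symW.
have -> : n.+1%:R^-1 * \tr (res_im y (W n w)) - be = n.+1%:R^-1 * (\tr (res_im y (W n w)) - n.+1%:R * be).
  by rewrite mulrBr mulKf// gt_eqF.
rewrite normrM (ger0_norm N1) ler_wpM2l// [leRHS]addrC.
have [_ h1] := trW w.
rewrite -(subrKA (\tr (res_im y (V w)))) (le_trans (ler_normD _ _))// lerD//; first by rewrite distrC.
have -> : \tr (res_im y (V w)) - n.+1%:R * be = \sum_i (res_im y (V w) i i - be).
  by rewrite sumrB sumr_const card_ord mulr_natl.
apply: le_trans (ler_norm_sum _ _ _) _; apply: ler_sum => i _.
by rewrite lerDr.
Qed.

Lemma resolvent_trace_as : {ae P, forall w,
  (fun n => n.+1%:R^-1 * \tr (res_re y (W n w))) @ \oo --> (0 : R) /\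
  (fun n => n.+1%:R^-1 * \tr (res_im y (W n w))) @ \oo --> (Num.sqrt (y ^+ 2 + 4) - y) / 2}.
Proof.
have h1 : {ae P, forall w, (fun n => tr_re (W n w)) @ \oo --> (0 : R)}.
  apply: concentration_as => //.
    by move=> n A B k AB; have [] := tr_diff AB.
  apply/cvgrPdist_le => e e0; have := mean_traces e0; apply: filterS => n [+ _].
  by rewrite sub0r normrN.
have h2 : {ae P, forall w, (fun n => tr_im (W n w)) @ \oo --> be}.
  apply: concentration_as => //.
    by move=> n A B k AB; have [] := tr_diff AB.
  apply/cvgrPdist_le => e e0; have := mean_traces e0; apply: filterS => n [_].
  by rewrite distrC.
apply: filterS2 h1 h2 => w h1 h2.
have E n : symm (W n w) = W n w by apply: symm_id; exact: symW.
move: h1 h2; rewrite /tr_re /tr_im.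
by under eq_fun do rewrite E; under [in X in _ -> X -> _]eq_fun do rewrite E.
Qed.

End TraceLimits.

(** * The semicircle law as a functional *)

Section SemicircleAverage.
Context (R : realType).
Let mu := @lebesgue_measure R.

Definition semicircle_mean (f : R -> R) : R := \int[mu]_x (f x * semicircle_density x).

Let mdens : measurable_fun setT (@semicircle_density R).
Proof. by apply: continuous_measurable_fun; exact: continuous_semicircle_density. Qed.

Let int_density : mu.-integrable setT (EFin \o (@semicircle_density R)).
Proof.
apply/integrableP; split; first exact/measurable_EFinP.
under eq_integral do rewrite /= ger0_norm ?semicircle_density_ge0//.
by rewrite semicircle_mass ltry.
Qed.

Lemma integrable_semicircle (f : R -> R) : bounded_continuous f ->
  mu.-integrable setT (fun x => (f x * semicircle_density x)%:E).
Proof.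
move=> [cf [M fM]].
have iM : mu.-integrable setT (fun x => (M * semicircle_density x)%:E).
  by under eq_fun do rewrite EFinM; exact: integrableZl.
apply: (@le_integrable _ (measurableTypeR R) R mu setT measurableT _ _ _ _ iM).
  apply/measurable_EFinP; apply: measurable_funM => //.
  exact: continuous_measurable_fun.
move=> x _ /=; rewrite lee_fin normrM [leRHS]normrM ler_wpM2r//.
by rewrite (le_trans (fM x))// ler_norm.
Qed.

Lemma semicircle_meanE f : bounded_continuous f ->
  (\int[mu]_x (f x * semicircle_density x)%:E)%E = (semicircle_mean f)%:E.
Proof.
move=> bf; rewrite /semicircle_mean /Rintegral fineK//.
exact: integrable_fin_num (integrable_semicircle bf).
Qed.

Lemma averaging_semicircle : averaging semicircle_mean.
Proof.
split.
- move=> f g a bf bg; rewrite /semicircle_mean -RintegralZl//; last exact: integrable_semicircle.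
  have iaf : mu.-integrable setT (fun x => (a * (f x * semicircle_density x))%:E).
    by under eq_fun do rewrite EFinM; apply: integrableZl => //; exact: integrable_semicircle.
  rewrite -RintegralD//; last exact: integrable_semicircle.
  by apply: eq_Rintegral => x _; ring.
- move=> f bf f0; apply: Rintegral_ge0 => x _.
  by rewrite mulr_ge0 ?semicircle_density_ge0.
- rewrite /semicircle_mean /Rintegral; under eq_integral do rewrite mul1r.
  by rewrite semicircle_mass.
Qed.

Lemma semicircle_mean_supp (f : R -> R) : bounded_continuous f ->
  (forall x, `|x| <= 2 -> f x = 0) -> semicircle_mean f = 0.
Proof.
move=> bf f0; rewrite /semicircle_mean /Rintegral (eq_integral (cst 0%E)); first by rewrite integral0.
move=> x _ /=; congr EFin; have [/f0 ->|/semicircle_density_out ->] := lerP `|x| 2; first by rewrite mul0r.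
by rewrite mulr0.
Qed.

End SemicircleAverage.

Lemma averaging_esd (R : realType) (n : nat) (A : 'M[R]_n.+1) : A^T = A -> averaging (esd_integral A).
Proof.
(* Only the number of eigenvalues is taken from here, so any positive [y] serves. *)
move=> AT; have [sz _ _] := eigvals_trace AT (@ltr01 R).
have N0 : n.+1%:R != 0 :> R by rewrite pnatr_eq0.
split.
- move=> f g a _ _; rewrite /esd_integral big_split/= -big_distrr/=; ring.
- by move=> f _ f0; rewrite /esd_integral mulr_ge0 ?invr_ge0// sumr_ge0.
- by rewrite /esd_integral big_const_seq count_predT sz iter_addr_0 mulVf.
Qed.

Theorem theorem5p2 (R : realType) (d : measure_display) (T : measurableType d)
  (P : probability T R)
  (* W n is the random (n+1) x (n+1) matrix W_{n+1} *)
  (W : forall n : nat, T -> 'M[R]_n.+1)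
  (Wmeas : forall n (i j : 'I_n.+1), measurable_fun setT (fun w => W n w i j))
  (Wsym : forall n w, (W n w)^T = W n w)
  (Windep : forall n (B : 'I_n.+1 -> 'I_n.+1 -> set R),
      (forall i j, measurable (B i j)) ->
      P [set w | forall i j : 'I_n.+1, (i <= j)%N -> B i j (W n w i j)] =
      (\prod_(i < n.+1) \prod_(j < n.+1 | (i <= j)%N)
          P [set w | B i j (W n w i j)])%E)
  (Wsymdist : forall n (i j : 'I_n.+1) (B : set R), measurable B ->
      P [set w | B (W n w i j)] = P [set w | B (- W n w i j)])
  (Hentry : forall (I J : forall n, 'I_n.+1) (f : R -> R), bounded_continuous f ->
      (fun n => \int[P]_w (f (W n w (I n) (J n)))%:E)%E @ \oo --> (f 0)%:E)
  (Hrow : forall (I : forall n, 'I_n.+1) (f : R -> R), bounded_continuous f ->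
      (fun n => \int[P]_w (f (\sum_(j < n.+1) W n w (I n) j))%:E)%E @ \oo -->
      (\int[lebesgue_measure]_x (f x * normal_pdf 0 1 x)%:E)%E) :
  {ae P, forall w, forall f : R -> R, bounded_continuous f ->
      (fun n => (esd_integral (W n w) f)%:E) @ \oo -->
      (\int[lebesgue_measure]_x (f x * semicircle_density x)%:E)%E}.
Proof.
have bcomp (f : R -> R) (X : T -> R) : bounded_continuous f -> measurable_fun setT X -> bmeas (fun w => f (X w)).
  by move=> [cf bf] mX; apply: bmeas_comp => //; exact: continuous_measurable_fun.
have entry f : bounded_continuous f -> forall e : R, 0 < e ->
    \forall n \near \oo, forall i j : 'I_n.+1, `|expect P (fun w => f (W n w i j)) - f 0| <= e.
  move=> bf e e0.
  have U := @uniform_of_choices R (fun n => ('I_n.+1 * 'I_n.+1)%type) (fun n => (ord0, ord0))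
    (fun n ij => expect P (fun w => f (W n w ij.1 ij.2))) (f 0).
  apply: filterS (U _ e e0) => [n h i j|ij]; first exact: (h (i, j)).
  have := Hentry (fun n => (ij n).1) (fun n => (ij n).2) f bf.
  have bE n : bmeas (fun w => f (W n w (ij n).1 (ij n).2)) by exact: bcomp.
  by under eq_fun do rewrite expectE//; move/fine_cvgP => [_].
have row f l : bounded_continuous f ->
    (\int[lebesgue_measure]_x (f x * normal_pdf 0 1 x)%:E)%E = l%:E -> forall e : R, 0 < e ->
    \forall n \near \oo, forall i : 'I_n.+1, `|expect P (fun w => f (\sum_j W n w i j)) - l| <= e.
  move=> bf lE e e0.
  apply: (@uniform_of_choices R (fun n => 'I_n.+1) (fun n => ord0)
    (fun n i => expect P (fun w => f (\sum_j W n w i j))) l) => // i; have := Hrow i f bf; rewrite lE.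
  have bS n : bmeas (fun w => f (\sum_j W n w (i n) j)).
    by apply: bcomp => //; apply: measurable_fun_sumR => j _; exact: Wmeas.
  by under eq_fun do rewrite expectE//; move/fine_cvgP => [_].
(* Enumerates the poles [0] and [1 / (m + 1)]; the corresponding [y k] is at least [4], as the
   resolvent estimates require. *)
pose pole k : R := if k is m.+1 then m.+1%:R^-1 else 0.
have pole0 k : 0 <= pole k by case: k => //= k; rewrite invr_ge0.
pose y k := Num.sqrt (16 + pole k).
have yE k : y k ^+ 2 = 16 + pole k by rewrite sqr_sqrtr// addr_ge0.
have y4 k : 4 <= y k.
  rewrite -(ler_pXn2r (n := 2))// ?nnegrE ?sqrtr_ge0// yE; have := pole0 k; lra.
(* One null set for all [k], fixed before [f], so the conclusion holds for all test functions
   simultaneously. *)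
have := ae_foralln (fun k => resolvent_trace_as Wmeas Wsym Windep Wsymdist entry row (y4 k)).
apply: filterS => w hw f bf.
rewrite semicircle_meanE//; apply/cvg_EFin; first exact: nearW.
have y0 k : 0 < y k by apply: lt_le_trans (y4 k).
have pick (t : R) : t = 0 \/ (exists m : nat, t = m.+1%:R^-1) -> exists k, t = pole k.
  by case=> [->|[m ->]]; [exists 0%N|exists m.+1].
apply: (@weak_convergence R (fun n => esd_integral (W n w)) (@semicircle_mean R)) => //.
- by move=> n; apply: averaging_esd.
- exact: averaging_semicircle.
- move=> _ /pick[k ->]; have [h _] := hw k.
  rewrite -yE (_ : semicircle_mean _ = 0).
    under eq_fun => n do (rewrite /esd_integral; have [_ -> _] := eigvals_trace (Wsym n w) (y0 k)).
    exact: h.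
  by rewrite /semicircle_mean /Rintegral semicircle_odd.
- move=> _ /pick[k ->]; have [_ h] := hw k.
  (* The imaginary part of the resolvent carries the kernel [y / (x^2 + y^2)], which is [y] times
     the function to be tested. *)
  have E (x : R) : (x ^+ 2 + (16 + pole k))^-1 = (y k)^-1 * (y k / (x ^+ 2 + y k ^+ 2)).
    by rewrite mulKf ?yE// gt_eqF.
  rewrite (_ : semicircle_mean _ = (y k)^-1 * ((Num.sqrt (y k ^+ 2 + 4) - y k) / 2)).
    have -> : (fun n => esd_integral (W n w) (fun x => (x ^+ 2 + (16 + pole k))^-1)) =
        (fun n => (y k)^-1 * (n.+1%:R^-1 * \tr (res_im (y k) (W n w)))).
      apply/funext => n; have [_ _ <-] := eigvals_trace (Wsym n w) (y0 k).
      rewrite /esd_integral mulrCA; congr (_ * _); rewrite big_distrr/=.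
      by apply: eq_bigr => x _; exact: E.
    by apply: cvgM => //; exact: cvg_cst.
  have -> : (y k)^-1 * ((Num.sqrt (y k ^+ 2 + 4) - y k) / 2) =
     (y k)^-1 * semicircle_mean (fun x => y k / (x ^+ 2 + y k ^+ 2)).
    by rewrite /semicircle_mean /Rintegral semicircle_poisson.
  have bc : bounded_continuous (fun x => y k / (x ^+ 2 + y k ^+ 2)).
    split; first exact: continuous_frac_even.
    exists (y k)^-1 => x; have d0 : 0 < x ^+ 2 + y k ^+ 2 by rewrite ltr_wpDl ?sqr_ge0 ?exprn_gt0.
    rewrite (ger0_norm (divr_ge0 (ltW (y0 k)) (ltW d0))) ler_pdivrMr// ler_pdivlMl//.
    by rewrite -expr2 lerDr sqr_ge0.
  rewrite -averagingZ//; last exact: averaging_semicircle.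
  by congr semicircle_mean; apply/funext => x; exact: E.
- by move=> g bg g0; exact: semicircle_mean_supp.
Qed.
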